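(* Let $\Omega\subset\mathbb{R}^n$ be a bounded open set, $s\in(0,1)$, and let $u$ be a weak solution of $$-\Delta u+(-\Delta)^s u=g(x,u)\ \text{ in }\Omega,\qquad u=0\ \text{ in }\mathbb{R}^n\setminus\Omega .$$ Assume that there exist $c>0$ and $q\in[1,2^*]$ such that $$|g(x,t)|\le c\,(1+|t|^{q-1})\quad\text{for a.e. }x\in\Omega,\ t\in\mathbb{R}.$$ Then $u\in L^\infty(\Omega)$. More precisely, there exists a constant $C_0=C_0(c,n,q,\Omega)>0$, independent of $u$, such that $$\|u\|_{L^\infty(\Omega)}\le C_0\Big(1+\int_\Omega|u|^{2^*\beta_1}\,dx\Big)^{\frac{1}{2^*(\beta_1-1)}},\qquad\text{where }\beta_1:=\frac{2^*+1}{2}.$$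
   Context: $2^*:=\frac{2n}{n-2}$ if $n>2$ and $2^*:=\infty$ if $n\le 2$. Set $[u]_s:=\big(\iint_{\mathbb{R}^{2n}}\frac{|u(x)-u(y)|^2}{|x-y|^{n+2s}}\,dx\,dy\big)^{1/2}$. The space $X_0^1$ consists of Lebesgue measurable $u:\mathbb{R}^n\to\mathbb{R}$ with $u|_\Omega\in H_0^1(\Omega)$ (the closure of $C_c^\infty(\Omega)$ in the $H^1(\Omega)$ norm), $[u]_s<\infty$ and $u=0$ a.e. in $\mathbb{R}^n\setminus\Omega$. A weak solution is a function $u\in X_0^1$ such that $$\int_\Omega\nabla u\cdot\nabla\varphi\,dx+\iint_{\mathbb{R}^{2n}}\frac{(u(x)-u(y))(\varphi(x)-\varphi(y))}{|x-y|^{n+2s}}\,dx\,dy=\int_\Omega g(x,u(x))\varphi(x)\,dx\quad\forall\varphi\in X_0^1$$ (the normalization constant in front of the fractional term is set to $1$).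
   Formalization: For n ≤ 2, where 2^* = ∞ makes the displayed estimate undefined, q is any finite number ≥ 1 and the estimate is stated with every finite p > 2, p ≥ q, in place of 2^* (C_0 then also depends on p). *)

(* Defs.v *)
From HB Require Import structures.
From mathcomp Require Import all_boot all_order all_algebra.
From mathcomp Require Import all_classical all_reals all_analysis.

Set Implicit Arguments.
Unset Strict Implicit.
Unset Printing Implicit Defensive.

Import Order.TTheory GRing.Theory Num.Theory.
Import numFieldNormedType.Exports.

Local Open Scope classical_set_scope.
Local Open Scope ring_scope.

Section borel_measure.
Context {R : realType}.

Definition cylinders n : set (set 'rV[R]_n) :=
  [set A | exists (i : 'I_n) (B : set R),
     measurable B /\ A = [set v : 'rV[R]_n | B (v ord0 i)]].

(* 'rV[R]_n with its Borel sigma-algebra. *)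
Definition borelRn n := g_sigma_algebraType (@cylinders n).

Lemma measurable_coord n (i : 'I_n) :
  measurable_fun setT (fun v : borelRn n => (v : 'rV[R]_n) ord0 i).
Proof.
by move=> _ B mB; rewrite setTI; apply: sub_sigma_algebra; exists i, B.
Qed.

Lemma measurable_fun_coordP d (T : measurableType d) n (f : T -> borelRn n) :
  (forall i : 'I_n, measurable_fun setT (fun x => (f x : 'rV[R]_n) ord0 i)) ->
  measurable_fun setT f.
Proof.
move=> mf; apply: (@measurability d (@cylinders n).-sigma T (borelRn n) setT f (@cylinders n)) => //.
move=> _ [_ [i [B [mB ->]]] <-]; exact: mf.
Qed.

Definition consRn n (z : measurableTypeR R * borelRn n) : borelRn n.+1 :=
  row_mx ((z.1 : R)%:M : 'M[R]_1) (z.2 : 'rV[R]_n).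

Definition unconsRn n (v : borelRn n.+1) : measurableTypeR R * borelRn n :=
  ((v : 'rV[R]_n.+1) ord0 ord0, rsubmx (v : 'rV[R]_(1 + n))).

Lemma consRnK n : cancel (@consRn n) (@unconsRn n).
Proof.
case=> a w; rewrite /consRn /unconsRn/=; congr pair; last exact: row_mxKr.
rewrite (_ : ord0 = lshift n (ord0 : 'I_1)); last exact/val_inj.
by rewrite [LHS]row_mxEl mxE.
Qed.

Lemma measurable_consRn n : measurable_fun setT (@consRn n).
Proof.
apply: measurable_fun_coordP => i.
have [j ij|j ij] := splitP (i : 'I_(1 + n)).
  have -> : i = lshift n j by apply/val_inj.
  rewrite (_ : (fun _ => _) = fst); first exact: measurable_fst.
  by apply/funext => z; rewrite [LHS]row_mxEl !ord1 mxE.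
have -> : i = rshift 1 j by apply/val_inj.
rewrite (_ : (fun _ => _) = (fun v : borelRn n => (v : 'rV[R]_n) ord0 j) \o snd).
  by apply: measurableT_comp; [exact: measurable_coord|exact: measurable_snd].
by apply/funext => z; rewrite [LHS]row_mxEr.
Qed.

Lemma measurable_unconsRn n : measurable_fun setT (@unconsRn n).
Proof.
apply/measurable_fun_pair => /=; first exact: measurable_coord.
apply: measurable_fun_coordP => i.
rewrite (_ : (fun _ => _) =
  (fun v : borelRn n.+1 => (v : 'rV[R]_n.+1) ord0 (rshift 1 i : 'I_(1 + n)))).
  exact: measurable_coord.
by apply/funext => v; rewrite mxE.
Qed.

Section succ.
Variables (n : nat) (m : {sigma_finite_measure set (borelRn n) -> \bar R}).

Definition leb_succ : set (borelRn n.+1) -> \bar R :=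
  pushforward (lebesgue_measure \x m)%E (@consRn n).

Let leb_succ0 : leb_succ set0 = 0%E.
Proof. by rewrite /leb_succ /pushforward preimage_set0 measure0. Qed.

Let leb_succ_ge0 A : (0 <= leb_succ A)%E.
Proof. by rewrite /leb_succ /pushforward; exact: measure_ge0. Qed.

Let leb_succ_sigma_additive : semi_sigma_additive leb_succ.
Proof.
have mc (A : set (borelRn n.+1)) : measurable A -> measurable (@consRn n @^-1` A).
  by move=> mA; rewrite -[_ @^-1` _]setTI; exact: measurable_consRn.
move=> F mF tF mUF; rewrite /leb_succ /pushforward preimage_bigcup.
apply: measure_semi_sigma_additive.
- by move=> k; exact: mc.
- apply/trivIsetP => /= i j _ _ ij; rewrite -preimage_setI.
  by move/trivIsetP : tF => /(_ _ _ _ _ ij) ->//; rewrite preimage_set0.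
- by rewrite -preimage_bigcup; exact: mc.
Qed.

HB.instance Definition _ := isMeasure.Build _ _ _ leb_succ
  leb_succ0 leb_succ_ge0 leb_succ_sigma_additive.

Let leb_succ_sigma_finite : sigma_finite setT leb_succ.
Proof.
have /sigma_finiteP[F [TF ndF Foo]] := sigma_finiteT (@lebesgue_measure R).
have /sigma_finiteP[G [TG ndG Goo]] := sigma_finiteT m.
exists (fun k => @unconsRn n @^-1` (F k `*` G k)).
  rewrite -preimage_bigcup (_ : \bigcup_i _ = setT) ?preimage_setT//.
  rewrite -setXTT TF TG predeqE => -[x y]; split.
    by move=> [k _ []/= ? ?]; split; exists k.
  move=> [/= [k _ Fkx] [l _ Gly]]; exists (maxn k l) => //; split.
  - by move: x Fkx; exact/subsetPset/ndF/leq_maxl.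
  - by move: y Gly; exact/subsetPset/ndG/leq_maxr.
move=> k; have [mF Fk] := Foo k; have [mG Gk] := Goo k; split.
  by rewrite -[_ @^-1` _]setTI; apply: measurable_unconsRn => //; exact: measurableX.
rewrite /leb_succ /pushforward -comp_preimage.
rewrite (_ : _ \o _ = id) ?preimage_id; last by apply/funext => z; exact: consRnK.
by rewrite product_measure1E// lte_mul_pinfty// ge0_fin_numE.
Qed.

HB.instance Definition _ := @Measure_isSigmaFinite.Build _ _ _ leb_succ
  leb_succ_sigma_finite.

End succ.

(* Iterated product of the one-dimensional Lebesgue measure. *)
Fixpoint borel_leb n : {sigma_finite_measure set (borelRn n) -> \bar R} :=
  if n is n'.+1 then leb_succ (borel_leb n') else \d_ ((0 : 'rV[R]_0) : borelRn 0).

(* 'rV[R]_n with its Lebesgue (i.e., completed Borel) sigma-algebra. *)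
Definition Rn n := caratheodory_type (mu_ext (borel_leb n)).

Definition leb n : set (Rn n) -> \bar R :=
  @completed_measure_extension _ _ _ (borel_leb n).

HB.instance Definition _ n := Measure.on (@leb n).

Let sigma_finite_leb n : sigma_finite setT (@leb n).
Proof. exact/completed_measure_extension_sigma_finite/sigma_finiteT. Qed.

HB.instance Definition _ n := @Measure_isSigmaFinite.Build _ _ _ (@leb n)
  (@sigma_finite_leb n).

End borel_measure.
Arguments leb {R} n.


Definition box (R : realType) n (a b : 'rV[R]_n) : set 'rV[R]_n :=
  [set v | forall i, v ord0 i \in `[a ord0 i, b ord0 i]].

Lemma measurable_box (R : realType) n (a b : 'rV[R]_n) :
  measurable (box a b : set (borelRn n)).
Proof.
rewrite (_ : box a b = \big[setI/setT]_(i < n)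
  [set v : 'rV[R]_n | v ord0 i \in `[a ord0 i, b ord0 i]]).
  apply: (@bigsetI_measurable _ (borelRn n)) => i _.
  by apply: sub_sigma_algebra; exists i, [set` `[a ord0 i, b ord0 i]]; split => //; exact: measurable_itv.
apply/seteqP; split => v.
  by move=> bv; elim/big_ind : _ => // i _ /=; rewrite (bv i).
move=> + i; rewrite (bigD1 i)//= => -[]//.
Qed.

Lemma leb_box (R : realType) n (a b : 'rV[R]_n) :
  (forall i, a ord0 i <= b ord0 i) ->
  leb n (box a b) = (\prod_(i < n) (b ord0 i - a ord0 i))%:E.
Proof.
move=> ab; rewrite /leb /completed_measure_extension.
rewrite measurable_mu_extE; last exact: measurable_box.
elim: n a b ab => [|n IH] a b ab /=.
  by rewrite big_ord0 diracE mem_set// => -[].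
rewrite /leb_succ /pushforward.
pose a' : 'rV[R]_n := \row_i a ord0 (lift ord0 i).
pose b' : 'rV[R]_n := \row_i b ord0 (lift ord0 i).
rewrite (_ : _ @^-1` _ = [set` `[a ord0 ord0, b ord0 ord0]] `*` box a' b').
  rewrite product_measure1E//; last exact: measurable_box.
  rewrite IH; last by move=> i; rewrite !mxE; exact: ab.
  rewrite [X in (X * _)%E](lebesgue_measure_itv `[a ord0 ord0, b ord0 ord0])/= lte_fin big_ord_recl EFinM.
  congr (_ * _)%E; last by congr EFin; apply: eq_bigr => i _; rewrite !mxE.
  case: ltP => // ba; rewrite (@le_anti _ _ (a ord0 ord0) (b ord0 ord0)) ?subrr//.
  by rewrite ab.
have c0 z : @consRn R n z ord0 ord0 = z.1.
  by rewrite -[in RHS](consRnK z).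
have cl z i : @consRn R n z ord0 (lift ord0 i) = (z.2 : 'rV[R]_n) ord0 i.
  have -> : lift ord0 i = rshift 1 i :> 'I_n.+1 by apply/val_inj.
  exact: (row_mxEr (z.1%:M : 'M[R]_1) (z.2 : 'rV[R]_n) ord0 i).
apply/seteqP; split => -[x y] /=.
  move=> bz; split; first by have := bz ord0; rewrite c0.
  by move=> i; rewrite !mxE; have := bz (lift ord0 i); rewrite cl.
move=> [/= xa by_] i; have [j|] := unliftP ord0 i; last by move->; rewrite c0.
by move->; rewrite cl; have := by_ j; rewrite !mxE.
Qed.

Section sobolev.
Context {R : realType} {n : nat}.
Implicit Types (Omega : set 'rV[R]_n) (f u v w phi : 'rV[R]_n -> R) (i : 'I_n).

Definition enorm (x : 'rV[R]_n) : R := Num.sqrt (\sum_(i < n) x ord0 i ^+ 2).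

Definition partial i f : 'rV[R]_n -> R := fun x => 'D_(delta_mx ord0 i) f x.

Definition smooth f : Prop :=
  forall s : seq 'I_n, continuous (foldr partial f s) /\
    forall i x, derivable (foldr partial f s) x (delta_mx ord0 i).

Definition Cc_infty Omega : set ('rV[R]_n -> R) :=
  [set phi | [/\ smooth phi, compact (closure [set x | phi x != 0])
           & closure [set x | phi x != 0] `<=` Omega]].

Definition L2 Omega f : Prop :=
  measurable_fun (Omega : set (Rn n)) f /\
  (\int[leb n]_(x in Omega) (f x ^+ 2)%:E < +oo)%E.

Definition is_weak_partial Omega i v w : Prop :=
  L2 Omega w /\
  forall phi, Cc_infty Omega phi ->
    \int[leb n]_(x in Omega) (v x * partial i phi x) =
    - \int[leb n]_(x in Omega) (w x * phi x).

Definition H1 Omega v : Prop :=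
  L2 Omega v /\ forall i, exists w, is_weak_partial Omega i v w.

(* A chosen representative, unique up to a null set when v is in H1. *)
Definition weak_partial Omega i v : 'rV[R]_n -> R :=
  xget (cst 0) [set w | is_weak_partial Omega i v w].

Definition H1norm Omega v : \bar R :=
  ((\int[leb n]_(x in Omega)
     (v x ^+ 2 + \sum_(i < n) weak_partial Omega i v x ^+ 2)%:E) `^ (2^-1)%R)%E.

Definition H10 Omega v : Prop :=
  H1 Omega v /\
  forall e : R, 0 < e ->
    exists2 phi, Cc_infty Omega phi & (H1norm Omega (v \- phi)%R < e%:E)%E.

Definition gagliardo (s : R) u : \bar R :=
  ((\int[leb n \x leb n]_z
     ((u z.1 - u z.2) ^+ 2 / enorm (z.1 - z.2) `^ (n%:R + 2 * s))%:E) `^ (2^-1)%R)%E.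

Definition X01 (s : R) Omega u : Prop :=
  [/\ measurable_fun (setT : set (Rn n)) u, H10 Omega u,
      (gagliardo s u < +oo)%E &
      {ae leb n, forall x, ~ Omega x -> u x = 0}].

(* Integrability of the right-hand side is part of the definition: no
   measurability is otherwise assumed on g. *)
Definition weak_solution (s : R) Omega (g : 'rV[R]_n -> R -> R) u : Prop :=
  X01 s Omega u /\
  forall phi, X01 s Omega phi ->
    (leb n).-integrable Omega (fun x => (g x (u x) * phi x)%:E) /\
    \int[leb n]_(x in Omega)
       (\sum_(i < n) weak_partial Omega i u x * weak_partial Omega i phi x)
    + \int[(leb n \x leb n)%E]_z
       ((u z.1 - u z.2) * (phi z.1 - phi z.2)
          / enorm (z.1 - z.2) `^ (n%:R + 2 * s))
    = \int[leb n]_(x in Omega) (g x (u x) * phi x).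

Definition Linfty_norm Omega u : \bar R :=
  ('N[leb n]_+oo[EFin \o (u \_ Omega)])%E.

Definition Linfty Omega u : Prop :=
  measurable_fun (Omega : set (Rn n)) u /\ (Linfty_norm Omega u < +oo)%E.

End sobolev.

Definition two_star (R : realType) (n : nat) : \bar R :=
  if (2 < n)%N then (2 * n%:R / (n%:R - 2))%:E else +oo%E.

(* The real exponent p used in the place of 2^*: it is 2^* when n > 2; when
   2^* is infinite, the formulas involving 2^* are read for every finite p
   with p > 2 and q <= p. *)
Definition critical_exponent (R : realType) (n : nat) (q p : R) : Prop :=
  if (2 < n)%N then p%:E = two_star R n else 2 < p /\ q <= p.

Definition growth (R : realType) (n : nat) (Omega : set 'rV[R]_n) (c q : R)
    (g : 'rV[R]_n -> R -> R) : Prop :=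
  {ae leb n, forall x, Omega x ->
     forall t : R, `|g x t| <= c * (1 + `|t| `^ (q - 1))}.

(* Main.v *)
(* For a nondecreasing smooth F with F(0) = 0 and bounded derivative, F(u) is an admissible test
   function; the fractional term is then nonnegative, which leaves
     int F'(u) |grad u|^2 <= int c (1 + |u|^(q-1)) |F(u)|.
   Taking for F a truncation of t |t|^(2 beta - 2), with h the same truncation of
   t |t|^(beta - 1), one has h'^2 <= beta^2 F', and the Sobolev inequality bounds the L^p norm of
   h(u), p = 2^*, by the right-hand side.  On the set where |u| is large the factor |u|^(p-2) is
   small in L^(p/(p-2)) and can be absorbed (Brezis-Kato), so that u lies in every L^r.  The
   truncation can then be removed, and with beta_(k+1) - 1 = (p/2) (beta_k - 1) the moments
   a_k = 1 + int |u|^(p beta_k) satisfy a_(k+1) <= (E^(k+1) a_k)^(p/2) with E independent of u.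
   Hence a_k <= (E^b a_0)^((p/2)^k), and Chebyshev's inequality for large k bounds |u| almost
   everywhere by (E^b a_0)^(1/(p (beta_1 - 1))).

   The Sobolev inequality is proved for test functions by the Gagliardo-Nirenberg argument, and
   carried over to H^1_0 by Fatou's lemma; the chain rule in H^1_0 is obtained by approximation,
   weak partial derivatives being unique by the fundamental lemma of the calculus of variations. *)
Require Import Defs.
From HB Require Import structures.
From mathcomp Require Import all_boot all_order all_algebra.
From mathcomp Require Import all_classical all_reals all_analysis.
From mathcomp Require Import measurable_realfun.
From mathcomp Require Import ring lra.

Set Implicit Arguments.
Unset Strict Implicit.
Unset Printing Implicit Defensive.

Import Order.TTheory GRing.Theory Num.Theory.
Import numFieldNormedType.Exports.

Local Open Scope classical_set_scope.
Local Open Scope ring_scope.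

(** * Smooth functions *)

Section directional_derivative.
Context {R : realType} {V : normedModType R}.
Implicit Types (f : V -> R) (g : R -> R).

(** Two obstacles shape the proof. Absorbing a term is legitimate only if it is finite, and the
    threshold beyond which [|u|^(p-2)] counts as small depends on [u]. Hence two passes: the first
    proves only that all moments are finite; the constant comes from the second, which bounds the
    right-hand side by a lower moment, absorbs nothing, and involves only [c], [p], the Sobolev
    constant and the measure of [Omega]. In the first pass the absorbed quantity is finite because a
    truncated power has linear growth and [u] lies in [L^p] by the Sobolev inequality. Moreover,
    test functions must have continuous partial derivatives of all orders, so the truncation has to
    be smooth too: it is made of real powers of [A + B t^2] with [A > 0], a family that reproduces
    itself under differentiation. Thus [F(phi_k)] is a test function whenever [phi_k] is one, and
    the chain rule passes to the limit without any mollification. *)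

Lemma is_derive_line f (x v : V) df :
  is_derive x v f df <-> is_derive (0 : R) 1 (fun h => f (h *: v + x)) df.
Proof.
have E : 'D_v f x = 'D_1 (fun h : R => f (h *: v + x)) 0.
  rewrite /derive; congr (lim (_ @[h --> 0^'])); apply/funext => h /=.
  by rewrite addr0 scale0r add0r [_%:A]mulr1.
split=> -[d1 d2].
  by split; [exact: (proj1 (@derivable1P R V R^o f x v) d1) | rewrite -E].
by split; [exact: (proj2 (@derivable1P R V R^o f x v) d1) | rewrite E].
Qed.

Lemma is_derive_comp f g (x v : V) df dg :
  is_derive x v f df -> is_derive (f x) 1 g dg ->
  is_derive x v (g \o f) (dg * df).
Proof.
move=> /is_derive_line hf hg; apply/is_derive_line.
have -> : (fun h : R => (g \o f) (h *: v + x)) = g \o (fun h : R => f (h *: v + x)).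
  by [].
by apply: is_derive1_comp; rewrite scale0r add0r.
Qed.

Lemma is_derive_continuous g (x dg : R) : is_derive x 1 g dg -> {for x, continuous g}.
Proof.
by case=> /derivable1_diffP dg1 _; exact: differentiable_continuous.
Qed.

(** Handles the point where a piecewise formula is glued: the bound forces [g 0 = 0] and makes the
    difference quotient at most [M |h|]. *)
Lemma is_derive0_quadratic g (M : R) :
  (forall t, `|t| <= 1 -> `|g t| <= M * t ^+ 2) -> is_derive (0 : R) 1 g 0.
Proof.
move=> gM.
have g0 : g 0 = 0.
  by apply/normr0_eq0/le_anti; rewrite normr_ge0 (le_trans (gM 0 _)) ?normr0// expr0n mulr0.
have c : h^-1 *: (g (h *: 1 + 0) - g 0) @[h --> (0:R)^'] --> (0 : R).
  apply: norm_cvg0; apply: (@squeeze_cvgr _ _ _ _ (cst 0) (fun h : R => M * `|h|)).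
  - near=> h.
    rewrite normr_ge0/= g0 subr0 addr0 [h *: 1]mulr1 normrM.
    have h1 : `|h| <= 1 by near: h; exact: dnbhs0_le.
    have h0 : 0 < `|h| by rewrite normr_gt0; near: h; exact: nbhs_dnbhs_neq.
    rewrite normfV ler_pdivrMl// (le_trans (gM h h1))// -[h ^+ 2]ger0_norm ?sqr_ge0//.
    by rewrite normrX expr2 mulrCA.
  - exact: cvg_cst.
  - rewrite -[X in _ --> X](mulr0 M); apply: cvgM; first exact: cvg_cst.
    rewrite -[X in _ --> X](@normr0 _ R); apply: cvg_norm; exact: cvg_within.
by split; [apply/cvg_ex; exists 0 | exact: cvg_lim].
Unshelve. all: by end_near. Qed.

End directional_derivative.

Section flat.
Context {R : realType}.
Implicit Types (c t : R) (k : nat).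

(* The parameter [k] makes the family stable under differentiation; as [c] tends to [0],
   products of such functions tend to indicators of open boxes. *)
Definition flat k c t : R := if 0 < t then t ^- k * expR (- (c / t)) else 0.

Lemma flat_ge0 k c t : 0 <= flat k c t.
Proof.
rewrite /flat; case: ifP => // t0.
by rewrite mulr_ge0// ?expR_ge0// invr_ge0 exprn_ge0// ltW.
Qed.

(** By [expR x >= x^(k+2) / (k+2)!] at [x = c / t]: the factor [t^-k] is compensated and two powers
    of [t] remain, which is what [is_derive0_quadratic] needs at the origin. *)
Lemma flat_quadratic k c : 0 < c -> exists M, forall t, `|flat k c t| <= M * t ^+ 2.
Proof.
move=> c0; exists ((k.+2)`!%:R / c ^+ k.+2) => t.
rewrite ger0_norm ?flat_ge0// /flat; case: ifPn => t0; last first.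
  by rewrite mulr_ge0 ?sqr_ge0// divr_ge0// exprn_ge0// ltW.
have ct : 0 < c / t by rewrite divr_gt0.
have E : (c / t) ^+ k.+2 / (k.+2)`!%:R <= expR (c / t).
  by apply: le_trans (expR_ge1Dxn k.+1 (ltW ct)); rewrite lerDr.
have X0 : 0 < (c / t) ^+ k.+2 / (k.+2)`!%:R.
  by rewrite divr_gt0 ?exprn_gt0// ltr0n fact_gt0.
rewrite expRN.
apply: (@le_trans _ _ (t ^- k * ((c / t) ^+ k.+2 / (k.+2)`!%:R)^-1)).
  by rewrite ler_pM2l ?invr_gt0 ?exprn_gt0// lef_pV2// posrE ?expR_gt0.
have tk : t ^+ k != 0 by rewrite expf_neq0// gt_eqF.
have ck : c ^+ k != 0 by rewrite expf_neq0// gt_eqF.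
have f0 : (k.+2)`!%:R != 0 :> R by rewrite pnatr_eq0 -lt0n fact_gt0.
have t1 : t != 0 by rewrite gt_eqF.
have c1 : c != 0 by rewrite gt_eqF.
rewrite expr_div_n !exprS.
rewrite le_eqVlt; apply/orP; left; apply/eqP.
by field; rewrite ?ck ?tk ?c1 ?t1 ?f0.
Qed.

Lemma is_derive_flat k c t : 0 < c ->
  is_derive t 1 (flat k c) (- k%:R * flat k.+1 c t + c * flat k.+2 c t).
Proof.
move=> c0; have [t0|t0|->] := ltgtP t 0.
- rewrite /flat !(lt_gtF t0) !mulr0 addr0.
  apply: (@near_eq_is_derive _ _ _ (cst 0)).
    by near=> s; rewrite ifF//; apply/negbTE; rewrite -leNgt ltW//; near: s; exact: lt_nbhsl.
- rewrite /flat !t0.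
  apply: (@near_eq_is_derive R R^o R^o (fun s : R => s ^- k * expR (- (c / s)))).
    by near=> s; rewrite ifT//; near: s; exact: lt_nbhsr.
  have t1 : t != 0 by rewrite gt_eqF.
  have tk : t ^+ k != 0 by rewrite expf_neq0.
  have d1 : is_derive t 1 (fun s : R => s^-1) (- t ^- 2).
    by apply: (is_derive_eq (@is_deriveV R id t 1 1 t1 (is_derive_id _ _))); rewrite [LHS]mulr1.
  have d2 : is_derive t 1 (fun s : R => s ^- k) (- k%:R * t ^- k.+1).
    have h := @is_deriveV R (fun s : R => s ^+ k) t _ 1 tk
      (@DeriveDef _ _ _ _ _ _ _ (@exprn_derivable R k t 1) (exp_derive k t 1)).
    apply: is_derive_eq h _.
    rewrite (_ : _ *: _ = - t ^+ k ^- 2 * (k%:R * t ^+ k.-1 * 1))//.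
    case: k tk => [|k] tk; first by rewrite !(mul0r,mulr0,oppr0).
    rewrite /= mulr1.
    have tk' : t ^+ k != 0 by rewrite expf_neq0.
    by rewrite !exprS; field; rewrite tk' t1.
  have d3 : is_derive t 1 (fun s : R => - (c / s)) (c * t ^- 2).
    apply: (is_derive_eq (is_deriveN (is_deriveZ c d1))).
    by rewrite [_ *: _]mulrN opprK.
  apply: (is_derive_eq (is_deriveM d2 (is_derive_comp d3 (is_derive_expR _)))).
  rewrite /= ![_ *: _]mulrC !exprS; field.
  by rewrite tk t1.
- have [M HM] := flat_quadratic k c0.
  rewrite /flat ltxx !mulr0 addr0.
  by apply: (@is_derive0_quadratic _ _ M) => s _; exact: HM.
Unshelve. all: by end_near. Qed.

End flat.

Lemma cvgn_prod (R : realType) (I : Type) (r : seq I) (F : I -> nat -> R) (l : I -> R) :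
  (forall i, F i k @[k --> \oo] --> l i) ->
  \prod_(i <- r) F i k @[k --> \oo] --> \prod_(i <- r) l i.
Proof.
move=> Fl; elim: r => [|a r IH].
  by under eq_fun do rewrite big_nil; rewrite big_nil; exact: cvg_cst.
by under eq_fun do rewrite big_cons; rewrite big_cons; exact: cvgM.
Qed.

Section smooth_algebra.
Context {R : realType} {n : nat}.
Implicit Types (f g phi : 'rV[R]_n -> R) (i : 'I_n) (x : 'rV[R]_n).

Inductive alg (G : set ('rV[R]_n -> R)) : ('rV[R]_n -> R) -> Prop :=
| alg_gen g : G g -> alg G g
| alg_cst (c : R) : alg G (cst c)
| alg_add f g : alg G f -> alg G g -> alg G (fun x => f x + g x)
| alg_mul f g : alg G f -> alg G g -> alg G (fun x => f x * g x).

Lemma alg_prod G (I : Type) (r : seq I) (F : I -> 'rV[R]_n -> R) :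
  (forall j, alg G (F j)) -> alg G (fun x => \prod_(j <- r) F j x).
Proof.
move=> GF; elim: r => [|a r IH].
  by under eq_fun do rewrite big_nil; exact: alg_cst.
by under eq_fun do rewrite big_cons; exact: alg_mul.
Qed.

Lemma is_derive_partial f x i : derivable f x (delta_mx ord0 i) ->
  is_derive x (delta_mx ord0 i) f (partial i f x).
Proof. exact: derivableP. Qed.

Lemma partialE f i x df : is_derive x (delta_mx ord0 i) f df -> partial i f x = df.
Proof. by case. Qed.

(* All smoothness claims below are obtained by exhibiting generators whose partial
   derivatives are polynomials in the generators. *)
Lemma alg_smooth G :
  (forall g, G g -> [/\ continuous g,
     forall i x, derivable g x (delta_mx ord0 i) & forall i, alg G (partial i g)]) ->
  forall f, alg G f -> smooth f.
Proof.
move=> HG.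
have H f : alg G f -> [/\ continuous f,
     forall i x, derivable f x (delta_mx ord0 i) & forall i, alg G (partial i f)].
  elim=> {f} [g /HG//|c|f g Gf [cf df pf] Gg [cg dg pg]|f g Gf [cf df pf] Gg [cg dg pg]].
  - split=> [x|i x|i]; [exact: cst_continuous|exact: derivable_cst|].
    rewrite (_ : partial i (cst c) = cst 0); first exact: alg_cst.
    by apply/funext => x; exact: derive_cst.
  - split=> [x|i x|i]; [by apply: continuousD; [exact: cf|exact: cg]|exact: derivableD|].
    rewrite (_ : partial i _ = (fun x => partial i f x + partial i g x)); first exact: alg_add.
    by apply/funext => x; exact: deriveD.
  - split=> [x|i x|i]; [by apply: continuousM; [exact: cf|exact: cg]|exact: derivableM|].
    rewrite (_ : partial i _ = (fun x => f x * partial i g x + g x * partial i f x)).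
      by apply: alg_add; exact: alg_mul.
    by apply/funext => x; exact: deriveM.
move=> f Gf s.
have : alg G (foldr (@partial R n) f s).
  by elim: s => [//|i s IH] /=; have [_ _] := H _ IH.
by move=> /H[c d _]; split.
Qed.

Lemma smooth_partial f i : smooth f -> smooth (partial i f).
Proof. by move=> sf s; have := sf (rcons s i); rewrite foldr_rcons. Qed.

Lemma smooth_continuous f : smooth f -> continuous f.
Proof. by move=> /(_ [::])[]. Qed.

Lemma smooth_derivable f i x : smooth f -> derivable f x (delta_mx ord0 i).
Proof. by move=> /(_ [::])[]. Qed.

Lemma continuous_coord i : continuous (fun x : 'rV[R]_n => x ord0 i).
Proof. exact: coord_continuous. Qed.

Lemma is_derive_coord i j x :
  is_derive x (delta_mx ord0 j) (fun y : 'rV[R]_n => y ord0 i) (i == j)%:R.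
Proof.
apply/is_derive_line.
have -> : (fun h : R => (h *: delta_mx ord0 j + x : 'rV[R]_n) ord0 i) =
    (fun h : R => (i == j)%:R * h + x ord0 i).
  by apply/funext => h; rewrite !mxE eqxx/= mulrC.
apply: (is_derive_eq (is_deriveD (is_deriveZ (i == j)%:R (is_derive_id (0 : R^o) 1))
  (is_derive_cst (x ord0 i : R^o) _ _))).
by rewrite addr0 [LHS]mulr1.
Qed.

Definition flat_gens (c : R) : set ('rV[R]_n -> R) :=
  [set g | exists k i l a, g = fun x => flat k c (l * x ord0 i + a)].

Lemma flat_gens_smooth c f : 0 < c -> alg (flat_gens c) f -> smooth f.
Proof.
move=> c0; apply: alg_smooth => g [k [i [l [a ->]]]].
have d j x : is_derive x (delta_mx ord0 j) (fun y : 'rV[R]_n => l * y ord0 i + a)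
    (l * (i == j)%:R).
  apply: (is_derive_eq (is_deriveD (is_deriveZ l (is_derive_coord i j x))
    (is_derive_cst a _ _))).
  by rewrite addr0.
have D j x := is_derive_comp (d j x) (is_derive_flat k (l * x ord0 i + a) c0).
split.
- move=> x; apply: (@continuous_comp _ _ _ (fun x : 'rV[R]_n => l * x ord0 i + a) (flat k c)).
    apply: continuousD; last exact: cst_continuous.
    by apply: continuousM; [exact: cst_continuous|exact: continuous_coord].
  exact: is_derive_continuous (is_derive_flat _ _ c0).
- by move=> j x; case: (D j x).
- move=> j.
  rewrite (_ : partial j _ = (fun x =>
     (cst (- k%:R) x * flat k.+1 c (l * x ord0 i + a) +
      cst c x * flat k.+2 c (l * x ord0 i + a)) * cst (l * (i == j)%:R) x)).
    apply: alg_mul; last exact: alg_cst.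
    by apply: alg_add; apply: alg_mul; try exact: alg_cst; apply: alg_gen;
       [exists k.+1, i, l, a|exists k.+2, i, l, a].
  by apply/funext => x; exact: partialE (D j x).
Qed.

(** The arguments are written [l * x + a] with [l = 1] or [l = -1], so that each factor is literally
    a member of [flat_gens]. *)
Definition bump (c : R) (a b : 'rV[R]_n) x : R :=
  \prod_(i < n) (flat 0 c (1 * x ord0 i + - a ord0 i) * flat 0 c (-1 * x ord0 i + b ord0 i)).

Lemma bump_smooth c a b : 0 < c -> smooth (bump c a b).
Proof.
move=> c0; apply: (flat_gens_smooth c0); apply: alg_prod => i.
by apply: alg_mul; apply: alg_gen;
  [exists 0%N, i, 1, (- a ord0 i)|exists 0%N, i, (-1), (b ord0 i)].
Qed.

Lemma flat0_le1 (c t : R) : 0 < c -> flat 0 c t <= 1.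
Proof.
move=> c0; rewrite /flat; case: ifP => // t0.
by rewrite expr0 invr1 mul1r expR_le1 oppr_le0 divr_ge0// ltW.
Qed.

Lemma bump_ge0 c a b x : 0 <= bump c a b x.
Proof. by apply: prodr_ge0 => i _; rewrite mulr_ge0// flat_ge0. Qed.

Lemma bump_le1 c a b x : 0 < c -> bump c a b x <= 1.
Proof.
move=> c0; rewrite -(@big1_eq R 1 *%R 'I_n (index_enum 'I_n) xpredT).
apply: ler_prod => i _.
by rewrite mulr_ge0 ?flat_ge0//= mulr_ile1 ?flat_ge0 ?flat0_le1.
Qed.

Definition obox (a b : 'rV[R]_n) : set 'rV[R]_n :=
  [set x | forall i, a ord0 i < x ord0 i < b ord0 i].

Lemma bump_eq0 c a b x : ~ obox a b x -> bump c a b x = 0.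
Proof.
move=> nx; have [i /negP xi] : exists i, ~ (a ord0 i < x ord0 i < b ord0 i).
  by apply/existsNP.
rewrite /bump (bigD1 i)//= /flat.
have -> : (0 < 1 * x ord0 i + - a ord0 i) = (a ord0 i < x ord0 i) by rewrite mul1r subr_gt0.
have -> : (0 < -1 * x ord0 i + b ord0 i) = (x ord0 i < b ord0 i) by rewrite mulN1r addrC subr_gt0.
by move: xi; rewrite negb_and => /orP[/negbTE->|/negbTE->]; rewrite ?(mul0r,mulr0).
Qed.

Lemma cvg_bump a b x :
  bump k.+1%:R^-1 a b x @[k --> \oo] --> (\1_(obox a b) x : R).
Proof.
rewrite indicE; case: (boolP (x \in _)) => [|]; last first.
  by move=> /negP; rewrite inE => nx; under eq_fun do rewrite bump_eq0//; exact: cvg_cst.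
rewrite inE => xab.
have ft t : 0 < t -> flat 0 k.+1%:R^-1 t @[k --> \oo] --> (1 : R).
  move=> t0; rewrite /flat t0.
  under eq_fun do rewrite expr0 invr1 mul1r.
  have h : - (k.+1%:R^-1 / t) @[k --> \oo] --> (0 : R).
    rewrite -[X in _ --> X]oppr0; apply: cvgN; rewrite -[X in _ --> X](mul0r t^-1).
    by apply: cvgM; [exact: cvg_harmonic|exact: cvg_cst].
  by have := cvg_comp _ _ h (@continuous_expR R 0); rewrite expR0.
rewrite /= (_ : 1%:R = \prod_(i < n) (1 * 1 : R)); last by rewrite big1// => i _; rewrite mulr1.
apply: cvgn_prod => i.
have /andP[h1 h2] := xab i.
by apply: cvgM; apply: ft; rewrite ?mul1r ?mulN1r ?subr_gt0// addrC subr_gt0.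
Qed.

Lemma closed_box a b : closed (box a b : set 'rV[R]_n).
Proof.
rewrite (_ : box a b = \bigcap_(i in [set: 'I_n])
   (fun x : 'rV[R]_n => x ord0 i) @^-1` `[a ord0 i, b ord0 i]).
  apply: closed_bigI => i _; apply: closed_comp; last exact: itv_closed.
  by move=> x _; exact: continuous_coord.
by apply/seteqP; split=> [x + i _|x + i]; [exact|move=> /(_ i I)].
Qed.

Lemma bounded_setP (A : set 'rV[R]_n) : bounded_set A ->
  exists M : R, 0 < M /\ forall x, A x -> forall i, `|x ord0 i| <= M.
Proof.
move=> /pinfty_ex_gt0[M M0 HM]; exists M; split=> // x Ax i.
have /(_ _ Ax) h := HM.
  apply: le_trans h; rewrite [leRHS]/Num.Def.normr/= mx_normrE.
  by apply/bigmax_geP; right; exists (ord0, i).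
Qed.

Lemma bounded_box a b : bounded_set (box a b : set 'rV[R]_n).
Proof.
exists (\big[Order.max/0]_(i < n) Num.max `|a ord0 i| `|b ord0 i|); split.
  exact: num_real.
move=> M Mlt x xab /=.
have M0 : 0 <= M by rewrite (le_trans _ (ltW Mlt))// bigmax_ge_id.
rewrite [leLHS]/Num.Def.normr/= mx_normrE; apply: bigmax_le => //= -[i j] _ /=.
rewrite ord1; have := xab j; rewrite in_itv/= => /andP[ax xb].
apply: le_trans (ltW Mlt).
apply: le_trans (le_bigmax _ _ j) => /=.
rewrite le_max; have [x0|x0] := leP 0 (x ord0 j).
  by rewrite (ger0_norm x0) (le_trans xb (ler_norm _)) orbT.
by rewrite (ltr0_norm x0) -(normrN (a _ _)) (@le_trans _ _ (- a ord0 j)) ?ler_norm// lerN2.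
Qed.

Lemma compact_box a b : compact (box a b : set 'rV[R]_n).
Proof.
apply: bounded_closed_compact; [exact: bounded_box|exact: closed_box].
Qed.

Lemma bump_support c a b : closure [set x | bump c a b x != 0] `<=` box a b.
Proof.
rewrite [X in _ `<=` X](closure_id (box a b)).1; last exact: closed_box.
apply: closure_subset => x /eqP; apply: contra_notP => nx; apply: bump_eq0.
by apply: contra_not nx => h i; rewrite in_itv/=; have /andP[/ltW-> /ltW->] := h i.
Qed.

Lemma bump_Cc Omega c a b : 0 < c -> box a b `<=` Omega -> Cc_infty Omega (bump c a b).
Proof.
move=> c0 abO; split; first exact: bump_smooth.
- apply: (subclosed_compact _ (@compact_box a b)); first exact: closed_closure.
  exact: bump_support.
- exact: subset_trans (@bump_support c a b) abO.
Qed.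

End smooth_algebra.

Section smooth_composition.
Context {R : realType} {n : nat}.
Implicit Types (phi : 'rV[R]_n -> R) (i : 'I_n) (x : 'rV[R]_n).

Lemma is_derive_powR_quad (A B r t : R) : 0 < A -> 0 <= B ->
  is_derive t 1 (fun s => (A + B * s ^+ 2) `^ r)
    (r * (A + B * t ^+ 2) `^ (r - 1) * (2 * B * t)).
Proof.
move=> A0 B0.
have p : 0 < A + B * t ^+ 2 by rewrite ltr_pwDl// mulr_ge0// sqr_ge0.
have d : is_derive t 1 (fun s : R => A + B * s ^+ 2) (2 * B * t).
  have h : is_derive t 1 (fun s : R => s ^+ 2) (2 * t).
    apply: (is_derive_eq (@DeriveDef _ _ _ _ _ _ _ (@exprn_derivable R 2 t 1) (exp_derive 2 t 1))).
    by rewrite [(_ *: _)%:A]mulr1 expr1.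
  apply: (is_derive_eq (is_deriveD (is_derive_cst (A : R^o) _ _) (is_deriveZ B h))).
  by rewrite add0r [_ *: _]mulrC; ring.
exact: is_derive_comp d (is_derive1_powR _ p).
Qed.

(** The building blocks of the truncated powers. The condition [0 < A] keeps the base positive, so
    that any real power is differentiable, and differentiation only lowers [r] by 1 and multiplies
    by [phi] and its partial derivatives. *)
Definition comp_gens phi : set ('rV[R]_n -> R) :=
  [set g | (exists s, g = foldr (@partial R n) phi s) \/
     exists A B r, [/\ 0 < A, 0 <= B & g = fun x => (A + B * phi x ^+ 2) `^ r]].

Lemma comp_smooth phi f : smooth phi -> alg (comp_gens phi) f -> smooth f.
Proof.
move=> sphi; apply: alg_smooth => g [[s ->]|[A [B [r [A0 B0 ->]]]]].
  have [c d] := sphi s; split => // i.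
  by apply: alg_gen; left; exists (i :: s).
have dphi i x := is_derive_partial (@smooth_derivable _ _ _ i x sphi).
have D i x := is_derive_comp (dphi i x) (is_derive_powR_quad r (phi x) A0 B0).
split.
- move=> x; apply: (@continuous_comp _ _ _ phi (fun s => (A + B * s ^+ 2) `^ r)).
    exact: smooth_continuous.
  exact: is_derive_continuous (is_derive_powR_quad _ _ A0 B0).
- by move=> i x; case: (D i x).
- move=> i.
  rewrite (_ : partial i _ = fun x => cst r x * ((A + B * phi x ^+ 2) `^ (r - 1)) *
     (cst (2 * B) x * phi x) * partial i phi x).
    apply: alg_mul; last by apply: alg_gen; left; exists [:: i].
    apply: alg_mul; apply: alg_mul; try exact: alg_cst.
      by apply: alg_gen; right; exists A, B, (r - 1).
    by apply: alg_gen; left; exists [::].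
  by apply/funext => x; exact: partialE (D i x).
Qed.

Lemma Cc_infty_sub0 Omega phi f : Cc_infty Omega phi -> smooth f ->
  (forall x, phi x = 0 -> f x = 0) -> Cc_infty Omega f.
Proof.
move=> [_ cphi sub] sf f0.
have S : closure [set x | f x != 0] `<=` closure [set x | phi x != 0].
  by apply: closure_subset => x; apply: contra_neq; exact: f0.
split=> //; last exact: subset_trans S sub.
exact: (subclosed_compact (@closed_closure _ _) cphi).
Qed.

Lemma Cc_infty_partial Omega phi i : Cc_infty Omega phi -> Cc_infty Omega (partial i phi).
Proof.
move=> [sphi cphi sub].
have S : [set x | partial i phi x != 0] `<=` closure [set x | phi x != 0].
  move=> x; apply: contraPP => nx.
  have /= : nbhs x (~` closure [set x | phi x != 0]).
    by apply: open_nbhs_nbhs; split=> //; apply: closed_openC; exact: closed_closure.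
  move=> nbx; apply/negP; rewrite negbK; apply/eqP.
  rewrite /partial (@near_eq_derive _ _ _ _ (cst 0)); first exact: derive_cst.
  apply: filterS nbx => y /= ny; apply/eqP; apply: contra_notT ny.
  by move=> y0; apply: subset_closure.
have S' : closure [set x | partial i phi x != 0] `<=` closure [set x | phi x != 0].
  by move=> x /(closure_subset S); rewrite -(closure_id _).1//; exact: closed_closure.
split; first exact: smooth_partial.
  exact: (subclosed_compact (@closed_closure _ _) cphi).
exact: subset_trans S' sub.
Qed.

Lemma Cc_infty_mul Omega phi psi :
  Cc_infty Omega phi -> smooth psi -> Cc_infty Omega (fun x => phi x * psi x).
Proof.
move=> hphi spsi; apply: (Cc_infty_sub0 hphi); last by move=> x ->; rewrite mul0r.
have [sphi _ _] := hphi.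
pose G := [set g | (exists s, g = foldr (@partial R n) phi s) \/
  exists s, g = foldr (@partial R n) psi s].
apply: (@alg_smooth R n G); last first.
  by apply: alg_mul; apply: alg_gen; [left|right]; exists [::].
move=> g [] [s ->]; [have [c d] := sphi s|have [c d] := spsi s]; split => // i.
  by apply: alg_gen; left; exists (i :: s).
by apply: alg_gen; right; exists (i :: s).
Qed.

Lemma partialM phi psi i x : smooth phi -> smooth psi ->
  partial i (fun x => phi x * psi x) x = phi x * partial i psi x + psi x * partial i phi x.
Proof.
by move=> sphi spsi; rewrite /partial; apply: deriveM; exact: smooth_derivable.
Qed.

Lemma Cc_infty_supp Omega phi x : Cc_infty Omega phi -> ~ Omega x -> phi x = 0.
Proof.
move=> [_ _ sub]; apply: contra_notP => /eqP h; apply: sub.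
exact: subset_closure.
Qed.

End smooth_composition.

(** * Lebesgue measure on R^n *)

Section borel_sets.
Context {R : realType} {n : nat}.
Implicit Types (a b x : 'rV[R]_n).

Lemma measurable_obox a b : measurable (obox a b : set (borelRn n)).
Proof.
rewrite (_ : obox a b = \big[setI/setT]_(i < n)
  [set v : 'rV[R]_n | v ord0 i \in `]a ord0 i, b ord0 i[]).
  apply: (@bigsetI_measurable _ (borelRn n)) => i _.
  apply: sub_sigma_algebra; exists i, [set` `]a ord0 i, b ord0 i[].
  by split => //; exact: measurable_itv.
apply/seteqP; split => v.
  by move=> bv; elim/big_ind : _ => // i _ /=; rewrite in_itv/= (bv i).
by move=> + i; rewrite (bigD1 i)//= in_itv/= => -[].
Qed.

Definition qvec (q : 'rV[rat]_n) : 'rV[R]_n := map_mx ratr q.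

(** Rational endpoints make the union countable, both for the Borel measurability of open sets and
    for merging null sets in [fundamental_lemma]. The closed boxes are kept inside [A] so that bumps
    on them are test functions. *)
Lemma open_bigcup_obox (A : set 'rV[R]_n) : open A ->
  A = \bigcup_(p in [set p : 'rV[rat]_n * 'rV[rat]_n |
        (forall i, qvec p.1 ord0 i <= qvec p.2 ord0 i) /\
        box (qvec p.1) (qvec p.2) `<=` A]) obox (qvec p.1) (qvec p.2).
Proof.
move=> oA; apply/seteqP; split=> [x Ax|x [p [_ pA] px]]; last first.
  by apply: pA => i; rewrite in_itv/=; have /andP[/ltW-> /ltW->] := px i.
have : nbhs x A by exact: open_nbhs_nbhs.
rewrite -nbhs_ballE => -[e /= e0 xeA].
have Ha i : {q : rat | ratr q \in `]x ord0 i - e, x ord0 i[}.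
  by apply: cid; apply: rat_in_itvoo; rewrite ltrBlDr ltrDl.
have Hb i : {q : rat | ratr q \in `]x ord0 i, x ord0 i + e[}.
  by apply: cid; apply: rat_in_itvoo; rewrite ltrDl.
have Ea i : x ord0 i - e < ratr (projT1 (Ha i)) < x ord0 i.
  by case: (Ha i) => q /=; rewrite in_itv.
have Eb i : x ord0 i < ratr (projT1 (Hb i)) < x ord0 i + e.
  by case: (Hb i) => q /=; rewrite in_itv.
exists (\row_i projT1 (Ha i), \row_i projT1 (Hb i)) => /=; last first.
  move=> i; rewrite !mxE.
  by have /andP[_ ->] := Ea i; have /andP[-> _] := Eb i.
split=> [i|y yab].
  rewrite !mxE; have /andP[_ h1] := Ea i; have /andP[h2 _] := Eb i.
  exact/ltW/(lt_trans h1 h2).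
apply: xeA; split=> // i j; rewrite ord1 -ball_normE/= /ball_/=.
have := yab j; rewrite in_itv/= !mxE => /andP[h1 h2].
have /andP[g1 g2] := Ea j; have /andP[g3 g4] := Eb j.
rewrite distrC ltr_distl; apply/andP; split.
  exact: lt_le_trans h1.
exact: le_lt_trans h2 _.
Qed.

Lemma open_borel (A : set 'rV[R]_n) : open A -> measurable (A : set (borelRn n)).
Proof.
move=> /open_bigcup_obox ->; rewrite bigcup_mkcond.
apply: (@countable_bigcupT_measurable _ (borelRn n)); first exact: countableP.
by move=> p; case: ifP => // _; exact: measurable_obox.
Qed.

Lemma continuous_borel (f : 'rV[R]_n -> R) : continuous f ->
  measurable_fun setT (f : borelRn n -> R).
Proof.
move=> cf; apply: (measurability _ (RGenOpens.measurableE R)) => // _ [_ [x [y ->] <-]].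
by rewrite setTI; apply: open_borel; apply: open_comp.
Qed.

Lemma borel_Rn (A : set 'rV[R]_n) :
  measurable (A : set (borelRn n)) -> measurable (A : set (Rn n)).
Proof. by move=> mA; exact: (@caratheodory_measurable_mu_ext _ _ _ (borel_leb n)). Qed.

Lemma leb_borel (A : set 'rV[R]_n) :
  measurable (A : set (borelRn n)) -> leb n A = borel_leb n A.
Proof. by move=> mA; exact: measurable_mu_extE. Qed.

Lemma borel_measurable_fun d (T : measurableType d) (D : set 'rV[R]_n) (f : 'rV[R]_n -> T) :
  measurable (D : set (borelRn n)) ->
  measurable_fun (D : set (borelRn n)) f -> measurable_fun (D : set (Rn n)) f.
Proof. by move=> mD mf mD' B mB; apply: borel_Rn; exact: mf. Qed.

(** Slicing by coordinates is done for the iterated product measure on Borel sets, while function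
    spaces are defined over its completion. The identity from the completed space to the Borel one
    is measurable and pushes [leb n] forward to [borel_leb n]. *)
Lemma ge0_integral_leb (D : set 'rV[R]_n) (f : 'rV[R]_n -> \bar R) :
  measurable (D : set (borelRn n)) -> measurable_fun (D : set (borelRn n)) f ->
  (forall x, D x -> 0 <= f x)%E ->
  (\int[leb n]_(x in D) f x = \int[borel_leb n]_(x in D) f x)%E.
Proof.
move=> mD mf f0.
have mid : measurable_fun setT (id : @Rn R n -> @borelRn R n).
  by move=> _ B mB; rewrite setTI; exact: borel_Rn.
have := @ge0_integral_pushforward _ _ (@Rn R n) (@borelRn R n) R id mid (leb n) D f mD mf.
rewrite preimage_id => <-; last by move=> y; rewrite inE; exact: f0.
pose m1 := measure_function_pushforward__canonical__measure_function_Measure (leb n) mid.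
apply: (@eq_measure_integral _ (@borelRn R n) R D (borel_leb n) m1) => A mA _.
by rewrite /m1/= /pushforward preimage_id; exact: leb_borel.
Qed.

Lemma ge0_integral_lebT (D : set 'rV[R]_n) (f : 'rV[R]_n -> \bar R) :
  measurable (D : set (borelRn n)) -> measurable_fun setT (f : borelRn n -> \bar R) ->
  (forall x, 0 <= f x)%E -> (forall x, ~ D x -> f x = 0)%E ->
  (\int[leb n]_(x in D) f x = \int[borel_leb n]_x f x)%E.
Proof.
move=> mD mf f0 fD.
rewrite ge0_integral_leb//; last exact: measurable_funTS.
rewrite integral_mkcond; apply: eq_integral => x _; rewrite patchE.
by case: ifPn => // /negP; rewrite inE => /fD ->.
Qed.

Lemma bounded_open_measurable (Omega : set 'rV[R]_n) : open Omega ->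
  measurable (Omega : set (Rn n)).
Proof. by move=> oO; apply: borel_Rn; exact: open_borel. Qed.

Lemma bounded_sub_box (A : set 'rV[R]_n) : bounded_set A ->
  exists2 M : R, 0 < M & A `<=` box (const_mx (- M)) (const_mx M).
Proof.
move=> /bounded_setP[M [M0 AM]]; exists M => // x Ax i.
by rewrite !mxE in_itv/= -ler_norml; exact: AM.
Qed.

Lemma leb_bounded (Omega : set 'rV[R]_n) : open Omega -> bounded_set Omega ->
  (leb n Omega < +oo)%E.
Proof.
move=> oO /bounded_sub_box[M M0 sub].
apply: (@le_lt_trans _ _ (leb n (box (const_mx (- M)) (const_mx M)))).
  apply: le_measure => //; rewrite inE; first exact: bounded_open_measurable.
  exact: borel_Rn (measurable_box _ _).
rewrite leb_box ?ltry// => i; rewrite !mxE.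
by rewrite ltW// (lt_trans _ M0)// oppr_lt0.
Qed.

End borel_sets.

Section fubini.
Context {R : realType} {n : nat}.

Lemma consRn0 (t : R) (w : 'rV[R]_n) : consRn (t, w) ord0 ord0 = t.
Proof. exact: (congr1 fst (consRnK (t, w))). Qed.

Lemma consRnS (t : R) (w : 'rV[R]_n) i : consRn (t, w) ord0 (lift ord0 i) = w ord0 i.
Proof.
have -> : lift ord0 i = rshift 1 i :> 'I_n.+1 by apply/val_inj.
exact: (row_mxEr (t%:M : 'M[R]_1) w ord0 i).
Qed.

Lemma consRnP (x : 'rV[R]_n.+1) : exists t w, x = consRn (t, w).
Proof.
exists (x ord0 ord0), (\row_i x ord0 (lift ord0 i)).
apply/rowP => i; have [j ->|->] := unliftP ord0 i; last by rewrite consRn0.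
by rewrite consRnS mxE.
Qed.

Lemma measurable_cons1 (t : R) : measurable_fun setT (fun w : borelRn n => consRn (t, w)).
Proof. exact: (measurableT_comp (@measurable_consRn R n) (pair1_measurable t)). Qed.

Lemma ge0_integral_borelS (f : 'rV[R]_n.+1 -> \bar R) :
  measurable_fun setT (f : borelRn n.+1 -> \bar R) -> (forall x, 0 <= f x)%E ->
  (\int[borel_leb n.+1]_x f x =
   \int[lebesgue_measure]_t \int[borel_leb n]_w f (consRn (t, w)))%E.
Proof.
move=> mf f0.
pose p : measurableTypeR R * borelRn n -> borelRn n.+1 := @consRn R n.
(* [borel_leb n.+1] is by definition this pushforward. *)
transitivity (\int[pushforward (lebesgue_measure \x borel_leb n)%E p]_x f x)%E.
  by [].
rewrite (ge0_integral_pushforward (@measurable_consRn R n))// preimage_setT.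
rewrite fubini_tonelli1//.
- exact: measurableT_comp (@measurable_consRn R n).
- by move=> z; exact: f0.
Qed.

Lemma measurable_slice (f : 'rV[R]_n.+1 -> \bar R) (t : R) :
  measurable_fun setT (f : borelRn n.+1 -> \bar R) ->
  measurable_fun setT (fun w : borelRn n => f (consRn (t, w))).
Proof. by move=> mf; exact: measurableT_comp (measurable_cons1 t). Qed.

Lemma measurable_fun_slice (f : 'rV[R]_n.+1 -> \bar R) :
  measurable_fun setT (f : borelRn n.+1 -> \bar R) -> (forall x, 0 <= f x)%E ->
  measurable_fun setT (fun t : measurableTypeR R => \int[borel_leb n]_w f (consRn (t, w)))%E.
Proof.
move=> mf f0.
apply: (@measurable_fun_fubini_tonelli_F _ _ _ _ _ (borel_leb n)
   (fun z : measurableTypeR R * borelRn n => f (consRn z))) => //.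
exact: measurableT_comp (@measurable_consRn R n).
Qed.

Lemma measurable_fun_slice0 (f : 'rV[R]_n.+1 -> \bar R) :
  measurable_fun setT (f : borelRn n.+1 -> \bar R) -> (forall x, 0 <= f x)%E ->
  measurable_fun setT (fun w : borelRn n => \int[lebesgue_measure]_t f (consRn (t, w)))%E.
Proof.
move=> mf f0.
apply: (@measurable_fun_fubini_tonelli_G _ _ _ _ _ (@lebesgue_measure R)
   (fun z : measurableTypeR R * borelRn n => f (consRn z))) => //.
exact: measurableT_comp (@measurable_consRn R n).
Qed.

Lemma ge0_integral_borelS' (f : 'rV[R]_n.+1 -> \bar R) :
  measurable_fun setT (f : borelRn n.+1 -> \bar R) -> (forall x, 0 <= f x)%E ->
  (\int[borel_leb n.+1]_x f x =
   \int[borel_leb n]_w \int[lebesgue_measure]_t f (consRn (t, w)))%E.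
Proof.
move=> mf f0; rewrite ge0_integral_borelS//.
rewrite -(@fubini_tonelli _ _ _ _ _ (@lebesgue_measure R) (borel_leb n)
  (fun z : measurableTypeR R * borelRn n => f (consRn z)))//.
exact: measurableT_comp (@measurable_consRn R n).
Qed.

End fubini.

(** * The Sobolev inequality for test functions *)

Section line_integrals.
Context {R : realType}.
Notation mu := (@lebesgue_measure R).
Implicit Types (f df : R -> R) (M : R).

Lemma ftc_itv f df (a b : R) : (forall t : R, is_derive t 1 f (df t)) -> continuous df ->
  a < b -> (\int[mu]_(t in `[a, b]) (df t)%:E = (f b - f a)%:E)%E.
Proof.
move=> fdf cdf ab.
have cf : continuous f by move=> t; exact: is_derive_continuous (fdf t).
rewrite (@continuous_FTC2 _ df f)//.
- exact: continuous_subspaceT.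
- split.
  + by move=> t _; case: (fdf t).
  + exact: cvg_at_right_filter (cf a).
  + exact: cvg_at_left_filter (cf b).
- by move=> t _; rewrite derive1E; case: (fdf t).
Qed.

Lemma measurable_cont f : continuous f -> measurable_fun setT (f : measurableTypeR R -> R).
Proof. exact: continuous_measurable_fun. Qed.

Lemma norm_le_integral_derive f df M : (forall t : R, is_derive t 1 f (df t)) -> continuous df ->
  (forall t, M <= `|t| -> f t = 0) ->
  forall x, (`|f x|%:E <= \int[mu]_t `|df t|%:E)%E.
Proof.
move=> fdf cdf f0 x.
have mdf := measurable_cont cdf.
(* To the left of both [x] and the support, so that [f x] is the integral of [df] over [[a, x]]. *)
pose a : R := - (`|M| + `|x| + 1).
have ax : a < x.
  rewrite /a ltrNl (le_lt_trans (ler_norm _))// normrN -addrA ltr_wpDl// ltrDl//.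
have fa : f a = 0.
  apply: f0; rewrite normrN ger0_norm; last by rewrite !addr_ge0.
  by rewrite (le_trans (ler_norm M))// -addrA lerDl addr_ge0.
have := ftc_itv fdf cdf ax; rewrite fa subr0 => fx.
rewrite -abse_EFin -fx.
apply: (@le_trans _ _ (\int[mu]_(t in `[a, x]) `|(df t)%:E|)%E).
  by apply: le_abse_integral => //; apply/measurable_EFinP/measurable_funTS.
apply: ge0_subset_integral => //.
by apply/measurable_EFinP; exact: measurableT_comp.
Qed.

(** Stated with positive and negative parts so that it can be integrated over the remaining
    variables by Tonelli alone, as in [integral_partial0]. *)
Lemma integral_derive0 f df M : (forall t : R, is_derive t 1 f (df t)) -> continuous df ->
  (forall t, M <= `|t| -> f t = 0) ->
  (\int[mu]_t (EFin \o df)^\+ t = \int[mu]_t (EFin \o df)^\- t)%E.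
Proof.
move=> fdf cdf f0.
have mdf := measurable_cont cdf.
pose a : R := `|M| + 1.
have a0 : 0 < a by rewrite ltr_wpDl.
have Ma : M < a by rewrite (le_lt_trans (ler_norm M))// ltrDl.
have df0 t : ~ (`[- a, a]%classic t) -> df t = 0.
  move=> /negP; rewrite /= in_itv/= -ler_norml -ltNge => at_.
  have [_ <-] := fdf t.
  rewrite (@near_eq_derive _ _ _ _ (cst (0 : R))); first exact: derive_cst.
  have : nbhs t [set s | M < `|s|].
    have := @norm_continuous R R^o t; move/cvgr_gt; apply; exact: lt_trans Ma at_.
  by apply: filterS => s /= /ltW; exact: f0.
have aa : - a < a by rewrite (lt_trans _ a0)// oppr_lt0.
have faa : (\int[mu]_(t in `[(- a)%R, a]) (df t)%:E = 0)%E.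
  rewrite (ftc_itv fdf cdf aa) !f0 ?subrr// ?normrN ger0_norm ?(ltW a0) ?ltW//.
have int : mu.-integrable `[- a, a] (EFin \o df).
  apply: continuous_compact_integrable; first exact: segment_compact.
  exact: continuous_subspaceT.
have restr (g : R -> \bar R) : (forall t, ~ (`[- a, a]%classic t) -> g t = 0%E) ->
    (\int[mu]_t g t = \int[mu]_(t in `[(- a)%R, a]) g t)%E.
  move=> g0; rewrite [RHS]integral_mkcond; apply: eq_integral => t _.
  by rewrite patchE; case: ifPn => // /negP; rewrite inE => /g0.
rewrite !restr; last 2 first.
- by move=> t /df0 dft; rewrite funeneg.unlock/= dft oppr0 maxxx.
- by move=> t /df0 dft; rewrite funepos.unlock/= dft maxxx.
move: faa; rewrite integralE => /eqP.
rewrite sube_eq ?add0e.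
- by move=> /eqP.
- exact: integrable_pos_fin_num.
- by rewrite fin_num_adde_defl// ; exact: integrable_neg_fin_num.
Qed.

End line_integrals.

Section coordinate_lines.
Context {R : realType}.

Definition upd n (x : 'rV[R]_n) (i : 'I_n) (s : R) : 'rV[R]_n :=
  \row_j if j == i then s else x ord0 j.

Lemma updE n (x : 'rV[R]_n) i s : upd x i s = (s - x ord0 i) *: delta_mx ord0 i + x.
Proof.
apply/rowP => j; rewrite !mxE eqxx/=; case: eqVneq => [->|_].
  by rewrite mulr1 subrK.
by rewrite mulr0 add0r.
Qed.

Lemma upd_id n (x : 'rV[R]_n) i : upd x i (x ord0 i) = x.
Proof. by rewrite updE subrr scale0r add0r. Qed.

Lemma upd_coord n (x : 'rV[R]_n) i s : upd x i s ord0 i = s.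
Proof. by rewrite mxE eqxx. Qed.

Lemma continuous_upd n (x : 'rV[R]_n) i : continuous (upd x i).
Proof.
rewrite (_ : upd x i = fun s => (s - x ord0 i) *: delta_mx ord0 i + x); last first.
  by apply/funext => s; exact: updE.
move=> s; apply: cvgD; last exact: cvg_cst.
by apply: cvgZr_tmp; apply: cvgB; [exact: cvg_id|exact: cvg_cst].
Qed.

Lemma is_derive_upd n (F : 'rV[R]_n -> R) (x : 'rV[R]_n) i s :
  derivable F (upd x i s) (delta_mx ord0 i) ->
  is_derive s 1 (fun s => F (upd x i s)) (partial i F (upd x i s)).
Proof.
move=> /is_derive_partial /is_derive_line h; apply/is_derive_line.
rewrite (_ : (fun h : R => F (upd x i (h *: 1 + s))) =
  fun h : R => F (h *: delta_mx ord0 i + upd x i s))//.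
apply/funext => t; congr F; rewrite !updE addrA -scalerDl; congr (_ *: _ + _).
by rewrite [t *: 1]mulr1 addrA.
Qed.

Lemma upd_cons0 n (t s : R) (w : 'rV[R]_n) : upd (consRn (t, w)) ord0 s = consRn (s, w).
Proof.
apply/rowP => j; rewrite mxE; have [k ->|->] := unliftP ord0 j.
  by rewrite eq_sym (negbTE (neq_lift _ _)) !consRnS.
by rewrite eqxx consRn0.
Qed.

Lemma upd_consS n (t s : R) (w : 'rV[R]_n) i :
  upd (consRn (t, w)) (lift ord0 i) s = consRn (t, upd w i s).
Proof.
apply/rowP => j; rewrite mxE; have [k ->|->] := unliftP ord0 j.
  by rewrite !consRnS mxE (inj_eq lift_inj).
by rewrite (negbTE (neq_lift _ _)) !consRn0.
Qed.

(** Tonelli along an arbitrary axis. Only the first coordinate can be split off directly, so the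
    induction peels it until direction [i] comes first; there the order of integration is exchanged,
    to integrate along the line before the rest. *)
Lemma ge0_integral_lines n (i : 'I_n) (f g : 'rV[R]_n -> \bar R) :
  measurable_fun setT (f : borelRn n -> \bar R) -> (forall x, 0 <= f x)%E ->
  measurable_fun setT (g : borelRn n -> \bar R) -> (forall x, 0 <= g x)%E ->
  (forall x, \int[lebesgue_measure]_s f (upd x i s) = \int[lebesgue_measure]_s g (upd x i s))%E ->
  (\int[borel_leb n]_x f x = \int[borel_leb n]_x g x)%E.
Proof.
elim: n i f g => [[]//|n IH] i f g mf f0 mg g0 fg.
have [j ij|i0] := unliftP ord0 i.
  rewrite (ge0_integral_borelS mf f0) (ge0_integral_borelS mg g0); apply: eq_integral => t _.
  apply: (IH j) => //; try exact: measurable_slice.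
  by move=> w; have := fg (consRn (t, w)); rewrite ij; under eq_integral do rewrite upd_consS;
    under [in RHS]eq_integral do rewrite upd_consS.
rewrite (ge0_integral_borelS' mf f0) (ge0_integral_borelS' mg g0); apply: eq_integral => w _.
by have := fg (consRn (0, w)); rewrite i0; under eq_integral do rewrite upd_cons0;
    under [in RHS]eq_integral do rewrite upd_cons0.
Qed.

Lemma integral_partial0 n (i : 'I_n) (F : 'rV[R]_n -> R) (M : R) :
  (forall x, derivable F x (delta_mx ord0 i)) -> continuous (partial i F) ->
  (forall x : 'rV[R]_n, M <= `|x ord0 i| -> F x = 0) ->
  (\int[borel_leb n]_x (EFin \o partial i F)^\+ x = \int[borel_leb n]_x (EFin \o partial i F)^\- x)%E.
Proof.
move=> dF cF F0.
have mF : measurable_fun setT (EFin \o (partial i F : borelRn n -> R)).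
  by apply/measurable_EFinP; exact: continuous_borel.
apply: (@ge0_integral_lines _ i).
- exact: measurable_funepos.
- by move=> x; exact: funepos_ge0.
- exact: measurable_funeneg.
- by move=> x; exact: funeneg_ge0.
move=> x.
have H := @integral_derive0 _ (fun s => F (upd x i s)) (fun s => partial i F (upd x i s)) M.
have E s : ((EFin \o partial i F)^\+ (upd x i s) = (EFin \o (fun s => partial i F (upd x i s)))^\+ s)%E.
  by rewrite funepos.unlock.
have E' s : ((EFin \o partial i F)^\- (upd x i s) = (EFin \o (fun s => partial i F (upd x i s)))^\- s)%E.
  by rewrite funeneg.unlock.
under eq_integral do rewrite E; under [in RHS]eq_integral do rewrite E'.
apply: H.
- by move=> s; exact: is_derive_upd.
- by move=> s; apply: continuous_comp; [exact: continuous_upd|exact: cF].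
- by move=> s Ms; apply: F0; rewrite upd_coord.
Qed.

End coordinate_lines.

Section gagliardo_nirenberg.
Context {R : realType}.

Lemma le_poweR (x y : \bar R) (r : R) : 0 <= r -> (0 <= x)%E -> (x <= y)%E ->
  (x `^ r <= y `^ r)%E.
Proof.
move=> r0 x0 xy; apply: gt0_ler_poweR => //; rewrite in_itv/= leey andbT//.
exact: le_trans xy.
Qed.

Lemma le_powR (x y r : R) : 0 <= r -> 0 <= x -> x <= y -> x `^ r <= y `^ r.
Proof.
by move=> r0 x0 xy; apply: ge0_ler_powR; rewrite ?nnegrE// (le_trans x0).
Qed.

Lemma powR_sqr (x p : R) : 0 <= x -> (x ^+ 2) `^ (p / 2) = x `^ p.
Proof.
move=> x0; rewrite -powR_mulrn// -powRrM; congr (_ `^ _).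
by rewrite mulrCA mulfV ?mulr1// pnatr_eq0.
Qed.

Lemma measurable_fun_powr d (T : measurableType d) (D : set T) (f : T -> R) (p : R) :
  measurable_fun D f -> measurable_fun D (fun x => f x `^ p).
Proof. exact: (measurableT_comp (measurable_powR p)). Qed.

Lemma ge0_integral_lin2 d (T : measurableType d) (mu : {measure set T -> \bar R})
    (A : set T) (f g : T -> R) (k l : R) : measurable A ->
  measurable_fun A f -> measurable_fun A g ->
  (forall x, A x -> 0 <= f x) -> (forall x, A x -> 0 <= g x) -> 0 <= k -> 0 <= l ->
  (\int[mu]_(x in A) (k * f x + l * g x)%:E =
   k%:E * \int[mu]_(x in A) (f x)%:E + l%:E * \int[mu]_(x in A) (g x)%:E)%E.
Proof.
move=> mA mf mg f0 g0 k0 l0.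
have mEf : measurable_fun A (EFin \o f) by exact/measurable_EFinP.
have mEg : measurable_fun A (EFin \o g) by exact/measurable_EFinP.
under eq_integral do rewrite EFinD !EFinM.
rewrite ge0_integralD//.
- rewrite (@ge0_integralZl _ _ _ mu A mA (EFin \o f))//.
    by rewrite (@ge0_integralZl _ _ _ mu A mA (EFin \o g)).
- by move=> x Ax; rewrite -EFinM lee_fin mulr_ge0 ?f0.
- by apply: emeasurable_funM.
- by move=> x Ax; rewrite -EFinM lee_fin mulr_ge0 ?g0.
- by apply: emeasurable_funM.
Qed.

Lemma ge0_hoelder d (T : measurableType d) (mu : {measure set T -> \bar R})
    (f g : T -> R) (p q : R) : measurable_fun setT f -> measurable_fun setT g ->
  (forall x, 0 <= f x) -> (forall x, 0 <= g x) -> 0 < p -> 0 < q -> p^-1 + q^-1 = 1 ->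
  (\int[mu]_x (f x * g x)%:E <= (\int[mu]_x (f x `^ p)%:E) `^ p^-1 *
     (\int[mu]_x (g x `^ q)%:E) `^ q^-1)%E.
Proof.
move=> mf mg f0 g0 p0 q0 pq.
have := hoelder mu mf mg p0 q0 pq; rewrite Lnorm1 unlock.
under eq_integral do rewrite /= ger0_norm ?mulr_ge0//.
have E (h : T -> R) s : (forall x, 0 <= h x) ->
    (\int[mu]_x `|(EFin \o h) x| `^ s = \int[mu]_x (h x `^ s)%:E)%E.
  by move=> h0; apply: eq_integral => x _; rewrite gee0_abs ?lee_fin// poweR_EFin.
by rewrite !E.
Qed.

(* Testing [F] against [A^(1/n)], instead of bounding the [n/(n-1)]-norm of [F], makes the
   statement meaningful for [n = 1] and lets the induction on [n] use Hoelder only once. *)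
Lemma gagliardo_nirenberg n (F A : 'rV[R]_n.+1 -> R) (G : 'I_n.+1 -> 'rV[R]_n.+1 -> R) :
  measurable_fun setT (F : borelRn n.+1 -> R) -> (forall x, 0 <= F x) ->
  measurable_fun setT (A : borelRn n.+1 -> R) -> (forall x, 0 <= A x) ->
  (forall i, measurable_fun setT (G i : borelRn n.+1 -> R)) -> (forall i x, 0 <= G i x) ->
  (forall i x, \int[lebesgue_measure]_s (G i (upd x i s))%:E < +oo)%E ->
  (forall i x, (F x)%:E <= \int[lebesgue_measure]_s (G i (upd x i s))%:E)%E ->
  (\int[borel_leb n.+1]_x (F x * A x `^ n.+1%:R^-1)%:E <=
   (\sum_i \int[borel_leb n.+1]_x (G i x)%:E) *
   (\int[borel_leb n.+1]_x (A x)%:E) `^ n.+1%:R^-1)%E.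
Proof.
elim: n F A G => [|n IH] F A G mF F0 mA A0 mG G0 Goo FG.
  (* In dimension 1 there is a single line, so [F] is bounded by the integral of [G ord0] over the
     whole space, and the exponent of the weight is 1. *)
  rewrite big_ord1 invr1 poweRe1; last by apply: integral_ge0 => x _; rewrite lee_fin.
  have IG : (\int[borel_leb 1]_x (G ord0 x)%:E =
      \int[lebesgue_measure]_s (G ord0 (consRn (s, 0%R)))%:E)%E.
    rewrite ge0_integral_borelS; [|exact/measurable_EFinP|by move=> x; rewrite lee_fin].
    apply: eq_integral => s _; rewrite integral_dirac//.
      by rewrite diracT mul1e.
    exact: (measurableT_comp (proj2 (measurable_EFinP _ _) (mG ord0)) (measurable_cons1 s)).
  rewrite -ge0_integralZl//; last 3 first.
  - exact/measurable_EFinP.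
  - by move=> x _; rewrite lee_fin.
  - by apply: integral_ge0 => x _; rewrite lee_fin.
  apply: ge0_le_integral => //.
  - by move=> x _; rewrite lee_fin mulr_ge0// powR_ge0.
  - apply/measurable_EFinP; apply: measurable_funM => //.
    exact: measurable_fun_powr.
  - by apply: emeasurable_funM => //; exact/measurable_EFinP.
  move=> x _; rewrite powRr1// EFinM; apply: lee_wpmul2r; first by rewrite lee_fin.
  rewrite IG; have [t [w xE]] := consRnP x.
  apply: le_trans (FG ord0 x) _; rewrite xE.
  under eq_integral do rewrite upd_cons0.
  by rewrite (thinmx0 w).
pose r : R := n.+1%:R^-1.
have r0 : 0 < r by rewrite invr_gt0 ltr0n.
pose S := (\sum_i \int[borel_leb n.+2]_x (G i x)%:E)%E.
pose a0 (w : 'rV[R]_n.+1) : R := fine (\int[lebesgue_measure]_t (G ord0 (consRn (t, w)))%:E).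
have IG0 i : (0 <= \int[borel_leb n.+2]_x (G i x)%:E)%E.
  by apply: integral_ge0 => x _; rewrite lee_fin.
have S0 : (0 <= S)%E by apply: sume_ge0.
have Ea0 w : (a0 w)%:E = (\int[lebesgue_measure]_t (G ord0 (consRn (t, w)))%:E)%E.
  rewrite fineK// ge0_fin_numE; last by apply: integral_ge0 => x _; rewrite lee_fin.
  by have := Goo ord0 (consRn (0, w)); under eq_integral do rewrite upd_cons0.
have a00 w : 0 <= a0 w by rewrite -lee_fin Ea0; apply: integral_ge0 => x _; rewrite lee_fin.
have mEG i : measurable_fun setT (EFin \o (G i : borelRn n.+2 -> R)).
  exact/measurable_EFinP.
have ma0 : measurable_fun setT (a0 : borelRn n.+1 -> R).
  apply/measurable_EFinP; rewrite (_ : EFin \o a0 =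
    (fun w => \int[lebesgue_measure]_t (G ord0 (consRn (t, w)))%:E)%E).
    by apply: (@measurable_fun_slice0 _ _ (EFin \o G ord0)) => // x; rewrite lee_fin.
  by apply/funext => w; exact: Ea0.
have Ia0 : (\int[borel_leb n.+1]_w (a0 w)%:E = \int[borel_leb n.+2]_x (G ord0 x)%:E)%E.
  rewrite (@ge0_integral_borelS' _ _ (EFin \o G ord0))//; last by move=> x; rewrite lee_fin.
  by apply: eq_integral => w _; exact: Ea0.
(* Integrating along the first direction gives [F <= a0], hence [F^(1+r) <= F a0^r] on a slice,
   where the induction hypothesis applies with the weight [a0]. *)
have slice (t : R) : (\int[borel_leb n.+1]_w (F (consRn (t, w)) `^ (1 + r))%:E <=
   (\sum_i \int[borel_leb n.+1]_w (G (lift ord0 i) (consRn (t, w)))%:E) *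
   (\int[borel_leb n.+1]_w (a0 w)%:E) `^ r)%E.
  have mFt : measurable_fun setT (fun w : borelRn n.+1 => F (consRn (t, w))).
    exact: measurableT_comp (measurable_cons1 t).
  apply: (@le_trans _ _ (\int[borel_leb n.+1]_w (F (consRn (t, w)) * a0 w `^ r)%:E)%E).
    apply: ge0_le_integral => //.
    - by move=> w _; rewrite lee_fin powR_ge0.
    - by apply/measurable_EFinP; exact: measurable_fun_powr.
    - apply/measurable_EFinP; apply: measurable_funM => //.
      exact: measurable_fun_powr.
    - move=> w _; rewrite lee_fin.
      rewrite powRD; last by rewrite gt_eqF// ltr_pwDl// ltW.
      rewrite powRr1//; apply: ler_wpM2l => //.
      apply: le_powR => //; first exact: ltW.
      rewrite -lee_fin Ea0; have := FG ord0 (consRn (t, w)).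
      by under eq_integral do rewrite upd_cons0.
  apply: (IH (fun w => F (consRn (t, w))) a0 (fun i w => G (lift ord0 i) (consRn (t, w)))) => //.
  - by move=> i; exact: measurableT_comp (measurable_cons1 t).
  - move=> i w; have := Goo (lift ord0 i) (consRn (t, w)).
    by under eq_integral do rewrite upd_consS.
  - move=> i w; have := FG (lift ord0 i) (consRn (t, w)).
    by under eq_integral do rewrite upd_consS.
have mFr : measurable_fun setT (EFin \o (fun x : borelRn n.+2 => F x `^ (1 + r))).
  by apply/measurable_EFinP; exact: measurable_fun_powr.
(* Integration in [t]: the directions other than the first contribute at most [S], and the integral
   of [a0] is the contribution of the first direction, also at most [S]. *)
have P : (\int[borel_leb n.+2]_x (F x `^ (1 + r))%:E <= S `^ (1 + r))%E.
  rewrite ge0_integral_borelS//; last by move=> x; rewrite lee_fin powR_ge0.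
  have Wr : (0 <= (\int[borel_leb n.+1]_w (a0 w)%:E) `^ r)%E by exact: poweR_ge0.
  have mJ i : measurable_fun setT (fun t : measurableTypeR R =>
      \int[borel_leb n.+1]_w (G (lift ord0 i) (consRn (t, w)))%:E)%E.
    by apply: (@measurable_fun_slice _ _ (EFin \o G (lift ord0 i))) => // x; rewrite lee_fin.
  have J0 i t : (0 <= \int[borel_leb n.+1]_w (G (lift ord0 i) (consRn (t, w)))%:E)%E.
    by apply: integral_ge0 => w _; rewrite lee_fin.
  apply: (@le_trans _ _ (\int[lebesgue_measure]_t
     ((\sum_i \int[borel_leb n.+1]_w (G (lift ord0 i) (consRn (t, w)))%:E) *
      (\int[borel_leb n.+1]_w (a0 w)%:E) `^ r))%E).
    apply: ge0_le_integral => //.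
    - by move=> t _; apply: integral_ge0 => w _; rewrite lee_fin powR_ge0.
    - apply: (@measurable_fun_slice _ _ (EFin \o (fun x => F x `^ (1 + r)))) => // x.
      by rewrite lee_fin powR_ge0.
    - by apply: emeasurable_funM => //; exact: emeasurable_sum.
  rewrite ge0_integralZr//; last 2 first.
  - exact: emeasurable_sum.
  - by move=> t _; exact: sume_ge0.
  rewrite ge0_integral_sum//.
  rewrite poweRD ?poweRe1//; last first.
    by apply: add_neq0_poweRD_def; rewrite gt_eqF// ltr_pwDl// ltW.
  rewrite Ia0; apply: lee_pmul => //.
  - by apply: sume_ge0 => i _; exact: integral_ge0.
  - exact: poweR_ge0.
  - rewrite /S [leRHS]big_ord_recl.
    apply: (@le_trans _ _ (\sum_(i < n.+1) \int[borel_leb n.+2]_x (G (lift ord0 i) x)%:E)%E).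
      apply: lee_sum => i _; rewrite (@ge0_integral_borelS _ _ (EFin \o G (lift ord0 i)))//.
      by move=> x; rewrite lee_fin.
    exact: leeDr.
  - apply: le_poweR => //; first exact: ltW.
    rewrite /S big_ord_recl; apply: leeDl; exact: sume_ge0.
(* Hoelder with the conjugate exponents [1 + r = (n+2)/(n+1)] and [n+2] separates [F] from the
   weight. *)
have p0 : 0 < 1 + r by rewrite ltr_pwDl// ltW.
have q0 : 0 < n.+2%:R :> R by rewrite ltr0n.
have pq : (1 + r)^-1 + n.+2%:R^-1 = 1.
  rewrite /r -[n.+2%:R](@natr1 R n.+1).
  have n1 : n.+1%:R != 0 :> R by rewrite pnatr_eq0.
  have n2 : n.+1%:R + 1 != 0 :> R by rewrite natr1 pnatr_eq0.
  set N := n.+1%:R in n1 n2 *.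
  have -> : 1 + N^-1 = (N + 1) / N by rewrite mulrDl divff// div1r.
  by rewrite invf_div -[X in _ + X]mul1r -mulrDl divff.
have mAr : measurable_fun setT (fun x : borelRn n.+2 => A x `^ n.+2%:R^-1).
  exact: measurable_fun_powr.
apply: le_trans (@ge0_hoelder _ _ (borel_leb n.+2) F _ (1 + r) n.+2%:R mF mAr F0 _ p0 q0 pq) _.
  by move=> x; exact: powR_ge0.
have -> : (\int[borel_leb n.+2]_x ((A x `^ n.+2%:R^-1) `^ n.+2%:R)%:E =
   \int[borel_leb n.+2]_x (A x)%:E)%E.
  by apply: eq_integral => x _; rewrite -powRrM mulVf ?powRr1// gt_eqF.
apply: lee_wpmul2r; first exact: poweR_ge0.
rewrite -/S (_ : S = (S `^ (1 + r)) `^ (1 + r)^-1)%E; last first.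
  by rewrite -poweRrM divff ?gt_eqF// poweRe1.
apply: le_poweR => //; first by rewrite invr_ge0 ltW.
by apply: integral_ge0 => x _; rewrite lee_fin powR_ge0.
Qed.

End gagliardo_nirenberg.

Section powers_of_norm.
Context {R : realType}.
Implicit Types (t g : R).

Definition dabspow g t : R := g * `|t| `^ (g - 2) * t.

Lemma abs_dabspow g t : 2 < g -> `|dabspow g t| = g * `|t| `^ (g - 1).
Proof.
move=> g2; rewrite /dabspow !normrM (ger0_norm (powR_ge0 _ _)) ger0_norm; last first.
  by rewrite ltW// (lt_trans _ g2).
rewrite -mulrA; congr (_ * _).
rewrite mulrC -{1}[`|t|](@powRr1 R)// -powRD; first by congr (_ `^ _); ring.
by apply/implyP => /eqP; lra.
Qed.

Lemma abspow_quad g t : 2 < g -> `|t| <= 1 -> `|t| `^ g <= t ^+ 2.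
Proof.
move=> g2 t1; have [->|t0] := eqVneq t 0.
  by rewrite normr0 powR0 ?expr0n// gt_eqF// (lt_trans _ g2).
rewrite -real_normK ?num_real// -powR_mulrn//.
by apply: ger_powR; rewrite ?normr_gt0 ?t0 ?t1 ?ltW.
Qed.

Lemma is_derive_abspow g t : 2 < g -> is_derive t 1 (fun s => `|s| `^ g) (dabspow g t).
Proof.
move=> g2.
have E s : 0 < s -> g * s `^ (g - 1) = g * s `^ (g - 2) * s.
  move=> s0; rewrite -mulrA; congr (_ * _).
  rewrite -{3}[s](@powRr1 R) ?ltW// -powRD; first by congr (_ `^ _); ring.
  by rewrite (gt_eqF s0)/= implybT.
have [t0|t0|->] := ltgtP t 0.
- apply: (@near_eq_is_derive _ _ _ (fun s : R => (- s) `^ g)).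
    by near=> s; rewrite ltr0_norm//; near: s; exact: lt_nbhsl.
  have t0' : 0 < - t by rewrite oppr_gt0.
  have dN : is_derive t 1 (fun s : R => - s) (-1) by exact: is_deriveNid.
  apply: (is_derive_eq (is_derive_comp dN (is_derive1_powR g t0'))).
  by rewrite E// /dabspow ltr0_norm// mulrN1 mulrN opprK.
- apply: (@near_eq_is_derive _ _ _ (fun s : R => s `^ g)).
    by near=> s; rewrite gtr0_norm//; near: s; exact: lt_nbhsr.
  apply: (is_derive_eq (is_derive1_powR g t0)).
  by rewrite E// /dabspow gtr0_norm.
- rewrite /dabspow mulr0; apply: (@is_derive0_quadratic _ _ 1) => s s1.
  by rewrite mul1r ger0_norm ?powR_ge0//; exact: abspow_quad.
Unshelve. all: by end_near. Qed.

Lemma continuous_dabspow g : 2 < g -> continuous (dabspow g).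
Proof.
move=> g2 t; have [->|t0] := eqVneq t 0.
  have d0 : dabspow g 0 = 0 by rewrite /dabspow mulr0.
  suff: dabspow g s @[s --> (0 : R)] --> (0 : R) by rewrite /continuous_at d0.
  have near1 : \forall s \near nbhs (0 : R), `|s| <= 1 by exact: (@nbhs0_le R R^o 1 ltr01).
  apply: norm_cvg0.
  apply: (@squeeze_cvgr _ _ _ _ (cst 0) (fun s : R => g * `|s|)).
  - near=> s; rewrite normr_ge0/= abs_dabspow//.
    apply: ler_wpM2l; first by rewrite ltW// (lt_trans _ g2).
    have s1 : `|s| <= 1 by near: s; exact: near1.
    have [->|s0] := eqVneq s 0; first by rewrite normr0 powR0// gt_eqF// subr_gt0 (lt_trans _ g2)// ltr1n.
    by apply: ge1r_powR; rewrite ?normr_gt0 ?s0// lerBrDr ltW.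
  - exact: cvg_cst.
  - rewrite -[X in _ --> X](mulr0 g); apply: cvgM; first exact: cvg_cst.
    by rewrite -[X in _ --> X](@normr0 _ R); exact: norm_continuous.
have cn : {for t, continuous (fun s : R => `|s| `^ (g - 2))}.
  apply: (@continuous_comp _ _ _ (@Num.norm _ R) (@powR R ^~ (g - 2))).
    exact: norm_continuous.
  by apply: is_derive_continuous; apply: is_derive1_powR; rewrite normr_gt0.
apply: (@continuousM _ _ (fun s => g * `|s| `^ (g - 2)) id t); last exact: (@cvg_id _ (nbhs t)).
by apply: (@continuousM _ _ (cst g) _ t) => //; exact: cst_continuous.
Unshelve. all: by end_near. Qed.

End powers_of_norm.

Section sobolev.
Context {R : realType}.

Lemma cont_mul (T : topologicalType) (f g : T -> R) :
  continuous f -> continuous g -> continuous (fun x => f x * g x).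
Proof. by move=> cf cg x; exact: (continuousM (cf x) (cg x)). Qed.

Lemma Cc_infty_bounded n (Omega : set 'rV[R]_n) phi : Cc_infty Omega phi ->
  exists2 K : R, 0 <= K & forall x, `|phi x| <= K.
Proof.
move=> [sphi cphi _].
have : bounded_set (phi @` closure [set x | phi x != 0]).
  apply: compact_bounded; apply: continuous_compact cphi.
  by apply: continuous_subspaceT; exact: smooth_continuous.
move=> /pinfty_ex_gt0[K K0 HK]; exists K; first exact: ltW.
move=> x; have [->|phix] := eqVneq (phi x) 0; first by rewrite normr0 ltW.
by apply: HK; exists x => //; exact: subset_closure.
Qed.

Lemma Cc_infty_far n (Omega : set 'rV[R]_n) : bounded_set Omega ->
  exists2 M : R, 0 < M & forall phi, Cc_infty Omega phi ->
    forall (x : 'rV[R]_n) i, M <= `|x ord0 i| -> phi x = 0.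
Proof.
move=> /bounded_setP[M [M0 HM]]; exists (M + 1); first by rewrite addr_gt0.
move=> phi hphi x i Mx; apply: (Cc_infty_supp hphi) => Ox.
by have := le_trans Mx (HM _ Ox i); rewrite gerDl leNgt ltr01.
Qed.

Lemma integral_line_lty (f : R -> R) (K M : R) : measurable_fun setT (f : measurableTypeR R -> R) ->
  (forall s, 0 <= f s <= K) -> (forall s, M <= `|s| -> f s = 0) ->
  (\int[lebesgue_measure]_s (f s)%:E < +oo)%E.
Proof.
move=> mf fK f0.
have E : (\int[lebesgue_measure]_s (f s)%:E =
    \int[lebesgue_measure]_(s in `[(- M)%R, M]) (f s)%:E)%E.
  rewrite [RHS]integral_mkcond; apply: eq_integral => s _.
  rewrite patchE; case: ifPn => // /negP; rewrite inE /= in_itv/= -ler_norml => /negP.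
  by rewrite -ltNge => /ltW /f0 ->.
rewrite E; apply: (@le_lt_trans _ _ (\int[lebesgue_measure]_(s in `[(- M)%R, M]) K%:E)%E).
  apply: ge0_le_integral => //.
  - by move=> s _; rewrite lee_fin; have /andP[] := fK s.
  - by apply/measurable_EFinP; exact: measurable_funTS.
  - by move=> s _; rewrite lee_fin; have /andP[] := fK s.
rewrite integral_cst//= lebesgue_measure_itv/=; case: ifP => _; rewrite ?mule0//.
by rewrite -EFinB -EFinM ltry.
Qed.

(* [gagliardo_nirenberg] is applied to [F = |phi|^(1 + p/2)] and [A = |phi|^(n (p/2 - 1))]:
   then [|d_i F|] is at most [|phi|^(p/2) |d_i phi|] up to a factor, so that only [|phi|^p] and
   [|d_i phi|^2] occur, and [n (p/2 - 1) <= p] says that the power of [A] is not too large. *)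
Lemma sobolev n (Omega : set 'rV[R]_n) (p : R) : (0 < n)%N -> open Omega ->
  bounded_set Omega -> 2 < p -> n%:R * (p / 2 - 1) <= p ->
  exists2 C : R, 0 < C & forall phi (D : R), Cc_infty Omega phi -> 0 <= D ->
    (\int[leb n]_(x in Omega) (\sum_i partial i phi x ^+ 2)%:E <= D%:E)%E ->
    (\int[leb n]_(x in Omega) (`|phi x| `^ p)%:E <= ((C * D) `^ (p / 2))%:E)%E.
Proof.
case: n Omega => // n Omega _ oO bO p2 np.
have bO' : measurable (Omega : set (borelRn n.+1)) by exact: open_borel.
have [M M0 farM] := Cc_infty_far bO.
pose V := fine (leb n.+1 Omega).
have V0 : 0 <= V by exact: fine_ge0.
have VE : leb n.+1 Omega = V%:E.
  by rewrite fineK// ge0_fin_numE//; exact: leb_bounded.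
pose g := 1 + p / 2; pose a := n.+1%:R * (p / 2 - 1).
have n0 : 0 < n.+1%:R :> R by rewrite ltr0n.
have g2 : 2 < g by rewrite /g; lra.
have a0 : 0 < a by rewrite mulr_gt0//; lra.
have aE : a / n.+1%:R = p / 2 - 1 by rewrite /a mulrAC divff ?mul1r// gt_eqF.
have g0 : 0 <= g by lra.
have g1 : 0 <= g - 1 by lra.
have gE : g + (p / 2 - 1) = p by rewrite /g; lra.
pose C := g ^+ 2 * n.+1%:R * (V + 1) ^+ 2.
have V1 : 0 < V + 1 by rewrite ltr_wpDl.
have C0 : 0 < C by rewrite !mulr_gt0 ?exprn_gt0//; lra.
exists C => // phi D hphi D0 HD.
have [sphi _ _] := hphi.
have cphi := smooth_continuous sphi.
have mu0 : forall x, ~ Omega x -> phi x = 0 by move=> x; exact: Cc_infty_supp.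
have dmu0 i : forall x, ~ Omega x -> partial i phi x = 0.
  by move=> x; apply: Cc_infty_supp; exact: Cc_infty_partial hphi.
have mphi := continuous_borel cphi.
have cdphi i : continuous (partial i phi) by exact/smooth_continuous/smooth_partial.
have mdphi i := continuous_borel (cdphi i).
have p0 : 0 < p by rewrite (lt_trans _ p2).
have mpow r : measurable_fun setT (fun x : borelRn n.+1 => `|phi x| `^ r).
  by apply: measurable_fun_powr; exact: measurableT_comp.
have phip0 r x : 0 < r -> ~ Omega x -> `|phi x| `^ r = 0.
  by move=> r0 /mu0 ->; rewrite normr0 powR0// gt_eqF.
have mdsum : measurable_fun setT (fun x : borelRn n.+1 => \sum_i partial i phi x ^+ 2).
  by apply: measurable_sum => i; exact: measurable_funX.
have IE : (\int[leb n.+1]_(x in Omega) (`|phi x| `^ p)%:E =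
    \int[borel_leb n.+1]_x (`|phi x| `^ p)%:E)%E.
  apply: ge0_integral_lebT => //; first exact/measurable_EFinP.
  by move=> x Ox; rewrite phip0.
rewrite IE.
have DE : (\int[borel_leb n.+1]_x (\sum_i partial i phi x ^+ 2)%:E <= D%:E)%E.
  rewrite -(@ge0_integral_lebT _ _ Omega)//; first exact/measurable_EFinP.
    by move=> x; rewrite lee_fin sumr_ge0// => i _; exact: sqr_ge0.
  by move=> x Ox; rewrite big1// => i _; rewrite dmu0// expr0n.
have VE' : (\int[borel_leb n.+1]_x (\1_Omega x)%:E = V%:E)%E.
  by rewrite integral_indic// setIT; apply: etrans (esym (leb_borel bO')) VE.
have [K K0 HK] := Cc_infty_bounded hphi.
have Ioo : (\int[borel_leb n.+1]_x (`|phi x| `^ p)%:E < +oo)%E.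
  apply: (@le_lt_trans _ _ (\int[borel_leb n.+1]_x ((K `^ p)%:E * (\1_Omega x)%:E))%E).
    apply: ge0_le_integral => //.
    - by apply/measurable_EFinP.
    - by apply: emeasurable_funM => //; apply/measurable_EFinP; exact: measurable_indic.
    - move=> x _; rewrite -EFinM lee_fin indicE; case: (boolP (x \in Omega)).
        by rewrite mulr1 => _; apply: le_powR => //; exact: ltW.
      by move=> /negP; rewrite inE => Ox; rewrite phip0// mulr0.
  rewrite ge0_integralZl//.
  - by rewrite VE' -EFinM ltry.
  - by apply/measurable_EFinP; exact: measurable_indic.
  - by rewrite lee_fin powR_ge0.
pose I0 := fine (\int[borel_leb n.+1]_x (`|phi x| `^ p)%:E).
have I0E : (\int[borel_leb n.+1]_x (`|phi x| `^ p)%:E = I0%:E)%E.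
  by rewrite fineK// ge0_fin_numE//; apply: integral_ge0 => x _; rewrite lee_fin powR_ge0.
have I00 : 0 <= I0 by rewrite -lee_fin -I0E integral_ge0// => x _; rewrite lee_fin powR_ge0.
rewrite I0E lee_fin.
have [->|I0n] := eqVneq I0 0; first exact: powR_ge0.
have I0p : 0 < I0 by rewrite lt0r I0n.
pose m := I0 `^ p^-1.
have m0 : 0 < m by exact: powR_gt0.
have mp : m `^ p = I0 by rewrite -powRrM mulVf ?gt_eqF// powRr1.
have cg : continuous (fun x => `|phi x| `^ g).
  move=> x; apply: (@continuous_comp _ _ _ phi (fun t : R => `|t| `^ g)); first exact: cphi.
  exact: is_derive_continuous (is_derive_abspow _ g2).
pose G i x : R := `|dabspow g (phi x) * partial i phi x|.
have cG i : continuous (G i).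
  move=> x; apply: (@continuous_comp _ _ _ (fun x => dabspow g (phi x) * partial i phi x)
    (@Num.norm _ R)); last exact: norm_continuous.
  apply: continuousM; last exact: cdphi.
  apply: (@continuous_comp _ _ _ phi (dabspow g)); first exact: cphi.
  exact: continuous_dabspow.
have mG i := continuous_borel (cG i).
have G0 i x : 0 <= G i x by exact: normr_ge0.
have G_far i (x : 'rV[R]_n.+1) : M <= `|x ord0 i| -> G i x = 0.
  by move=> Mx; rewrite /G /dabspow (farM _ hphi _ _ Mx) mulr0 mul0r normr0.
have GN := @gagliardo_nirenberg R n (fun x => `|phi x| `^ g) (fun x => `|phi x| `^ a) G
  (mpow g) (fun x => powR_ge0 _ _) (mpow a) (fun x => powR_ge0 _ _) mG G0.
have {GN} : (\int[borel_leb n.+1]_x (`|phi x| `^ p)%:E <=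
    (\sum_i \int[borel_leb n.+1]_x (G i x)%:E) *
    (\int[borel_leb n.+1]_x (`|phi x| `^ a)%:E) `^ n.+1%:R^-1)%E.
  apply: le_trans (GN _ _).
  - rewrite le_eqVlt; apply/orP; left; apply/eqP; apply: eq_integral => x _.
    rewrite -powRrM aE -powRD gE// gt_eqF//.
  - move=> i x; have [K' K'0 HK'] := Cc_infty_bounded (Cc_infty_partial i hphi).
    apply: (@integral_line_lty _ (g * K `^ (g - 1) * K') M).
    + apply: measurable_cont => s; apply: continuous_comp; first exact: continuous_upd.
      exact: cG.
    + move=> s; rewrite G0/= /G normrM abs_dabspow//; apply: ler_pM => //.
        by rewrite mulr_ge0 ?powR_ge0.
      by apply: ler_wpM2l => //; exact: le_powR.
    + by move=> s Ms; apply: (G_far i); rewrite upd_coord.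
  - move=> i x.
    have H := @norm_le_integral_derive R (fun s => `|phi (upd x i s)| `^ g)
      (fun s => dabspow g (phi (upd x i s)) * partial i phi (upd x i s)) M.
    have := H _ _ _ (x ord0 i); rewrite upd_id ger0_norm ?powR_ge0//; apply.
    + move=> s; have h := is_derive_upd (@smooth_derivable _ _ _ i (upd x i s) sphi).
      exact: is_derive_comp h (is_derive_abspow _ g2).
    + apply: cont_mul => s.
        apply: (@continuous_comp _ _ _ (fun s => phi (upd x i s)) (dabspow g)).
          by apply: continuous_comp; [exact: continuous_upd|exact: cphi].
        exact: continuous_dabspow.
      by apply: continuous_comp; [exact: continuous_upd|exact: cdphi].
    + move=> s Ms; rewrite (farM _ hphi _ i); first by rewrite normr0 powR0// gt_eqF//; lra.
      by rewrite upd_coord.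
(* The weight is cut at [m], the [L^p] norm of [phi]: below [m] it is at most [m^a]; above, [a <= p]
   gives [|phi|^a <= m^(a-p) |phi|^p], whose integral is at most [m^a]. *)
have Wle : (\int[borel_leb n.+1]_x (`|phi x| `^ a)%:E <= (m `^ a * (V + 1))%:E)%E.
  apply: (@le_trans _ _ (\int[borel_leb n.+1]_x
     (m `^ a * \1_Omega x + m `^ a / I0 * `|phi x| `^ p)%:E)%E).
    apply: ge0_le_integral => //.
    - by apply/measurable_EFinP.
    - by apply/measurable_EFinP; apply: measurable_funD; apply: measurable_funM.
    - move=> x _; rewrite lee_fin indicE; case: (boolP (x \in Omega)); last first.
        move=> /negP; rewrite inE => Ox; rewrite phip0// mulr0 add0r.
        by rewrite mulr_ge0 ?powR_ge0// divr_ge0 ?powR_ge0.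
      rewrite mulr1 => _.
      have [le|lt] := leP `|phi x| m.
        rewrite -[leLHS]addr0; apply: lerD; first by apply: le_powR => //; exact: ltW.
        by rewrite mulr_ge0 ?divr_ge0 ?powR_ge0.
      rewrite -[leLHS]add0r; apply: lerD; first exact: powR_ge0.
      have E (r : R) : `|phi x| `^ r = m `^ r * (`|phi x| / m) `^ r.
        rewrite -powRM ?divr_ge0 ?(ltW m0)//; congr (_ `^ r).
        by rewrite mulrC divfK// gt_eqF.
      rewrite -mp (E a) (E p) mulrA divfK ?gt_eqF ?powR_gt0//.
      rewrite ler_wpM2l ?powR_ge0//; apply: ler_powR => //.
      by rewrite ler_pdivlMr// mul1r ltW.
  rewrite ge0_integral_lin2 ?powR_ge0 ?divr_ge0 ?powR_ge0//.
  by rewrite VE' I0E -!EFinM -EFinD lee_fin divfK ?gt_eqF// mulrDr mulr1.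
(* Young's inequality for [|phi|^(p/2) |d_i phi|] with a weight [l] left free, to be fixed once the
   power of [m] is known. *)
have Sle (l : R) : 0 < l -> (\sum_i \int[borel_leb n.+1]_x (G i x)%:E <=
    (g / 2 * (n.+1%:R * l * I0 + D / l))%:E)%E.
  move=> l0; rewrite -ge0_integral_sum//; last first.
  - by move=> i x _; rewrite lee_fin.
  - by move=> i; exact/measurable_EFinP.
  have k1 : 0 <= g / 2 * n.+1%:R * l by rewrite !mulr_ge0// ltW.
  have k2 : 0 <= g / 2 / l by rewrite !divr_ge0// ltW.
  apply: (@le_trans _ _ (\int[borel_leb n.+1]_x
     (g / 2 * n.+1%:R * l * `|phi x| `^ p + g / 2 / l * (\sum_i partial i phi x ^+ 2))%:E)%E).
    apply: ge0_le_integral => //.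
    - by move=> x _; apply: sume_ge0 => i _; rewrite lee_fin.
    - by apply: emeasurable_sum => i; exact/measurable_EFinP.
    - by apply/measurable_EFinP; apply: measurable_funD; apply: measurable_funM.
    - move=> x _; rewrite sumEFin lee_fin.
      have -> : g / 2 * n.+1%:R * l * `|phi x| `^ p + g / 2 / l * (\sum_i partial i phi x ^+ 2) =
          \sum_(i < n.+1) g / 2 * (l * `|phi x| `^ p + l^-1 * partial i phi x ^+ 2).
        rewrite -mulr_sumr big_split/= sumr_const card_ord -mulr_sumr mulrDr -(mulr_natl (l * _)).
        by rewrite !mulrA.
      apply: ler_sum => i _; rewrite /G normrM abs_dabspow//.
      rewrite -!mulrA; apply: ler_wpM2l => //.
      rewrite (_ : g - 1 = p / 2); last by rewrite /g addrC addKr.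
      have -> : `|phi x| `^ p = (`|phi x| `^ (p / 2)) ^+ 2.
        by rewrite -powR_mulrn ?powR_ge0// -powRrM divfK.
      rewrite -[partial i phi x ^+ 2]real_normK ?num_real//.
      set A := _ `^ _; set B := `|_|.
      rewrite ler_pdivlMl// -subr_ge0.
      have -> : l * A ^+ 2 + l^-1 * B ^+ 2 - 2 * (A * B) = l^-1 * (l * A - B) ^+ 2.
        by field; rewrite gt_eqF.
      by rewrite mulr_ge0 ?sqr_ge0// invr_ge0 ltW.
  rewrite ge0_integral_lin2//; last by move=> x _; apply: sumr_ge0 => i _; exact: sqr_ge0.
  rewrite I0E; apply: (@le_trans _ _ ((g / 2 * n.+1%:R * l)%:E * I0%:E + (g / 2 / l)%:E * D%:E)%E).
    by rewrite leeD2l//; apply: lee_wpmul2l.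
  rewrite -!EFinM -EFinD lee_fin le_eqVlt; apply/orP; left; apply/eqP.
  by field; rewrite gt_eqF.
rewrite I0E => GN.
have key (l : R) : 0 < l -> I0 <= (g / 2 * (n.+1%:R * l * I0 + D / l)) * (m `^ (p / 2 - 1) * (V + 1)).
  move=> l0; rewrite -lee_fin; apply: le_trans GN _; rewrite EFinM; apply: lee_pmul.
  - by apply: sume_ge0 => i _; apply: integral_ge0 => x _; rewrite lee_fin.
  - exact: poweR_ge0.
  - exact: Sle.
  apply: (@le_trans _ _ ((m `^ a * (V + 1))%:E `^ n.+1%:R^-1)%E).
    by apply: le_poweR => //; apply: integral_ge0 => x _; rewrite lee_fin powR_ge0.
  rewrite poweR_EFin lee_fin powRM ?powR_ge0 ?(ltW V1)// -powRrM.
  rewrite aE; apply: ler_wpM2l; first exact: powR_ge0.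
  by apply: ler1_powR; rewrite ?lerDr// invf_le1// ler1n.
have mE : m `^ (p / 2 - 1) * m `^ (p / 2 - 1) = I0 / m ^+ 2.
  rewrite -powRD; last by rewrite (gt_eqF m0) implybT.
  rewrite (_ : p / 2 - 1 + (p / 2 - 1) = p - 2%:R); last by lra.
  rewrite powRB; last by rewrite (gt_eqF m0) implybT.
  by rewrite mp powR_mulrn// ltW.
have md0 : 0 < m `^ (p / 2 - 1) by exact: powR_gt0.
(* The weight [l] is chosen so that the term with [I0] equals [I0 / 2]. Absorbing it leaves
   [I0 / 2 <= C D / 2 * (I0 / m^2)], which is where the value of [C] comes from. *)
have m2 : m ^+ 2 <= C * D.
  set w := m `^ _ in mE md0 key *.
  have gp : 0 < g by rewrite (lt_trans _ g2).
  have l0 : 0 < (w * (g * n.+1%:R * (V + 1)))^-1 by rewrite invr_gt0 !mulr_gt0.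
  have := key _ l0.
  have -> : g / 2 * (n.+1%:R * (w * (g * n.+1%:R * (V + 1)))^-1 * I0 +
      D / (w * (g * n.+1%:R * (V + 1)))^-1) * (w * (V + 1)) =
      I0 / 2 + C * D / 2 * (w * w).
    by rewrite /C; field; rewrite !gt_eqF.
  rewrite mE => k.
  have : I0 / 2 <= C * D / 2 * (I0 / m ^+ 2) by clear - k; lra.
  have -> : C * D / 2 * (I0 / m ^+ 2) = I0 / 2 * (C * D / m ^+ 2) by field; rewrite gt_eqF.
  rewrite -{1}[I0 / 2]mulr1 ler_pM2l ?divr_gt0//.
  by rewrite ler_pdivlMr ?exprn_gt0// mul1r.
have p20 : 0 <= p / 2 by rewrite divr_ge0// ltW.
rewrite -mp -(powR_sqr p (ltW m0)).
by apply: (le_powR p20 _ m2); exact: sqr_ge0.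
Qed.

End sobolev.

(** * Weak partial derivatives *)

#[global] Instance leb_ae_filter (R : realType) n : Filter (almost_everywhere (@leb R n)).
Proof. exact: ae_filter_ringOfSetsType. Qed.

(** * The fundamental lemma of the calculus of variations *)

Section borel_hull.
Context {R : realType} {n : nat}.

(** A Dynkin argument reaches Borel sets only, while the completed sigma-algebra has more sets. By
    definition of the outer measure there are Borel supersets of measure within [1/(k+1)], and their
    intersection exceeds [E] by a null set. *)
Lemma borel_hull (E : set 'rV[R]_n) : measurable (E : set (Rn n)) ->
  (leb n E < +oo)%E -> exists B : set 'rV[R]_n,
    [/\ measurable (B : set (borelRn n)), E `<=` B & leb n (B `\` E) = 0%E].
Proof.
move=> mE Eoo.
have Efin : leb n E \is a fin_num by rewrite ge0_fin_numE.
have H (k : nat) : exists B : set 'rV[R]_n, [/\ measurable (B : set (borelRn n)), E `<=` B &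
    (leb n B <= leb n E + k.+1%:R^-1%:E)%E].
  have k0 : 0 < k.+1%:R^-1 :> R by [].
  have [x [A [mA EA] <-]] := @lb_ereal_inf_adherent R _ _ k0 Efin.
  move=> lt; exists (\bigcup_j A j); split => //; first exact: bigcupT_measurable.
  rewrite leb_borel; last exact: bigcupT_measurable.
  apply: le_trans (ltW lt).
  by apply: measure_sigma_subadditive => //; exact: bigcupT_measurable.
have {H} /choice[B HB] := H.
have mB : measurable (\bigcap_k B k : set (borelRn n)).
  by apply: bigcapT_measurable => k; have [] := HB k.
have EB : E `<=` \bigcap_k B k by move=> x Ex k _; have [_ sub _] := HB k; exact: sub.
exists (\bigcap_k B k); split=> //.
have mB' := borel_Rn mB.
have BE : (leb n (\bigcap_k B k) <= leb n E)%E.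
  apply/lee_addgt0Pr => e e0.
  have [k _ ke] := near_infty_natSinv_lt (PosNum e0).
  have {ke} := ke k (leqnn _); rewrite /= => ke.
  have [mBk _ le] := HB k.
  apply: (@le_trans _ _ (leb n (B k))).
    by apply: le_measure; rewrite ?inE//; [exact: borel_Rn|exact: bigcap_inf].
  by apply: le_trans le _; rewrite leeD2l// lee_fin ltW.
rewrite measureD//; last by rewrite (le_lt_trans BE).
rewrite (setIidr EB); apply/eqP; rewrite eq_le.
by rewrite sube_le0 BE/= sube_ge0 ?Efin// le_measure ?inE.
Qed.

End borel_hull.

Section fundamental_lemma.
Context {R : realType} {n : nat}.
Implicit Types (a b c d : 'rV[R]_n).

Definition oboxes : set (set 'rV[R]_n) := [set A | exists c d, A = obox c d].

Definition vmax a c : 'rV[R]_n := \row_i Num.max (a ord0 i) (c ord0 i).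
Definition vmin a c : 'rV[R]_n := \row_i Num.min (a ord0 i) (c ord0 i).

Lemma obox_setI a b c d : obox a b `&` obox c d = obox (vmax a c) (vmin b d).
Proof.
apply/seteqP; split=> x.
  move=> [xab xcd] i; rewrite !mxE gt_max lt_min.
  by have /andP[-> ->] := xab i; have /andP[-> ->] := xcd i.
move=> h; split=> i; have := h i; rewrite !mxE gt_max lt_min.
  by move=> /andP[/andP[-> _] /andP[-> _]].
by move=> /andP[/andP[_ ->] /andP[_ ->]].
Qed.

Lemma borel_oboxes : @measurable _ (@borelRn R n) = <<s oboxes >>.
Proof.
apply/seteqP; split; last first.
  apply: smallest_sub; first exact: sigma_algebra_measurable.
  by move=> _ [c [d ->]]; exact: measurable_obox.
apply: smallest_sub; first exact: smallest_sigma_algebra.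
move=> _ [i [B [mB ->]]].
pose T := g_sigma_algebraType oboxes.
suff mc : measurable_fun setT (fun v : T => (v : 'rV[R]_n) ord0 i).
  by have := mc measurableT B mB; rewrite setTI.
apply: (measurability _ (RGenOpens.measurableE R)) => // _ [_ [x [y ->] <-]].
(* A slab [x < v_i < y] is the union of the boxes whose other sides are []-k, k[]. *)
rewrite setTI (_ : _ @^-1` _ = \bigcup_k
   obox (\row_j if j == i then x else - k%:R) (\row_j if j == i then y else k%:R)).
  apply: bigcupT_measurable => k; apply: sub_sigma_algebra; by do 2 eexists.
apply/seteqP; split=> v.
  rewrite /= in_itv/= => vxy.
  have [k Hk] : exists k : nat, forall j, `|v ord0 j| < k%:R.
    exists (\max_(j < n) (Num.truncn `|v ord0 j|).+1)%N => j.
    apply: lt_le_trans (truncnS_gt _) _; rewrite ler_nat.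
    exact: (@leq_bigmax _ (fun j : 'I_n => (Num.truncn `|v ord0 j|).+1)).
  exists k => // j; rewrite !mxE; case: ifPn => [/eqP->//|_].
  by rewrite -ltr_norml.
by move=> [k _ /(_ i)]; rewrite !mxE eqxx /= in_itv.
Qed.

(** Dominated convergence, with majorant [|w|], along bumps that tend to the indicator of the open
    box. *)
Lemma bump_test (Omega : set 'rV[R]_n) (w : 'rV[R]_n -> R) :
  open Omega -> (leb n).-integrable Omega (EFin \o w) ->
  (forall phi, Cc_infty Omega phi -> \int[leb n]_(x in Omega) (w x * phi x) = 0) ->
  forall a b, box a b `<=` Omega -> (\int[leb n]_(x in obox a b) (w x)%:E = 0)%E.
Proof.
move=> oO iw w0 a b abO.
have mO : measurable (Omega : set (Rn n)) by exact: bounded_open_measurable.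
have mob : measurable (obox a b : set (Rn n)) by exact: (borel_Rn (measurable_obox a b)).
have obO : obox a b `<=` Omega.
  by apply: subset_trans abO => x xab i; have /andP[/ltW p /ltW q] := xab i; rewrite in_itv/= p.
have mw := measurable_int _ iw.
have mb (k : nat) : measurable_fun (Omega : set (Rn n)) (bump k.+1%:R^-1 a b).
  apply: (@borel_measurable_fun R n _ _ Omega); first exact: open_borel.
  apply: measurable_funTS; apply: continuous_borel; apply: smooth_continuous.
  exact: bump_smooth.
have mwb k : measurable_fun (Omega : set (Rn n)) (fun x => (w x * bump k.+1%:R^-1 a b x)%:E).
  by apply/measurable_EFinP/measurable_funM => //; exact/measurable_EFinP.
have k0 (k : nat) : 0 < k.+1%:R^-1 :> R by [].
have wb (k : nat) x : (`|(w x * bump k.+1%:R^-1 a b x)%:E| <= `|(w x)%:E|)%E.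
  by rewrite lee_fin normrM ler_piMr// ger0_norm ?bump_ge0//; exact: bump_le1.
have [_ _] : [/\ (leb n).-integrable Omega (fun x => (w x * \1_(obox a b) x)%:E),
    \int[leb n]_(x in Omega) `|(w x * bump k.+1%:R^-1 a b x)%:E -
       (w x * \1_(obox a b) x)%:E| @[k --> \oo] --> 0 &
    \int[leb n]_(x in Omega) (w x * bump k.+1%:R^-1 a b x)%:E @[k --> \oo] -->
    \int[leb n]_(x in Omega) (w x * \1_(obox a b) x)%:E]%E.
  apply: (@dominated_convergence _ _ _ (leb n) Omega mO _ _ (fun x => `|(w x)%:E|%E)).
  - exact: mwb.
  - apply/measurable_EFinP/measurable_funM; first exact/measurable_EFinP.
    exact: measurable_indic.
  - apply: aeW => x _; apply: cvg_EFin; first exact: nearW.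
    by apply: cvgM; [exact: cvg_cst|exact: cvg_bump].
  - exact: integrable_abse.
  - by apply: aeW => x k _; exact: wb.
have -> : (fun k => \int[leb n]_(x in Omega) (w x * bump k.+1%:R^-1 a b x)%:E)%E = cst 0%E.
  apply/funext => k.
  have := w0 _ (bump_Cc (k0 k) abO); rewrite /Rintegral => h.
  rewrite -[LHS]fineK ?h//.
  apply: integrable_fin_num => //.
  by apply: le_integrable iw => // x _; exact: wb.
move=> /(cvg_unique (@ereal_hausdorff R) (cvg_cst _)) h; rewrite [RHS]h.
rewrite -[in LHS](setIidr obO) integral_mkcondr; apply: eq_integral => x _.
by rewrite patchE indicE; case: ifPn => _; rewrite ?mulr1 ?mulr0.
Qed.

(** Inside a fixed box, the Borel sets over which [w] has integral 0 form a Dynkin class; it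
    contains the boxes, which are stable under intersection and generate the Borel sets. Hulls
    extend this to the completed sigma-algebra, so [w] vanishes almost everywhere in the box, and
    countably many boxes cover [Omega]. *)
Lemma fundamental_lemma (Omega : set 'rV[R]_n) (w : 'rV[R]_n -> R) :
  open Omega -> bounded_set Omega -> (leb n).-integrable Omega (EFin \o w) ->
  (forall phi, Cc_infty Omega phi -> \int[leb n]_(x in Omega) (w x * phi x) = 0) ->
  {ae leb n, forall x, Omega x -> w x = 0}.
Proof.
move=> oO bO iw w0.
have mO : measurable (Omega : set (Rn n)) by exact: bounded_open_measurable.
have mw := measurable_int _ iw.
have ob a b : box a b `<=` Omega -> {ae leb n, forall x, obox a b x -> (w x)%:E = 0%E}.
  move=> abO.
  have mob : measurable (obox a b : set (Rn n)) by exact: (borel_Rn (measurable_obox a b)).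
  have obO : obox a b `<=` Omega.
    by apply: subset_trans abO => x xab i; have /andP[/ltW p /ltW q] := xab i; rewrite in_itv/= p.
  have iob : (leb n).-integrable (obox a b) (EFin \o w) by exact: integrableS iw.
  have mobw : measurable_fun (obox a b : set (Rn n)) (EFin \o w) by exact: measurable_int iob.
  have Borel (S : set 'rV[R]_n) : measurable (S : set (borelRn n)) ->
      (\int[leb n]_(x in obox a b `&` S) (w x)%:E = 0)%E.
    rewrite borel_oboxes => mS.
    move: S mS; apply: (@dynkin_induction _ (@borelRn R n) oboxes
      (fun S => \int[leb n]_(x in obox a b `&` S) (w x)%:E = 0)%E borel_oboxes).
    - by move=> _ _ [c [d ->]] [c' [d' ->]]; rewrite obox_setI; do 2 eexists.
    - by rewrite setIT; exact: (bump_test oO iw w0 abO).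
    - move=> _ [c [d ->]]; rewrite obox_setI; apply: (bump_test oO iw w0).
      apply: subset_trans abO => x xin i; have := xin i; rewrite !in_itv/= !mxE.
      by rewrite ge_max le_min => /andP[/andP[-> _] /andP[-> _]].
    - move=> S mS S0; have mS' := borel_Rn mS.
      have E : obox a b = (obox a b `&` S) `|` (obox a b `&` ~` S).
        by rewrite -setIUr setUv setIT.
      have := bump_test oO iw w0 abO; rewrite {1}E integral_setU.
      + by rewrite S0 add0e.
      + exact: measurableI.
      + by apply: measurableI => //; exact: measurableC.
      + by rewrite -E.
      + by apply/disj_set2P; rewrite setIACA setICr setI0.
    - move=> F mF tF F0; rewrite setI_bigcupr integral_bigcup.
      + by apply: eseries0 => k _ _; exact: F0.
      + exact: trivIset_setIl.
      + by move=> k; apply: measurableI => //; exact: borel_Rn.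
      + apply: integrableS iob => //; last by apply: bigcup_sub => k _; exact: subIsetl.
        by apply: bigcup_measurable => k _; apply: measurableI => //; exact: borel_Rn.
  apply: integral_ae_eq => // E Eob mE; rewrite integral0.
  have Eoo : (leb n E < +oo)%E.
    apply: le_lt_trans (leb_bounded oO bO); apply: le_measure; rewrite ?inE//.
    exact: subset_trans Eob obO.
  have [B [mB EB BE]] := borel_hull mE Eoo.
  have mB' := borel_Rn mB.
  have EE : obox a b `&` B = E `|` ((obox a b `&` B) `\` E).
    apply/seteqP; split=> [x h|x [Ex|[]//]].
      by have [Ex|nEx] := pselect (E x); [left|right].
    by split; [exact: Eob|exact: EB].
  have mD : measurable ((obox a b `&` B) `\` E : set (Rn n)).
    by apply: measurableD => //; exact: measurableI.
  have := Borel _ mB; rewrite EE integral_setU; [|exact: mE|exact: mD| |].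
  - rewrite [X in (_ + X)%E](_ : _ = 0%E) ?adde0//.
    apply: (null_set_integral mD).
    + by apply: (measurable_funS mob _ mobw) => x [[]].
    + by apply: (subset_measure0 mD _ _ BE); [exact: measurableD|move=> x [[]]].
  - by rewrite -EE; apply: (measurable_funS mob _ mobw) => x [].
  - by apply/disj_set2P; rewrite setDE setIA setIAC setICr set0I.
(* Here [k] is the code of a pair of rational vectors: one null set per natural number, merged by
   [ae_foralln]. *)
have /ae_foralln : forall k, {ae leb n, forall x, forall p : 'rV[rat]_n * 'rV[rat]_n,
    unpickle k = Some p -> box (qvec p.1) (qvec p.2) `<=` Omega ->
    obox (qvec p.1) (qvec p.2) x -> (w x)%:E = 0%E}.
  move=> k; case: (unpickle k) => [p|]; last by apply: aeW.
  have [sub|nsub] := pselect (box (qvec p.1) (qvec p.2) `<=` Omega).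
    by apply: filterS (ob _ _ sub) => x h _ [<-].
  by apply: aeW => x _ [<-].
apply: filterS => x h; rewrite (open_bigcup_obox oO) => -[p [_ pO] px].
by have [] := h (pickle p) p (pickleK p) pO px.
Qed.

End fundamental_lemma.

(** * Square-integrable functions and convergence in [L^2] *)

Section square_integrable.
Context d (T : measurableType d) {R : realType} (mu : {measure set T -> \bar R}) (A : set T).
Hypotheses (mO : measurable A) (fO : (mu A < +oo)%E).
Implicit Types f g h : T -> R.

(* [L2 Omega] is convertible to [sqint (leb n) Omega]. *)
Definition sqint f : Prop :=
  measurable_fun A f /\ (\int[mu]_(x in A) (f x ^+ 2)%:E < +oo)%E.

Lemma measurable_sqr f : measurable_fun A f ->
  measurable_fun A (fun x => (f x ^+ 2)%:E).
Proof. by move=> mf; apply/measurable_EFinP; exact: measurable_funX. Qed.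

Lemma sqint_lty f : sqint f -> (\int[mu]_(x in A) (f x ^+ 2)%:E < +oo)%E.
Proof. by case. Qed.

Lemma sqint_le f g K L : sqint f -> sqint g -> 0 <= K -> 0 <= L ->
  forall h, measurable_fun A h ->
  {ae mu, forall x, A x -> h x ^+ 2 <= K * f x ^+ 2 + L * g x ^+ 2} ->
  (\int[mu]_(x in A) (h x ^+ 2)%:E <=
   K%:E * \int[mu]_(x in A) (f x ^+ 2)%:E + L%:E * \int[mu]_(x in A) (g x ^+ 2)%:E)%E.
Proof.
move=> [mf _] [mg _] K0 L0 h mh hle.
have mf2 : measurable_fun A (fun x => f x ^+ 2) by exact: measurable_funX.
have mg2 : measurable_fun A (fun x => g x ^+ 2) by exact: measurable_funX.
rewrite -ge0_integral_lin2//; last 2 first.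
- by move=> x _; exact: sqr_ge0.
- by move=> x _; exact: sqr_ge0.
apply: ae_ge0_le_integral => //.
- by move=> x _; rewrite lee_fin sqr_ge0.
- exact: measurable_sqr.
- by move=> x _; rewrite lee_fin addr_ge0// mulr_ge0// sqr_ge0.
- by apply/measurable_EFinP/measurable_funD; apply: measurable_funM.
Qed.

Lemma sqint_comb_le f g h K L : sqint f -> sqint g -> 0 <= K -> 0 <= L ->
  measurable_fun A h ->
  (forall x, A x -> h x ^+ 2 <= K * f x ^+ 2 + L * g x ^+ 2) -> sqint h.
Proof.
move=> Lf Lg K0 L0 mh hle; split => //.
apply: le_lt_trans (sqint_le Lf Lg K0 L0 mh (aeW _ hle)) _.
have Lf2 := sqint_lty Lf; have Lg2 := sqint_lty Lg.
apply: lte_add_pinfty; apply: lte_mul_pinfty => //; rewrite ?lee_fin//.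
Qed.

Lemma sqint_B f g : sqint f -> sqint g -> sqint (f \- g).
Proof.
move=> Lf Lg; have [mf _] := Lf; have [mg _] := Lg.
apply: (@sqint_comb_le f g _ 2 2) => //; first exact: measurable_funB.
move=> x _ /=; have := sqr_ge0 (f x + g x).
by rewrite !expr2; set a := f x; set b := g x; lra.
Qed.

Lemma sqint_bounded_mul f (a : T -> R) (K : R) : sqint f -> measurable_fun A a ->
  (forall x, A x -> `|a x| <= K) -> sqint (fun x => a x * f x).
Proof.
move=> Lf ma aK; have [mf _] := Lf.
apply: (@sqint_comb_le f f _ (K ^+ 2) 0) => //; first exact: sqr_ge0.
  exact: measurable_funM.
move=> x Ox; rewrite mul0r addr0 exprMn; apply: ler_wpM2r; first exact: sqr_ge0.
rewrite -[a x ^+ 2]real_normK ?num_real//; apply: lerXn2r; rewrite ?nnegrE ?aK//.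
by rewrite (le_trans _ (aK x Ox)).
Qed.

Lemma sqint_cst (c : R) : sqint (cst c).
Proof.
split; first exact: measurable_cst.
rewrite (integral_cst _ mO (c ^+ 2)%:E).
by rewrite lte_mul_pinfty ?lee_fin ?sqr_ge0.
Qed.

Lemma sqint_mul_integrable f g : sqint f -> sqint g ->
  mu.-integrable A (fun x => (f x * g x)%:E).
Proof.
move=> Lf Lg; have [mf If] := Lf; have [mg Ig] := Lg.
apply/integrableP; split; first by apply/measurable_EFinP; exact: measurable_funM.
apply: (@le_lt_trans _ _ (\int[mu]_(x in A) (1 * f x ^+ 2 + 1 * g x ^+ 2)%:E)%E).
  apply: ge0_le_integral => //.
  - by apply/measurable_EFinP/measurableT_comp => //; exact: measurable_funM.
  - by apply/measurable_EFinP/measurable_funD; apply: measurable_funM => //; exact: measurable_funX.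
  - move=> x _; rewrite lee_fin normrM !mul1r.
    rewrite -[f x ^+ 2]real_normK ?num_real// -[g x ^+ 2]real_normK ?num_real//.
    have := sqr_ge0 (`|f x| - `|g x|); have := sqr_ge0 (`|f x| + `|g x|).
    by rewrite !expr2; set a := `|f x|; set b := `|g x|; lra.
rewrite ge0_integral_lin2// ?mul1e; last 4 first.
- exact: measurable_funX.
- exact: measurable_funX.
- by move=> x _; exact: sqr_ge0.
- by move=> x _; exact: sqr_ge0.
exact: lte_add_pinfty.
Qed.

Lemma sqint_integrable f : sqint f -> mu.-integrable A (EFin \o f).
Proof.
move=> Lf; have := sqint_mul_integrable Lf (sqint_cst 1).
by apply: eq_integrable => // x _ /=; rewrite mulr1.
Qed.

End square_integrable.

Section square_integrable_leb.
Context {R : realType} {n : nat} (Omega : set 'rV[R]_n).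
Hypotheses (oO : open Omega) (bO : bounded_set Omega).
Implicit Types f g h phi psi : 'rV[R]_n -> R.
Local Notation mu := (@leb R n).

Let mO : measurable (Omega : set (Rn n)).
Proof. exact: bounded_open_measurable. Qed.

Lemma L2_B f g : L2 Omega f -> L2 Omega g -> L2 Omega (f \- g).
Proof. exact: sqint_B. Qed.

Lemma L2_bounded_mul f (a : 'rV[R]_n -> R) (K : R) : L2 Omega f -> measurable_fun (Omega : set (Rn n)) a ->
  (forall x, Omega x -> `|a x| <= K) -> L2 Omega (fun x => a x * f x).
Proof. exact: sqint_bounded_mul. Qed.

Lemma L2_mul_integrable f g : L2 Omega f -> L2 Omega g ->
  mu.-integrable Omega (fun x => (f x * g x)%:E).
Proof. exact: sqint_mul_integrable. Qed.

Lemma L2_integrable f : L2 Omega f -> mu.-integrable Omega (EFin \o f).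
Proof. exact: (sqint_integrable mO (leb_bounded oO bO)). Qed.

Lemma L2_cst (c : R) : L2 Omega (cst c).
Proof. exact: (sqint_cst mO (leb_bounded oO bO)). Qed.

Lemma Cc_measurable phi : Cc_infty Omega phi -> measurable_fun (Omega : set (Rn n)) phi.
Proof.
move=> [sphi _ _]; apply: (@borel_measurable_fun R n _ _ Omega); first exact: open_borel.
by apply: measurable_funTS; apply: continuous_borel; exact: smooth_continuous.
Qed.

Lemma Cc_L2 phi : Cc_infty Omega phi -> L2 Omega phi.
Proof.
move=> hphi; have [K K0 HK] := Cc_infty_bounded hphi.
have := L2_bounded_mul (L2_cst 1) (Cc_measurable hphi) (fun x _ => HK x).
by under eq_fun do rewrite /= mulr1.
Qed.

Lemma Cc_parts phi psi i : Cc_infty Omega phi -> Cc_infty Omega psi ->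
  \int[mu]_(x in Omega) (phi x * partial i psi x) =
  - \int[mu]_(x in Omega) (partial i phi x * psi x).
Proof.
move=> hphi hpsi; have [sphi _ _] := hphi; have [spsi _ _] := hpsi.
have [M M0 farM] := Cc_infty_far bO.
pose chi x := phi x * psi x.
have hchi : Cc_infty Omega chi := Cc_infty_mul hphi spsi.
have hdchi := Cc_infty_partial i hchi.
have [schi _ _] := hchi.
have bOm : measurable (Omega : set (borelRn n)) by exact: open_borel.
have cd : continuous (partial i chi).
  by apply: smooth_continuous; exact: smooth_partial.
have mE := proj2 (measurable_EFinP _ _) (continuous_borel cd).
have d0 x : ~ Omega x -> partial i chi x = 0 by exact: Cc_infty_supp.
have I0 : \int[mu]_(x in Omega) (partial i chi x) = 0.
  rewrite /Rintegral integralE.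
  rewrite (@ge0_integral_lebT _ _ Omega (EFin \o partial i chi)^\+%E)//;
    last 2 first.
  - exact: measurable_funepos.
  - by move=> x nx; rewrite funepos.unlock/= (d0 x nx) maxxx.
  rewrite (@ge0_integral_lebT _ _ Omega (EFin \o partial i chi)^\-%E)//;
    last 2 first.
  - exact: measurable_funeneg.
  - by move=> x nx; rewrite funeneg.unlock/= (d0 x nx) oppr0 maxxx.
  rewrite (@integral_partial0 R n i _ M)//.
  (* The two equal integrals cancel; if they are infinite, [fine] of their difference is 0 by
     convention. *)
  - set z := (\int[_]_x _)%E; case: z => [r| |]//=.
    by rewrite subrr.
  - by move=> x; exact: smooth_derivable.
  - by move=> x; exact: farM hchi x i.
have I1 : mu.-integrable Omega (EFin \o (fun x => phi x * partial i psi x)).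
  exact: (L2_mul_integrable (Cc_L2 hphi) (Cc_L2 (Cc_infty_partial i hpsi))).
have I2 : mu.-integrable Omega (EFin \o (fun x => partial i phi x * psi x)).
  exact: (L2_mul_integrable (Cc_L2 (Cc_infty_partial i hphi)) (Cc_L2 hpsi)).
apply/eqP; rewrite -addr_eq0 -RintegralD//; apply/eqP.
rewrite -[RHS]I0; apply: eq_Rintegral => x _.
by rewrite /chi partialM// [psi x * _]mulrC.
Qed.

End square_integrable_leb.

Section L2_convergence.
Context d (T : measurableType d) {R : realType} (mu : {measure set T -> \bar R}) (A : set T).
Hypotheses (mA : measurable A) (fA : (mu A < +oo)%E).
Implicit Types f g h : T -> R.

Definition cvgL2 (f_ : nat -> T -> R) f : Prop :=
  (\int[mu]_(x in A) ((f_ k x - f x) ^+ 2)%:E)%E @[k --> \oo] --> 0%E.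

Lemma cvgL2P (f_ : nat -> T -> R) f : cvgL2 f_ f <->
  forall e : R, 0 < e ->
    \forall k \near \oo, (\int[mu]_(x in A) ((f_ k x - f x) ^+ 2)%:E <= e%:E)%E.
Proof.
split=> [/fine_cvgP[fin cv] e e0|H].
  move/cvgrPdist_le : cv => /(_ e e0) cv.
  near=> k.
  have kfin : (\int[mu]_(x in A) ((f_ k x - f x) ^+ 2)%:E)%E \is a fin_num by near: k.
  rewrite -(fineK kfin) lee_fin; apply: le_trans (ler_norm _) _.
  by rewrite -[X in `|X| <= _]opprK normrN -[X in `|X| <= _]add0r; near: k.
apply/fine_cvgP; split.
  near=> k; rewrite ge0_fin_numE; last by apply: integral_ge0 => x _; rewrite lee_fin sqr_ge0.
  have : (\int[mu]_(x in A) ((f_ k x - f x) ^+ 2)%:E <= 1%:E)%E by near: k; exact: H.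
  by move=> /le_lt_trans; apply; rewrite ltry.
apply/cvgrPdist_le => e e0; near=> k.
have ge0 : (0 <= \int[mu]_(x in A) ((f_ k x - f x) ^+ 2)%:E)%E.
  by apply: integral_ge0 => x _; rewrite lee_fin sqr_ge0.
have lee : (\int[mu]_(x in A) ((f_ k x - f x) ^+ 2)%:E <= e%:E)%E by near: k; exact: H.
rewrite /= sub0r normrN ger0_norm ?fine_ge0// -lee_fin fineK//.
by rewrite ge0_fin_numE// (le_lt_trans lee)// ltry.
Unshelve. all: by end_near. Qed.

Lemma cvgL2_comb (f_ g_ h_ : nat -> T -> R) f g h K L : 0 <= K -> 0 <= L ->
  (forall k, sqint mu A (f_ k \- f)) -> (forall k, sqint mu A (g_ k \- g)) ->
  (forall k, measurable_fun A (h_ k \- h)) ->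
  cvgL2 f_ f -> cvgL2 g_ g ->
  (forall k x, A x -> (h_ k x - h x) ^+ 2 <=
     K * (f_ k x - f x) ^+ 2 + L * (g_ k x - g x) ^+ 2) ->
  cvgL2 h_ h.
Proof.
move=> K0 L0 sf sg mh /cvgL2P cf /cvgL2P cg hle; apply/cvgL2P => e e0.
have d0 : 0 < e / (K + L + 1).
  by rewrite divr_gt0// ltr_wpDl// addr_ge0.
near=> k.
apply: le_trans (sqint_le mA (sf k) (sg k) K0 L0 (mh k) (aeW _ (hle k))) _.
have l1 : (\int[mu]_(x in A) ((f_ k x - f x) ^+ 2)%:E <= (e / (K + L + 1))%:E)%E.
  by near: k; exact: cf.
have l2 : (\int[mu]_(x in A) ((g_ k x - g x) ^+ 2)%:E <= (e / (K + L + 1))%:E)%E.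
  by near: k; exact: cg.
apply: (@le_trans _ _ (K%:E * (e / (K + L + 1))%:E + L%:E * (e / (K + L + 1))%:E)%E).
  by apply: leeD; apply: lee_wpmul2l; rewrite ?lee_fin.
rewrite -!EFinM -EFinD lee_fin -mulrDl mulrCA ler_piMr ?(ltW e0)//.
by rewrite ler_pdivrMr ?mul1r ?lerDl// ltr_wpDl// addr_ge0.
Unshelve. all: by end_near. Qed.

Lemma cvgL2_Rintegral (f_ : nat -> T -> R) f g :
  (forall k, sqint mu A (f_ k)) -> sqint mu A f -> sqint mu A g -> cvgL2 f_ f ->
  \int[mu]_(x in A) (f_ k x * g x) @[k --> \oo] --> \int[mu]_(x in A) (f x * g x).
Proof.
move=> sf_ sf sg /cvgL2P cf; apply/cvgrPdist_le => e e0.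
pose G := fine (\int[mu]_(x in A) (g x ^+ 2)%:E).
have GE : (\int[mu]_(x in A) (g x ^+ 2)%:E)%E = G%:E.
  rewrite fineK// ge0_fin_numE ?(proj2 sg)//.
  by apply: integral_ge0 => x _; rewrite lee_fin sqr_ge0.
have G0 : 0 <= G by rewrite -lee_fin -GE; apply: integral_ge0 => x _; rewrite lee_fin sqr_ge0.
(* Weight for Young's inequality [|a b| <= a^2 / (2 l) + l b^2 / 2]: it makes [l G <= e], so the
   second term is at most [e / 2], and the first is at most [e / 2] once the squared distance is at
   most [e l]. *)
pose l := e / (G + 1).
have l0 : 0 < l by rewrite divr_gt0// ltr_wpDl.
near=> k.
rewrite -RintegralB//; last 2 first.
- exact: sqint_mul_integrable.
- exact: sqint_mul_integrable.
have sB : sqint mu A (f \- f_ k) by exact: sqint_B.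
have sB' : sqint mu A (f_ k \- f) by exact: sqint_B.
rewrite (_ : \int[mu]_(x in A) _ = \int[mu]_(x in A) ((f \- f_ k) x * g x)); last first.
  by apply: eq_Rintegral => x _; rewrite /= mulrBl.
have iB : mu.-integrable A (EFin \o (fun x => (f \- f_ k) x * g x)).
  exact: sqint_mul_integrable.
apply: le_trans (le_normr_Rintegral mA iB) _.
have [mB _] := sB; have [mg _] := sg.
rewrite -lee_fin /Rintegral fineK; last first.
  by apply: integrable_fin_num => //; exact: integrable_abse iB.
apply: (@le_trans _ _ (\int[mu]_(x in A) ((2 * l)^-1 * (f_ k \- f) x ^+ 2 + l / 2 * g x ^+ 2)%:E)%E).
  apply: ge0_le_integral => //.
  - apply/measurable_EFinP/measurableT_comp => //.
    exact: measurable_funM.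
  - apply/measurable_EFinP/measurable_funD; apply: measurable_funM => //; apply: measurable_funX => //.
    by have [] := sB'.
  - move=> x _; rewrite lee_fin /= normrM distrC.
    rewrite -[(f_ k x - f x) ^+ 2]real_normK ?num_real// -[g x ^+ 2]real_normK ?num_real//.
    set a := `|_|; set b := `|_|.
    rewrite -subr_ge0.
    have -> : (2 * l)^-1 * a ^+ 2 + l / 2 * b ^+ 2 - a * b = (2 * l)^-1 * (a - l * b) ^+ 2.
      by field; rewrite gt_eqF.
    by rewrite mulr_ge0 ?sqr_ge0// invr_ge0 mulr_ge0// ltW.
have [mB' _] := sB'.
rewrite ge0_integral_lin2//; last 6 first.
- exact: measurable_funX.
- exact: measurable_funX.
- by move=> x _; exact: sqr_ge0.
- by move=> x _; exact: sqr_ge0.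
- by rewrite invr_ge0 mulr_ge0// ltW.
- by rewrite divr_ge0// ltW.
rewrite GE.
have le : (\int[mu]_(x in A) ((f_ k \- f) x ^+ 2)%:E <= (e * l)%:E)%E.
  by near: k; apply: cf; rewrite mulr_gt0.
apply: (@le_trans _ _ ((2 * l)^-1%:E * (e * l)%:E + (l / 2)%:E * G%:E)%E).
  by rewrite leeD2r//; apply: lee_wpmul2l => //; rewrite lee_fin invr_ge0 mulr_ge0// ltW.
rewrite -!EFinM -EFinD lee_fin.
have -> : (2 * l)^-1 * (e * l) = e / 2 by field; rewrite gt_eqF.
have lG : l * G <= e.
  rewrite /l mulrAC ler_pdivrMr ?ltr_wpDl//; apply: ler_wpM2l; first exact: ltW.
  by rewrite lerDl.
lra.
Unshelve. all: by end_near. Qed.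

(** The series of the squared differences has a finite integral, by comparison with a geometric
    series. It is therefore finite almost everywhere, and its terms tend to 0 there. *)
Lemma cvgL2_ae (f_ : nat -> T -> R) f :
  (forall k, sqint mu A (f_ k)) -> sqint mu A f ->
  (forall k, \int[mu]_(x in A) ((f_ k x - f x) ^+ 2)%:E <= (2^-1 ^+ k)%:E)%E ->
  {ae mu, forall x, A x -> f_ k x @[k --> \oo] --> f x}.
Proof.
move=> sf_ sf le.
pose g k x := ((f_ k x - f x) ^+ 2)%:E.
have mg k : measurable_fun A (g k).
  have [mB _] := sqint_B mA (sf_ k) sf.
  by apply/measurable_EFinP; exact: measurable_funX.
have g0 k x : A x -> (0 <= g k x)%E by rewrite lee_fin sqr_ge0.
have mS : measurable_fun A (fun x => \sum_(k <oo) g k x)%E.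
  by apply: (@ge0_emeasurable_sum _ _ _ A g xpredT) => k *; [exact: g0|exact: mg].
have iS : mu.-integrable A (fun x => \sum_(k <oo) g k x)%E.
  apply/integrableP; split => //.
  rewrite (_ : integral _ _ _ = \int[mu]_(x in A) (\sum_(k <oo) g k x))%E; last first.
    apply: eq_integral => x /[!inE] Ax; rewrite gee0_abs//.
    by apply: nneseries_ge0 => k _ _; exact: g0.
  rewrite integral_nneseries//.
  apply: (@le_lt_trans _ _ (\sum_(k <oo) (2^-1 ^+ k)%:E)%E).
    apply: lee_nneseries => [k _ _|k _]; last exact: le.
    by apply: integral_ge0 => x Ax; exact: g0.
  have c : cvgn (series (geometric 1 (2^-1 : R))).
    by apply: is_cvg_geometric_series; rewrite ger0_norm// invf_lt1// ltr1n.
  rewrite (_ : (fun k => _) = EFin \o (series (geometric 1 (2^-1 : R)))); last first.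
    apply/funext => m /=; rewrite sumEFin; congr EFin.
    by apply: eq_bigr => i _ /=; rewrite mul1r.
  by rewrite EFin_lim// ltry.
apply: filterS (integrable_ae mA iS) => x fin Ax.
have {}fin := fin Ax.
pose a k := (f_ k x - f x) ^+ 2.
have ca : cvgn (series a).
  apply: nondecreasing_is_cvgn.
    by apply: nondecreasing_series => i _ _; exact: sqr_ge0.
  exists (fine (\sum_(k <oo) g k x)%E) => _ [m _ <-].
  rewrite -lee_fin fineK// /series/= -sumEFin.
  by apply: (@nneseries_lim_ge _ (g ^~ x) xpredT) => i _ _; exact: g0.
have a0 := cvg_series_cvg_0 ca.
apply/cvgrPdist_lt => e e0.
have e2 : 0 < e ^+ 2 by rewrite exprn_gt0.
move/cvgrPdist_lt : a0 => /(_ _ e2); apply: filterS => k.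
rewrite sub0r normrN /a normrX -normrX => h.
by rewrite distrC -(@ltr_pXn2r _ 2)// ?nnegrE ?(ltW e0)// -normrX.
Qed.

End L2_convergence.

Section ae_convergence.
Context d (T : measurableType d) {R : realType} (mu : {measure set T -> \bar R}) (A : set T).
Hypotheses (mA : measurable A) (fA : (mu A < +oo)%E).
Implicit Types f g h : T -> R.

Lemma fatou_le (f_ : nat -> T -> R) f (B : \bar R) :
  (forall k, measurable_fun A (f_ k)) -> measurable_fun A f ->
  (forall k x, A x -> 0 <= f_ k x) -> (forall x, A x -> 0 <= f x) ->
  {ae mu, forall x, A x -> f_ k x @[k --> \oo] --> f x} ->
  (forall k, \int[mu]_(x in A) (f_ k x)%:E <= B)%E ->
  (\int[mu]_(x in A) (f x)%:E <= B)%E.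
Proof.
move=> mf_ mf f_0 f0 cf leB.
pose h k x := (f_ k x)%:E.
have mh k : measurable_fun A (h k) by exact/measurable_EFinP.
have h0 k x : A x -> (0 <= h k x)%E by move=> Ax; rewrite lee_fin f_0.
have mL : measurable_fun A (fun x => limn_einf (h ^~ x)).
  rewrite /limn_einf; apply: measurableT_comp => //.
  by apply: measurable_fun_limn_esup => k; exact: measurableT_comp.
have L0 x : A x -> (0 <= limn_einf (h ^~ x))%E.
  by move=> Ax; rewrite limn_einf_lim; apply: lime_ge; [exact: is_cvg_einfs|
    apply: nearW => k; apply: le_ereal_inf_tmp => _ [m /= _ <-]; exact: h0].
apply: (@le_trans _ _ (\int[mu]_(x in A) limn_einf (h ^~ x))%E).
  apply: ae_ge0_le_integral => //.
  - exact/measurable_EFinP.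
  - apply: filterS cf => x cx Ax.
    have ch : (h k x)%E @[k --> \oo] --> (f x)%:E.
      by apply: cvg_EFin; [exact: nearW|exact: cx].
    by have [-> _] := cvg_limn_einf_sup ch.
apply: le_trans (fatou mu mA mh h0) _.
rewrite limn_einf_lim; apply: lime_le; first exact: is_cvg_einfs.
apply: nearW => k; apply: le_trans (leB k).
by apply: ereal_inf_lbound; exists k => /=.
Qed.

(** Splitting [a_k w_k - a w = a_k (w_k - w) + (a_k - a) w]: the first part is controlled by the
    bound [L], the second by dominated convergence with majorant [(2L)^2 w^2]. *)
Lemma cvgL2_bounded_mul (a_ : nat -> T -> R) (a : T -> R) (w_ : nat -> T -> R) (w : T -> R) (L : R) :
  (forall k, measurable_fun A (a_ k)) -> measurable_fun A a ->
  (forall k x, A x -> `|a_ k x| <= L) -> (forall x, A x -> `|a x| <= L) ->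
  {ae mu, forall x, A x -> a_ k x @[k --> \oo] --> a x} ->
  (forall k, sqint mu A (w_ k)) -> sqint mu A w -> cvgL2 mu A w_ w ->
  cvgL2 mu A (fun k x => a_ k x * w_ k x) (fun x => a x * w x).
Proof.
move=> ma_ ma a_L aL ca sw_ sw cw.
have mw_ k := proj1 (sw_ k); have mw := proj1 sw.
pose m k x := (a_ k x - a x) * w x.
have mm k : measurable_fun A (m k).
  by apply: measurable_funM => //; exact: measurable_funB.
have bB k x : A x -> `|a_ k x - a x| <= L + L.
  by move=> Ax; apply: le_trans (ler_normB _ _) _; rewrite lerD// ?a_L ?aL.
have sm k : sqint mu A (m k).
  by apply: (sqint_bounded_mul mA sw) (bB k) => //; exact: measurable_funB.
have cm : cvgL2 mu A m (cst 0).
  have iG : mu.-integrable A (fun x => ((L + L) ^+ 2 * w x ^+ 2)%:E).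
    have sb := sqint_bounded_mul mA sw (measurable_cst (L + L)) (fun x _ => lexx `|L + L|).
    have := sqint_mul_integrable mA sb sb.
    by apply: eq_integrable => // x _; rewrite /= mulrACA.
  have [| | | |_ _] := @dominated_convergence _ _ R mu A mA
      (fun k x => ((m k x - 0) ^+ 2)%:E) (cst 0%E) (fun x => ((L + L) ^+ 2 * w x ^+ 2)%:E) _ _ _ iG.
  - by move=> k; apply/measurable_EFinP/measurable_funX/measurable_funB.
  - exact: measurable_cst.
  - apply: filterS ca => x cx Ax.
    apply: cvg_EFin; first exact: nearW.
    rewrite [X in _ --> X](_ : _ = ((a x - a x) * w x - 0) ^+ 2); last by rewrite /= subrr mul0r subr0 expr0n.
    have cm : (m k x - 0) @[k --> \oo] --> (a x - a x) * w x - 0.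
      by apply: cvgB (cvg_cst _); apply: cvgMl; apply: cvgB (cvg_cst _); exact: cx.
    exact: (cvgM cm cm).
  - apply: aeW => x k Ax; rewrite abse_EFin lee_fin ger0_norm ?sqr_ge0// subr0 exprMn.
    apply: ler_wpM2r; first exact: sqr_ge0.
    rewrite -[X in X <= _]real_normK ?num_real//; apply: lerXn2r; rewrite ?nnegrE ?bB//.
    by rewrite (le_trans _ (bB k x Ax)).
  - by rewrite integral0.
have sB k : sqint mu A (w_ k \- w) by exact: sqint_B.
have sB0 k : sqint mu A (m k \- cst 0) by apply: sqint_B => //; exact: sqint_cst.
apply: (cvgL2_comb mA _ _ sB sB0 _ cw cm) (_ : forall k x, A x -> _ <= (2 * L ^+ 2) * _ + 2 * _) => //.
- by rewrite mulr_ge0// sqr_ge0.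
- by move=> k; apply: measurable_funB; exact: measurable_funM.
- move=> k x Ax; rewrite /m subr0.
  have -> : a_ k x * w_ k x - a x * w x =
    a_ k x * (w_ k x - w x) + (a_ k x - a x) * w x by ring.
  have h1 : (a_ k x * (w_ k x - w x)) ^+ 2 <= L ^+ 2 * (w_ k x - w x) ^+ 2.
    rewrite exprMn; apply: ler_wpM2r; first exact: sqr_ge0.
    rewrite -[X in X <= _]real_normK ?num_real//; apply: lerXn2r; rewrite ?nnegrE ?a_L//.
    by rewrite (le_trans _ (a_L k x Ax)).
  move: h1; set z := a_ k x * _; set y := (_ - _) * w x => h1.
  have := sqr_ge0 (z - y); move: h1.
  set t := L ^+ 2 * _; rewrite -mulrA -/t !expr2; clear; lra.
Qed.

Lemma cvgL2_geo (f_ : nat -> T -> R) f :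
  (forall k, \int[mu]_(x in A) ((f_ k x - f x) ^+ 2)%:E <= (2^-1 ^+ k)%:E)%E ->
  cvgL2 mu A f_ f.
Proof.
move=> le; apply/cvgL2P => e e0.
have /cvgrPdist_le/(_ e e0) : (2^-1 : R) ^+ k @[k --> \oo] --> (0 : R).
  by apply: cvg_expr; rewrite ger0_norm// invf_lt1// ltr1n.
apply: filterS => k; rewrite sub0r normrN ger0_norm ?exprn_ge0// => ke.
exact: le_trans (le k) _.
Qed.

Lemma cvgL2_ae_eq (f_ : nat -> T -> R) f g :
  (forall k, measurable_fun A (f_ k)) -> measurable_fun A f -> measurable_fun A g ->
  {ae mu, forall x, A x -> f x = g x} -> cvgL2 mu A f_ f -> cvgL2 mu A f_ g.
Proof.
move=> mf_ mf mg fg /cvgL2P cf; apply/cvgL2P => e e0.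
apply: filterS (cf e e0) => k; apply: le_trans.
apply: ae_ge0_le_integral => //.
- by move=> x _; rewrite lee_fin sqr_ge0.
- by apply/measurable_EFinP/measurable_funX/measurable_funB.
- by move=> x _; rewrite lee_fin sqr_ge0.
- by apply/measurable_EFinP/measurable_funX/measurable_funB.
- by apply: filterS fg => x fg Ax; rewrite fg.
Qed.

End ae_convergence.

Section ae_le.
Context d (T : measurableType d) {R : realType} (mu : {measure set T -> \bar R}) (A : set T).
Hypotheses (mA : measurable A).
Implicit Types f g h : T -> R.

Lemma ae_le_integral_EFin f g : measurable_fun A f -> measurable_fun A g ->
  (forall x, A x -> 0 <= f x) -> (forall x, A x -> 0 <= g x) ->
  {ae mu, forall x, A x -> f x <= g x} ->
  (\int[mu]_(x in A) (f x)%:E <= \int[mu]_(x in A) (g x)%:E)%E.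
Proof.
move=> mf mg f0 g0 fg; apply: ae_ge0_le_integral => //.
- exact/measurable_EFinP.
- exact/measurable_EFinP.
Qed.

Lemma Rintegral_mulBl f g h : mu.-integrable A (fun x => (f x * h x)%:E) ->
  mu.-integrable A (fun x => (g x * h x)%:E) ->
  \int[mu]_(x in A) ((f x - g x) * h x) =
  \int[mu]_(x in A) (f x * h x) - \int[mu]_(x in A) (g x * h x).
Proof.
move=> fh gh; rewrite -RintegralB//; apply: eq_Rintegral => x _.
by rewrite mulrBl.
Qed.

Lemma ge0_integral_sum_le m f (g : 'I_m -> T -> R) (D : R) :
  measurable_fun A f -> (forall i, measurable_fun A (g i)) ->
  (forall x, 0 <= f x) -> (forall i x, 0 <= g i x) ->
  (\int[mu]_(x in A) (f x)%:E <= D%:E)%E ->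
  (forall i, \int[mu]_(x in A) (g i x)%:E <= D%:E)%E ->
  (\int[mu]_(x in A) (f x + \sum_(i < m) g i x)%:E <= (m.+1%:R * D)%:E)%E.
Proof.
move=> mf mg f0 g0 fD gD.
rewrite (_ : integral _ _ _ = \int[mu]_(x in A) ((f x)%:E + \sum_(i < m) (g i x)%:E))%E; last first.
  by apply: eq_integral => x _; rewrite EFinD sumEFin.
rewrite ge0_integralD//; last 4 first.
- by move=> x _; rewrite lee_fin.
- exact/measurable_EFinP.
- by move=> x _; apply: sume_ge0 => i _; rewrite lee_fin.
- by apply: emeasurable_sum => i; exact/measurable_EFinP.
rewrite ge0_integral_sum//; last 2 first.
- by move=> i; exact/measurable_EFinP.
- by move=> i x _; rewrite lee_fin.
apply: (@le_trans _ _ (D%:E + \sum_(i < m) D%:E)%E).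
  by apply: leeD => //; apply: lee_sum => i _; exact: gD.
by rewrite sumEFin sumr_const card_ord -EFinD lee_fin mulr_natl mulrS.
Qed.

End ae_le.

(** * Uniqueness of weak partial derivatives and approximation by test functions in [H^1_0] *)

Section weak_partial.
Context {R : realType} {n : nat} (Omega : set 'rV[R]_n).
Hypotheses (oO : open Omega) (bO : bounded_set Omega).
Implicit Types f g h phi psi u v w : 'rV[R]_n -> R.
Local Notation mu := (@leb R n).

Let mO : measurable (Omega : set (Rn n)).
Proof. exact: bounded_open_measurable. Qed.

Lemma Cc_partial_L2 i phi : Cc_infty Omega phi -> L2 Omega (partial i phi).
Proof. by move=> hphi; exact (Cc_L2 oO bO (Cc_infty_partial i hphi)). Qed.

Lemma is_weak_partial_unique i v w1 w2 :
  is_weak_partial Omega i v w1 -> is_weak_partial Omega i v w2 ->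
  {ae mu, forall x, Omega x -> w1 x = w2 x}.
Proof.
move=> [L1 h1] [L2' h2].
have LB : L2 Omega (w1 \- w2) by exact (L2_B oO L1 L2').
have := fundamental_lemma oO bO (L2_integrable oO bO LB).
have H phi : Cc_infty Omega phi -> \int[mu]_(x in Omega) ((w1 \- w2) x * phi x) = 0.
  move=> hphi; have Lphi := Cc_L2 oO bO hphi.
  rewrite (Rintegral_mulBl mO (L2_mul_integrable oO L1 Lphi) (L2_mul_integrable oO L2' Lphi)).
  have := h2 _ hphi; rewrite (h1 _ hphi) => /eqP; rewrite eqr_opp => /eqP ->.
  by rewrite subrr.
move=> /(_ H); apply: filterS => x h Ox.
by apply/eqP; rewrite -subr_eq0; apply/eqP; exact: h.
Qed.

Lemma weak_partialP i v : H1 Omega v -> is_weak_partial Omega i v (weak_partial Omega i v).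
Proof. by move=> [_ /(_ i) ex]; exact: (xgetPex (cst 0) ex). Qed.

Lemma weak_partial_ae i v w : is_weak_partial Omega i v w ->
  {ae mu, forall x, Omega x -> weak_partial Omega i v x = w x}.
Proof.
move=> hw; apply: (is_weak_partial_unique _ hw).
exact: (xgetI (cst 0) (hw : [set w | is_weak_partial Omega i v w] w)).
Qed.

Lemma Cc_is_weak_partial i phi : Cc_infty Omega phi ->
  is_weak_partial Omega i phi (partial i phi).
Proof.
move=> hphi; split; first exact: Cc_partial_L2.
by move=> psi hpsi; exact: (Cc_parts oO bO i hphi hpsi).
Qed.

Lemma is_weak_partial_B i v1 v2 w1 w2 : L2 Omega v1 -> L2 Omega v2 ->
  is_weak_partial Omega i v1 w1 -> is_weak_partial Omega i v2 w2 ->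
  is_weak_partial Omega i (v1 \- v2) (w1 \- w2).
Proof.
move=> Lv1 Lv2 [Lw1 h1] [Lw2 h2]; split; first exact (L2_B oO Lw1 Lw2).
move=> phi hphi; have Lphi := Cc_L2 oO bO hphi; have Ldphi := Cc_partial_L2 i hphi.
rewrite (Rintegral_mulBl mO (L2_mul_integrable oO Lw1 Lphi) (L2_mul_integrable oO Lw2 Lphi)).
rewrite (Rintegral_mulBl mO (L2_mul_integrable oO Lv1 Ldphi) (L2_mul_integrable oO Lv2 Ldphi)).
by rewrite (h1 _ hphi) (h2 _ hphi) opprB opprK addrC.
Qed.

(* The geometric rate gives convergence almost everywhere without passing to a subsequence. *)
Lemma H10_seq u : H10 Omega u -> exists phi_ : nat -> 'rV[R]_n -> R, forall k,
  [/\ Cc_infty Omega (phi_ k),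
      (\int[mu]_(x in Omega) ((phi_ k x - u x) ^+ 2)%:E <= (2^-1 ^+ k)%:E)%E &
      forall i, (\int[mu]_(x in Omega)
        ((partial i (phi_ k) x - weak_partial Omega i u x) ^+ 2)%:E <= (2^-1 ^+ k)%:E)%E].
Proof.
move=> [Hu appr].
suff /choice[phi_ h] : forall k : nat, exists phi, [/\ Cc_infty Omega phi,
      (\int[mu]_(x in Omega) ((phi x - u x) ^+ 2)%:E <= (2^-1 ^+ k)%:E)%E &
      forall i, (\int[mu]_(x in Omega)
        ((partial i phi x - weak_partial Omega i u x) ^+ 2)%:E <= (2^-1 ^+ k)%:E)%E].
  by exists phi_.
move=> k.
(* [H1norm] carries a square root, and so must the tolerance. *)
have e0 : 0 < Num.sqrt (2^-1 ^+ k : R) by rewrite sqrtr_gt0 exprn_gt0.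
have [phi hphi lt] := appr _ e0; exists phi.
have [Lu _] := Hu; have Lphi := Cc_L2 oO bO hphi.
have wB i := is_weak_partial_B Lu Lphi (weak_partialP i Hu) (Cc_is_weak_partial i hphi).
have LB : L2 Omega (u \- phi) by exact (L2_B oO Lu Lphi).
have HB : H1 Omega (u \- phi) by split=> // i; eexists; exact: wB.
have wae i := weak_partial_ae (wB i).
have mw i : measurable_fun (Omega : set (Rn n)) (weak_partial Omega i (u \- phi)).
  by have [[]] := weak_partialP i HB.
pose G x := (u \- phi) x ^+ 2 + \sum_(i < n) weak_partial Omega i (u \- phi) x ^+ 2.
have mB : measurable_fun (Omega : set (Rn n)) (u \- phi) by have [] := LB.
have mG : measurable_fun (Omega : set (Rn n)) G.
  apply: measurable_funD; first exact: measurable_funX.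
  by apply: measurable_sum => i; exact: measurable_funX.
have G0 x : Omega x -> 0 <= G x.
  by move=> _; rewrite addr_ge0 ?sqr_ge0// sumr_ge0// => i _; exact: sqr_ge0.
have IG : (\int[mu]_(x in Omega) (G x)%:E <= (2^-1 ^+ k)%:E)%E.
  rewrite leNgt; apply/negP => /ltW ltI; move: lt; rewrite ltNge => /negP; apply.
  rewrite /H1norm -/G.
  have : ((2^-1 ^+ k)%:E `^ 2^-1 <= (\int[mu]_(x in Omega) (G x)%:E) `^ 2^-1)%E.
    apply: (le_poweR _ _ ltI); first by rewrite invr_ge0.
    by rewrite lee_fin exprn_ge0// invr_ge0.
  by rewrite poweR_EFin powR12_sqrt// exprn_ge0// invr_ge0.
have LE f : measurable_fun (Omega : set (Rn n)) f ->
  {ae mu, forall x, Omega x -> f x ^+ 2 <= G x} ->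
  (\int[mu]_(x in Omega) (f x ^+ 2)%:E <= (2^-1 ^+ k)%:E)%E.
  move=> mf fG; apply: le_trans IG.
  apply: (ae_le_integral_EFin mO (measurable_funX 2 mf) mG _ G0 fG).
  by move=> x _; exact: sqr_ge0.
split => // [|i].
- apply: (LE (fun x => phi x - u x)).
    by have [mu1 _] := Lu; have [mphi _] := Lphi; exact: measurable_funB.
  apply: aeW => x _; rewrite -sqrrN opprB /G/= lerDl sumr_ge0// => j _; exact: sqr_ge0.
- have [Lw _] := weak_partialP i Hu; have Ldp := Cc_partial_L2 i hphi.
  apply: (LE (fun x => partial i phi x - weak_partial Omega i u x)).
    by have [mw1 _] := Lw; have [mdp _] := Ldp; exact: measurable_funB.
  apply: filterS (wae i) => x h Ox; rewrite /G (bigD1 i)//= (h Ox) /=.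
  rewrite -sqrrN opprB addrCA lerDl addr_ge0 ?sqr_ge0// sumr_ge0// => j _; exact: sqr_ge0.
Qed.

Lemma H10_approx v (phi_ : nat -> 'rV[R]_n -> R) : H1 Omega v ->
  (forall k, Cc_infty Omega (phi_ k)) -> cvgL2 mu Omega phi_ v ->
  (forall i, cvgL2 mu Omega (fun k => partial i (phi_ k)) (weak_partial Omega i v)) ->
  H10 Omega v.
Proof.
move=> Hv Cphi /cvgL2P cv cdv; split=> // e e0.
(* The [n + 1] squared norms, each at most [d], add up to at most [(e/2)^2]; halving [e] yields the
   strict inequality. *)
pose d := e ^+ 2 / 4 / n.+1%:R.
have d0 : 0 < d by rewrite !divr_gt0// exprn_gt0.
have [Lv _] := Hv.
have : \forall k \near \oo, (\int[mu]_(x in Omega) ((phi_ k x - v x) ^+ 2)%:E <= d%:E)%E /\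
    forall i, (\int[mu]_(x in Omega)
      ((partial i (phi_ k) x - weak_partial Omega i v x) ^+ 2)%:E <= d%:E)%E.
  apply: filterI; first exact: cv.
  apply: (@filter_forall _ _ (fun i k => \int[mu]_(x in Omega)
      ((partial i (phi_ k) x - weak_partial Omega i v x) ^+ 2)%:E <= d%:E)%E
      _ eventually_filter) => i.
  by have /cvgL2P := cdv i; apply.
case=> N _ /(_ N (leqnn N)) [vd dvd]; exists (phi_ N) => //.
have Lphi := Cc_L2 oO bO (Cphi N).
have wB i := is_weak_partial_B Lv Lphi (weak_partialP i Hv) (Cc_is_weak_partial i (Cphi N)).
have HB : H1 Omega (v \- phi_ N).
  by split=> [|i]; [exact: (L2_B oO Lv Lphi)|eexists; exact: wB].
have mw i : measurable_fun (Omega : set (Rn n)) (weak_partial Omega i (v \- phi_ N)).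
  by have [[]] := weak_partialP i HB.
have mB : measurable_fun (Omega : set (Rn n)) (v \- phi_ N) by have [[]] := HB.
have Iv : (\int[mu]_(x in Omega) ((v \- phi_ N) x ^+ 2)%:E <= d%:E)%E.
  apply: le_trans vd; rewrite (_ : integral _ _ _ = integral mu Omega
    (fun x => ((phi_ N x - v x) ^+ 2)%:E))//.
  by apply: eq_integral => x _; rewrite -sqrrN opprB.
have Idv i : (\int[mu]_(x in Omega) (weak_partial Omega i (v \- phi_ N) x ^+ 2)%:E <= d%:E)%E.
  apply: le_trans (dvd i).
  have [[mwi _] _] := weak_partialP i Hv.
  have [mdi _] := Cc_partial_L2 i (Cphi N).
  apply: (ae_le_integral_EFin mO (measurable_funX 2 (mw i))
    (measurable_funX 2 (measurable_funB mdi mwi))) => [x _|x _|]; rewrite ?sqr_ge0//.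
  by apply: filterS (weak_partial_ae (wB i)) => x h Ox; rewrite (h Ox) /= -sqrrN opprB.
have I := ge0_integral_sum_le mO (measurable_funX 2 mB) (fun i => measurable_funX 2 (mw i))
  (fun x => sqr_ge0 _) (fun i x => sqr_ge0 _) Iv Idv.
have dE : n.+1%:R * d = (e / 2) ^+ 2 by rewrite /d; field; rewrite addrC natr1 pnatr_eq0.
rewrite dE in I.
have e20 : 0 <= e / 2 by rewrite divr_ge0// ltW.
have le : (H1norm Omega (v \- phi_ N)%R <= ((e / 2) ^+ 2)%:E `^ 2^-1)%E.
  apply: le_poweR I; first by rewrite invr_ge0.
  by apply: integral_ge0 => x _; rewrite lee_fin addr_ge0 ?sqr_ge0// sumr_ge0// => i _; exact: sqr_ge0.
apply: (le_lt_trans le); rewrite poweR_EFin powR12_sqrt ?sqr_ge0// sqrtr_sqr ger0_norm// lte_fin.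
by rewrite ltr_pdivrMr// mulr_natr mulr2n ltrDl.
Qed.

End weak_partial.

(** * Composition with smooth Lipschitz functions *)

Section chain.
Context {R : realType} {n : nat} (Omega : set 'rV[R]_n).
Hypotheses (oO : open Omega) (bO : bounded_set Omega).
Variables (f f1 : R -> R) (L : R).
Implicit Types phi psi u v w : 'rV[R]_n -> R.
Local Notation mu := (@leb R n).

(** The last clause states directly the consequence of smoothness that makes [f \o phi] a test
    function, so that no higher-order chain rule is involved. The bound [L] makes [f] Lipschitz,
    which carries [L^2] and the Gagliardo seminorm through the composition. *)
Definition chainable : Prop :=
  [/\ f 0 = 0, forall t, is_derive t (1 : R) f (f1 t), continuous f1,
      (forall t, `|f1 t| <= L) & forall phi, smooth phi -> smooth (f \o phi)].

Hypothesis cf : chainable.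

Let mO : measurable (Omega : set (Rn n)).
Proof. exact: bounded_open_measurable. Qed.

Let f0 : f 0 = 0. Proof. by have [] := cf. Qed.
Let df t : is_derive t (1 : R) f (f1 t). Proof. by have [_ /(_ t)] := cf. Qed.
Let cf1 : continuous f1. Proof. by have [] := cf. Qed.
Let f1L t : `|f1 t| <= L. Proof. by have [_ _ _ /(_ t)] := cf. Qed.

Lemma chain_continuous : continuous f.
Proof. by move=> t; exact: is_derive_continuous. Qed.

Lemma chain_lip a b : `|f a - f b| <= L * `|a - b|.
Proof.
wlog ba : a b / b <= a => [H|].
  by have [/H//|/ltW/H] := leP b a; rewrite distrC [`|b - a|]distrC.
have [c _ ->] := MVT_segment ba (fun t _ => df t)
  (continuous_subspaceT (A := `[b, a]) chain_continuous).
by rewrite normrM ler_wpM2r.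
Qed.

Lemma chain_measurable d (T : measurableType d) (A : set T) (v : T -> R) :
  measurable_fun A v -> measurable_fun A (f \o v) /\ measurable_fun A (f1 \o v).
Proof.
move=> mv; split; apply: measurableT_comp mv; apply: continuous_measurable_fun => //.
exact: chain_continuous.
Qed.

Lemma chain_Cc phi : Cc_infty Omega phi -> Cc_infty Omega (f \o phi).
Proof.
move=> hphi; have [sphi _ _] := hphi; have [_ _ _ _ /(_ _ sphi) sf] := cf.
by apply: (Cc_infty_sub0 hphi sf) => x /= ->.
Qed.

Lemma chain_partial i phi x : smooth phi ->
  partial i (f \o phi) x = f1 (phi x) * partial i phi x.
Proof.
move=> sphi; apply: partialE; apply: is_derive_comp (df _).
exact: (@is_derive_partial _ _ phi x i (@smooth_derivable _ _ phi i x sphi)).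
Qed.

Lemma chain_L2 v : L2 Omega v -> L2 Omega (f \o v).
Proof.
move=> Lv; have [mv _] := Lv; have [mfv _] := chain_measurable mv.
apply: (sqint_comb_le mO Lv Lv (sqr_ge0 L) (lexx 0) mfv) => x Ox.
rewrite mul0r addr0 -exprMn -[X in X <= _]real_normK ?num_real//.
rewrite -[X in _ <= X]real_normK ?num_real//; apply: lerXn2r; rewrite ?nnegrE//=.
have := chain_lip (v x) 0; rewrite f0 !subr0 normrM => /le_trans; apply.
by rewrite ler_wpM2r// ler_norm.
Qed.

Lemma chain_mul_L2 v w : L2 Omega v -> L2 Omega w -> L2 Omega (fun x => f1 (v x) * w x).
Proof.
move=> [mv _] Lw; have [_ mfv] := chain_measurable mv.
exact: (L2_bounded_mul oO Lw mfv (fun x _ => f1L (v x))).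
Qed.

Variable u : 'rV[R]_n -> R.
Hypothesis Hu : H10 Omega u.
Variable phi_ : nat -> 'rV[R]_n -> R.
Hypothesis Cphi : forall k, Cc_infty Omega (phi_ k).
Hypothesis uphi : forall k,
  (\int[mu]_(x in Omega) ((phi_ k x - u x) ^+ 2)%:E <= (2^-1 ^+ k)%:E)%E.
Hypothesis duphi : forall k i, (\int[mu]_(x in Omega)
  ((partial i (phi_ k) x - weak_partial Omega i u x) ^+ 2)%:E <= (2^-1 ^+ k)%:E)%E.

Let Lu : L2 Omega u. Proof. by have [[]] := Hu. Qed.
Let Ldu i : L2 Omega (weak_partial Omega i u).
Proof. by have [H _] := Hu; have [] := weak_partialP i H. Qed.
Let Lphi k : L2 Omega (phi_ k). Proof. exact: (Cc_L2 oO bO (Cphi k)). Qed.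
Let Ldphi i k : L2 Omega (partial i (phi_ k)).
Proof. exact: (Cc_partial_L2 oO bO i (Cphi k)). Qed.

Lemma seq_ae : {ae mu, forall x, Omega x -> phi_ k x @[k --> \oo] --> u x}.
Proof. exact: (cvgL2_ae mO Lphi Lu uphi). Qed.

Let chain_dphi i : cvgL2 mu Omega (fun k x => f1 (phi_ k x) * partial i (phi_ k) x)
  (fun x => f1 (u x) * weak_partial Omega i u x).
Proof.
have mf1 v : L2 Omega v -> measurable_fun (Omega : set (Rn n)) (f1 \o v).
  by move=> [mv _]; have [] := chain_measurable mv.
apply: (@cvgL2_bounded_mul _ _ R mu Omega mO (leb_bounded oO bO) (fun k => f1 \o phi_ k)
  (f1 \o u) (fun k => partial i (phi_ k)) (weak_partial Omega i u) L
  (fun k => mf1 _ (Lphi k)) (mf1 _ Lu) (fun k x _ => f1L _) (fun x _ => f1L _)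
  _ (Ldphi i) (Ldu i)).
- apply: filterS seq_ae => x cx Ox; apply: continuous_cvg; first exact: cf1.
  exact: cx.
- exact: (cvgL2_geo (duphi ^~ i)).
Qed.

Let chain_phi : cvgL2 mu Omega (fun k => f \o phi_ k) (f \o u).
Proof.
have Lfu := chain_L2 Lu.
have sB k : L2 Omega (phi_ k \- u) by exact: (L2_B oO (Lphi k) Lu).
have mB k : measurable_fun (Omega : set (Rn n)) ((f \o phi_ k) \- (f \o u)).
  by have [] := L2_B oO (chain_L2 (Lphi k)) Lfu.
apply: (cvgL2_comb mO (sqr_ge0 L) (lexx 0) sB sB mB (cvgL2_geo uphi) (cvgL2_geo uphi)).
move=> k x Ox; rewrite mul0r addr0 -exprMn -[X in X <= _]real_normK ?num_real//.
rewrite -[X in _ <= X]real_normK ?num_real//; apply: lerXn2r; rewrite ?nnegrE//=.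
apply: le_trans (chain_lip _ _) _; rewrite normrM.
by rewrite ler_wpM2r// ler_norm.
Qed.

(** Integration by parts holds for the test functions [f \o phi_ k]. Both sides pass to the limit,
    because [L^2] convergence implies convergence of the integrals against a fixed square-integrable
    function. *)
Lemma chain_is_weak_partial_seq i :
  is_weak_partial Omega i (f \o u) (fun x => f1 (u x) * weak_partial Omega i u x).
Proof.
split; first exact: (chain_mul_L2 Lu (Ldu i)).
move=> psi hpsi.
have c1 := cvgL2_Rintegral mO (fun k => chain_L2 (Lphi k)) (chain_L2 Lu)
  (Cc_partial_L2 oO bO i hpsi) chain_phi.
have c2 := cvgL2_Rintegral mO (fun k => chain_mul_L2 (Lphi k) (Ldphi i k))
  (chain_mul_L2 Lu (Ldu i)) (Cc_L2 oO bO hpsi) (chain_dphi i).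
apply: (cvg_unique _ c1) => //.
rewrite /= (_ : (fun k => _) = (fun k => - \int[mu]_(x in Omega)
    (f1 (phi_ k x) * partial i (phi_ k) x * psi x))); first exact: cvgN c2.
apply/funext => k; rewrite (Cc_parts oO bO i (chain_Cc (Cphi k)) hpsi); congr (- _).
by apply: eq_Rintegral => x _; have [sphi _ _] := Cphi k; rewrite (chain_partial i x sphi).
Qed.

Lemma chain_H10_seq : H10 Omega (f \o u).
Proof.
have wf i := chain_is_weak_partial_seq i.
have H1f : H1 Omega (f \o u) by split=> [|i]; [exact: chain_L2|eexists; exact: wf].
apply: (H10_approx oO bO H1f (fun k => chain_Cc (Cphi k)) chain_phi) => i.
have [[mw _] _] := weak_partialP i H1f; have [[mw' _] _] := wf i.
have pE : (fun k => partial i (f \o phi_ k)) = (fun k x => f1 (phi_ k x) * partial i (phi_ k) x).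
  by apply/funext => k; apply/funext => x; have [sphi _ _] := Cphi k; rewrite (chain_partial i x sphi).
have mp k : measurable_fun (Omega : set (Rn n)) (fun x => f1 (phi_ k x) * partial i (phi_ k) x).
  by have [] := chain_mul_L2 (Lphi k) (Ldphi i k).
rewrite pE; apply: (cvgL2_ae_eq mO mp mw' mw _ (chain_dphi i)).
by apply: filterS (weak_partial_ae oO bO (wf i)) => x h Ox; rewrite h.
Qed.

End chain.

Section chain_H10.
Context {R : realType} {n : nat} (Omega : set 'rV[R]_n).
Hypotheses (oO : open Omega) (bO : bounded_set Omega).
Variables (f f1 : R -> R) (L : R) (u : 'rV[R]_n -> R).
Hypotheses (cf : chainable (n := n) f f1 L) (Hu : H10 Omega u).

Lemma chain_is_weak_partial i :
  is_weak_partial Omega i (f \o u) (fun x => f1 (u x) * weak_partial Omega i u x).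
Proof.
have [phi_ /all_and3[h1 h2 h3]] := H10_seq oO bO Hu.
exact: (chain_is_weak_partial_seq oO bO cf Hu h1 h2 h3).
Qed.

Lemma chain_H10 : H10 Omega (f \o u).
Proof.
have [phi_ /all_and3[h1 h2 h3]] := H10_seq oO bO Hu.
exact: (chain_H10_seq oO bO cf Hu h1 h2 h3).
Qed.

End chain_H10.

(** * Stability of the Gagliardo seminorm and of the energy space under composition *)

Section lipschitz_quotient.
Context d (T : measurableType d) {R : realType} (mu : {measure set T -> \bar R}).

(** In use, [U] and [V] are the increments [u(x) - u(y)] and [v(x) - v(y)], and [k] is the kernel
    [|x - y|^(n+2s)]. *)
Lemma lipschitz_quotient_lty (U V k : T -> R) (L : R) :
  measurable_fun setT U -> measurable_fun setT V -> measurable_fun setT k ->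
  (forall z, 0 <= k z) -> (forall z, `|V z| <= L * `|U z|) ->
  (\int[mu]_z (U z ^+ 2 / k z)%:E < +oo -> \int[mu]_z (V z ^+ 2 / k z)%:E < +oo)%E.
Proof.
move=> mU mV mk k0 VU.
have mk' : measurable_fun setT (fun z => (k z)^-1).
  rewrite (_ : (fun _ => _) = fun z => k z `^ (-1)); first exact: measurable_fun_powr.
  by apply/funext => z; rewrite powRN powRr1.
have kV z : 0 <= (k z)^-1 by rewrite invr_ge0.
have mq (W : T -> R) : measurable_fun setT W -> measurable_fun setT (fun z => W z ^+ 2 / k z).
  by move=> mW; apply: measurable_funM => //; exact: measurable_funX.
move=> Ioo; apply: (@le_lt_trans _ _ (\int[mu]_z ((L ^+ 2)%:E * (U z ^+ 2 / k z)%:E))%E).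
  apply: ge0_le_integral => //.
  - by move=> z _; rewrite lee_fin mulr_ge0 ?sqr_ge0.
  - by apply/measurable_EFinP; exact: mq.
  - apply/measurable_EFinP; apply: measurable_funM => //; exact: mq.
  - move=> z _; rewrite -EFinM lee_fin mulrA; apply: ler_wpM2r => //.
    rewrite -exprMn -[X in X <= _]real_normK ?num_real//.
    rewrite -[X in _ <= X]real_normK ?num_real//; apply: lerXn2r; rewrite ?nnegrE//.
    by apply: le_trans (VU z) _; rewrite normrM ler_wpM2r// ler_norm.
rewrite ge0_integralZl//; last 3 first.
- by apply/measurable_EFinP; exact: mq.
- by move=> z _; rewrite lee_fin mulr_ge0 ?sqr_ge0.
- by rewrite lee_fin sqr_ge0.
by rewrite lte_mul_pinfty// lee_fin sqr_ge0.
Qed.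

End lipschitz_quotient.

Section gagliardo.
Context {R : realType} {n : nat}.
Implicit Types u v : 'rV[R]_n -> R.

Lemma measurable_enorm_pow (a : R) :
  measurable_fun setT (fun z : Rn n * Rn n => enorm (z.1 - z.2 : 'rV[R]_n) `^ a).
Proof.
apply: measurable_fun_powr.
have mc i : measurable_fun (setT : set (Rn n)) (fun x : 'rV[R]_n => x ord0 i : R).
  apply: (@borel_measurable_fun R n _ _ setT); first exact: measurableT.
  exact: measurable_coord.
have msqrt : measurable_fun setT (Num.sqrt : R -> R).
  by apply: continuous_measurable_fun; exact: sqrt_continuous.
have mG : measurable_fun setT (fun z : Rn n * Rn n =>
    \sum_i ((z.1 : 'rV[R]_n) ord0 i - (z.2 : 'rV[R]_n) ord0 i) ^+ 2).
  apply: measurable_sum => i; apply: measurable_funX.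
  by apply: measurable_funB; apply: (measurableT_comp (mc i)).
rewrite (_ : (fun _ => _) = (Num.sqrt : R -> R) \o (fun z : Rn n * Rn n =>
    \sum_i ((z.1 : 'rV[R]_n) ord0 i - (z.2 : 'rV[R]_n) ord0 i) ^+ 2)); last first.
  by apply/funext => z; rewrite /enorm/=; congr Num.sqrt; apply: eq_bigr => i _; rewrite !mxE.
exact (measurableT_comp msqrt mG).
Qed.

Lemma gagliardo_lip (s L : R) u v :
  measurable_fun (setT : set (Rn n)) u -> measurable_fun (setT : set (Rn n)) v ->
  (forall x y, `|v x - v y| <= L * `|u x - u y|) ->
  (gagliardo s u < +oo -> gagliardo s v < +oo)%E.
Proof.
move=> mu_ mv uv; rewrite /gagliardo => Iu; apply: poweR_lty.
have md (w : 'rV[R]_n -> R) : measurable_fun (setT : set (Rn n)) w ->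
    measurable_fun setT (fun z : Rn n * Rn n => w z.1 - w z.2).
  by move=> mw; apply: measurable_funB; apply: (measurableT_comp mw).
apply: (@lipschitz_quotient_lty _ _ R _ (fun z : Rn n * Rn n => u z.1 - u z.2)
  (fun z => v z.1 - v z.2) _ L (md u mu_) (md v mv) (measurable_enorm_pow _)
  (fun z => powR_ge0 _ _) (fun z => uv z.1 z.2)).
rewrite ltNge leye_eq; apply/negP => /eqP Ioo.
by move: Iu; rewrite Ioo poweRyr.
Qed.

Lemma chain_X01 Omega (s L : R) f f1 u : open Omega -> bounded_set Omega ->
  chainable (n := n) f f1 L -> X01 s Omega u -> X01 s Omega (f \o u).
Proof.
move=> oO bO cf [mu_ Hu gu u0].
have [mfu _] := chain_measurable cf mu_.
split; [exact: mfu|exact: (chain_H10 oO bO cf Hu)| |].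
- by apply: (gagliardo_lip mu_ mfu _ gu) => x y; exact: (chain_lip cf).
- have [f0 _ _ _ _] := cf.
  by apply: filterS u0 => x h Ox /=; rewrite (h Ox) f0.
Qed.

End gagliardo.

(** * The Sobolev inequality in [H^1_0] *)

Lemma cvg_norm_powR (R : realType) (x_ : nat -> R) (x p : R) : 0 < p ->
  x_ k @[k --> \oo] --> x -> `|x_ k| `^ p @[k --> \oo] --> `|x| `^ p.
Proof.
move=> p0 cx; have cn : `|x_ k| @[k --> \oo] --> `|x| by exact: cvg_norm.
have [x0|x0] := eqVneq x 0; last first.
  have c : {for `|x|, continuous (fun t : R => t `^ p)}.
    by apply: is_derive_continuous (is_derive1_powR p _); rewrite normr_gt0.
  exact: (cvg_comp _ _ cn c).
rewrite x0 normr0 powR0 ?gt_eqF//.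
apply/cvgrPdist_lt => e e0.
move: cn; rewrite x0 normr0 => /cvgrPdist_lt/(_ _ (powR_gt0 p^-1 e0)).
apply: filterS => k; rewrite !sub0r !normrN normr_id [X in _ -> X < _]ger0_norm ?powR_ge0// => h.
rewrite -[ltRHS](powRr1 (ltW e0)) -(mulVf (lt0r_neq0 p0)) powRrM.
by apply: gt0_ltr_powR => //; rewrite nnegrE ?powR_ge0.
Qed.

Section sum_squares.
Context d (T : measurableType d) {R : realType} (mu : {measure set T -> \bar R}) (A : set T).
Hypotheses (mA : measurable A).

Lemma integral_sum_sqr_le m (g w : 'I_m -> T -> R) (D e : R) :
  (forall i, measurable_fun A (g i)) -> (forall i, measurable_fun A (w i)) -> 0 <= e ->
  (\int[mu]_(x in A) (\sum_(i < m) w i x ^+ 2)%:E <= D%:E)%E ->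
  (forall i, \int[mu]_(x in A) ((g i x - w i x) ^+ 2)%:E <= e%:E)%E ->
  (\int[mu]_(x in A) (\sum_(i < m) g i x ^+ 2)%:E <= (2 * D + 2 * (m.+1%:R * e))%:E)%E.
Proof.
move=> mg mw e0 wD gw.
have sum0 (v : 'I_m -> T -> R) x : 0 <= \sum_(i < m) v i x ^+ 2.
  by apply: sumr_ge0 => i _; exact: sqr_ge0.
have msum (v : 'I_m -> T -> R) : (forall i, measurable_fun A (v i)) ->
    measurable_fun A (fun x => \sum_(i < m) v i x ^+ 2).
  by move=> mv; apply: measurable_sum => i; exact: measurable_funX.
have mgw i : measurable_fun A (fun x => g i x - w i x) by exact: measurable_funB.
apply: (@le_trans _ _ (\int[mu]_(x in A)
    (2 * \sum_(i < m) w i x ^+ 2 + 2 * \sum_(i < m) (g i x - w i x) ^+ 2)%:E)%E).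
  apply: (ae_le_integral_EFin mA (msum _ mg)).
  - by apply: measurable_funD; apply: measurable_funM => //; exact: msum.
  - by move=> x _; exact: sum0.
  - by move=> x _; rewrite addr_ge0// mulr_ge0// (sum0, sum0 (fun i x => g i x - w i x)).
  - apply: aeW => x _; rewrite !mulr_sumr -big_split/=; apply: ler_sum => i _.
    (* This square is exactly the difference [2 w^2 + 2 (g - w)^2 - g^2]. *)
    have := sqr_ge0 (2 * w i x - g i x); rewrite !expr2; clear; lra.
rewrite ge0_integral_lin2//; last 3 first.
- exact: msum.
- exact: (msum (fun i x => g i x - w i x)).
- by move=> x _; exact: (sum0 (fun i x => g i x - w i x)).
rewrite (EFinD (2 * D)) (EFinM 2 D) (EFinM 2 (_ * e)); apply: leeD; apply: lee_wpmul2l => //.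
have := @ge0_integral_sum_le _ _ R mu A mA m (cst 0) (fun i x => (g i x - w i x) ^+ 2) e
  (measurable_cst (0 : R)) (fun i => measurable_funX 2 (mgw i)) (fun x => lexx 0)
  (fun i x => sqr_ge0 _) _ gw.
rewrite integral0 lee_fin => /(_ e0).
by under eq_integral do rewrite add0r.
Qed.

End sum_squares.

Section H10_sobolev.
Context {R : realType} {n : nat} (Omega : set 'rV[R]_n).
Hypotheses (oO : open Omega) (bO : bounded_set Omega).
Variables (p C : R).
Hypothesis p0 : 0 < p.
Hypothesis sob : forall phi D, Cc_infty Omega phi -> 0 <= D ->
  (\int[leb n]_(x in Omega) (\sum_i partial i phi x ^+2)%:E <= D%:E)%E ->
  (\int[leb n]_(x in Omega) (`|phi x| `^ p)%:E <= ((C * D) `^ (p / 2))%:E)%E.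
Local Notation mu := (@leb R n).

Let mO : measurable (Omega : set (Rn n)).
Proof. exact: bounded_open_measurable. Qed.

(** The gradients of the approximating test functions have squared norm at most [2 D] plus an error,
    by [|a|^2 <= 2 |b|^2 + 2 |a - b|^2]. Shifting the sequence by [N] brings the error below [D];
    hence the factor 3 and the requirement [0 < D]. *)
Lemma H10_sobolev v D : H10 Omega v -> 0 < D ->
  (\int[mu]_(x in Omega) (\sum_(i < n) weak_partial Omega i v x ^+ 2)%:E <= D%:E)%E ->
  (\int[mu]_(x in Omega) (`|v x| `^ p)%:E <= ((C * (3 * D)) `^ (p / 2))%:E)%E.
Proof.
move=> Hv D0 vD.
have [phi_ /all_and3[Cphi h2 h3]] := H10_seq oO bO Hv.
have [Hv1 _] := Hv; have [Lv _] := Hv1; have [mv _] := Lv.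
have mp k := Cc_measurable oO (Cphi k).
have mdp i k : measurable_fun (Omega : set (Rn n)) (partial i (phi_ k)).
  by have [] := Cc_partial_L2 oO bO i (Cphi k).
have mw i : measurable_fun (Omega : set (Rn n)) (weak_partial Omega i v).
  by have [[]] := weak_partialP i Hv1.
have [N hN] : exists N, forall k, 2 * (n.+1%:R * 2^-1 ^+ (k + N)) <= D.
  have /cvgrPdist_le/(_ (D / (2 * n.+1%:R))) : (2^-1 : R) ^+ k @[k --> \oo] --> (0 : R).
    by apply: cvg_expr; rewrite ger0_norm// invf_lt1// ltr1n.
  case; first by rewrite divr_gt0.
  move=> N _ hN; exists N => k; have := hN (k + N)%N (leq_addl _ _).
  rewrite /= sub0r normrN ger0_norm ?exprn_ge0// ler_pdivlMr ?mulr_gt0//.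
  by rewrite mulrA mulrC.
pose f_ k x := `|phi_ (k + N)%N x| `^ p.
apply: (@fatou_le _ _ R mu Omega mO f_ (fun x => `|v x| `^ p)).
- by move=> k; apply: measurable_fun_powr; apply: measurableT_comp => //; exact: mp.
- by apply: measurable_fun_powr; apply: measurableT_comp => //; exact: mv.
- by move=> k x _; exact: powR_ge0.
- by move=> x _; exact: powR_ge0.
- apply: filterS (seq_ae oO bO Hv Cphi h2) => x cx Ox.
  apply: cvg_norm_powR => //; rewrite (@cvg_shiftn N _ (phi_ ^~ x)); exact: cx.
- move=> k.
  have e0 : 0 <= (2^-1 : R) ^+ (k + N) by rewrite exprn_ge0// invr_ge0.
  have D30 : 0 <= 3 * D by rewrite mulr_ge0// ltW.
  apply: (sob (Cphi _) D30).
  apply: le_trans (integral_sum_sqr_le mO (fun i => mdp i _) mw e0 vD (h3 _)) _.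
  rewrite lee_fin (_ : 3 * D = 2 * D + D); last by ring.
  by apply: lerD; last exact: hN.
Qed.

Lemma chain_sobolev (h h1 : R -> R) (L D : R) u : chainable (n := n) h h1 L ->
  H10 Omega u -> 0 < D ->
  (\int[mu]_(x in Omega) (\sum_(i < n) (h1 (u x) * weak_partial Omega i u x) ^+ 2)%:E <= D%:E)%E ->
  (\int[mu]_(x in Omega) (`|h (u x)| `^ p)%:E <= ((C * (3 * D)) `^ (p / 2))%:E)%E.
Proof.
move=> ch Hu D0 uD; have Hv := chain_H10 oO bO ch Hu.
have [Hv1 _] := Hv.
apply: (H10_sobolev Hv D0); apply: le_trans uD.
have mw i : measurable_fun (Omega : set (Rn n)) (weak_partial Omega i (h \o u)).
  by have [[]] := weak_partialP i Hv1.
have hw i := chain_is_weak_partial oO bO ch Hu i.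
have mw' i : measurable_fun (Omega : set (Rn n)) (fun x => h1 (u x) * weak_partial Omega i u x).
  by have [[]] := hw i.
have msum (v : 'I_n -> 'rV[R]_n -> R) :
    (forall i, measurable_fun (Omega : set (Rn n)) (v i)) ->
    measurable_fun (Omega : set (Rn n)) (fun x => \sum_(i < n) v i x ^+ 2).
  by move=> mv; apply: measurable_sum => i; exact: measurable_funX.
have sum0 (v : 'I_n -> 'rV[R]_n -> R) x : Omega x -> 0 <= \sum_(i < n) v i x ^+ 2.
  by move=> _; apply: sumr_ge0 => i _; exact: sqr_ge0.
apply: (ae_le_integral_EFin mO (msum _ mw) (msum _ mw') (sum0 _) (sum0 _)).
have := @filter_forall _ _ (fun i x => Omega x -> weak_partial Omega i (h \o u) x =
  h1 (u x) * weak_partial Omega i u x) _ (leb_ae_filter R n)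
  (fun i => weak_partial_ae oO bO (hw i)).
apply: filterS => x hx Ox; apply: ler_sum => i _.
by rewrite (hx i Ox).
Qed.

End H10_sobolev.

(** * The energy inequality *)

Section Rintegral_compare.
Context d (T : measurableType d) {R : realType} (mu : {measure set T -> \bar R}) (A : set T).
Hypotheses (mA : measurable A).

(** The weak formulation relates real-valued integrals, whose value is 0 by default when the
    extended integral is infinite; integrability of [S'] and [G] lets the inequality return to
    extended reals. In use, [S] is built from chosen weak partial derivatives and agrees with its
    chain-rule form [S'] only almost everywhere. *)
Lemma Rintegral_ae_le (S S' G H : T -> R) : measurable_fun A S ->
  mu.-integrable A (EFin \o S') -> {ae mu, forall x, A x -> S x = S' x} ->
  mu.-integrable A (EFin \o G) -> measurable_fun A H -> (forall x, A x -> 0 <= H x) ->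
  {ae mu, forall x, A x -> `|G x| <= H x} ->
  \int[mu]_(x in A) S x <= \int[mu]_(x in A) G x ->
  (\int[mu]_(x in A) (S' x)%:E <= \int[mu]_(x in A) (H x)%:E)%E.
Proof.
move=> mS iS' SS' iG mH H0 GH le.
have mS' : measurable_fun A (EFin \o S') by have /integrableP[] := iS'.
have mG : measurable_fun A (EFin \o G) by have /integrableP[] := iG.
have E : (\int[mu]_(x in A) (S' x)%:E = \int[mu]_(x in A) (S x)%:E)%E.
  apply: ae_eq_integral => //; first exact/measurable_EFinP.
  by apply: filterS SS' => x h Ax; rewrite h.
have finS : (\int[mu]_(x in A) (S x)%:E)%E \is a fin_num by rewrite -E; exact: integrable_fin_num.
have finG : (\int[mu]_(x in A) (G x)%:E)%E \is a fin_num by exact: integrable_fin_num.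
rewrite E; apply: (@le_trans _ _ (\int[mu]_(x in A) (G x)%:E)%E).
  by rewrite -(fineK finS) -(fineK finG) lee_fin.
apply: (@le_trans _ _ (\int[mu]_(x in A) (`|G x|)%:E)%E).
  apply: le_trans (lee_abs _) _.
  exact: (le_abse_integral mu mA mG).
apply: (ae_le_integral_EFin mA) => //.
by apply: measurableT_comp => //; exact/measurable_EFinP.
Qed.

End Rintegral_compare.

Section energy.
Context {R : realType} {n : nat} (Omega : set 'rV[R]_n).
Hypotheses (oO : open Omega) (bO : bounded_set Omega).
Local Notation mu := (@leb R n).

Let mO : measurable (Omega : set (Rn n)).
Proof. exact: bounded_open_measurable. Qed.

Lemma chain_nondecreasing (f f1 : R -> R) (L : R) : chainable (n := n) f f1 L ->
  (forall t, 0 <= f1 t) -> {homo f : x y / x <= y}.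
Proof.
move=> cf f10 a b ab; have [_ df _ _ _] := cf.
have [c _ E] := MVT_segment ab (fun t _ => df t)
  (continuous_subspaceT (A := `[a, b]) (chain_continuous cf)).
by rewrite -subr_ge0 E mulr_ge0// subr_ge0.
Qed.

(* [F \o u] is used as a test function; the fractional term is nonnegative because [F] is
   nondecreasing, and is dropped. *)
Lemma energy (s c q L : R) (g : 'rV[R]_n -> R -> R) (u : 'rV[R]_n -> R) (F F1 : R -> R) :
  0 < c -> growth Omega c q g -> weak_solution s Omega g u ->
  chainable (n := n) F F1 L -> (forall t, 0 <= F1 t) ->
  (\int[mu]_(x in Omega) (\sum_(i < n) F1 (u x) * weak_partial Omega i u x ^+ 2)%:E <=
   \int[mu]_(x in Omega) (c * (1 + `|u x| `^ (q - 1)) * `|F (u x)|)%:E)%E.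
Proof.
move=> c0 gg [Xu weak] cF F10.
have Xphi := chain_X01 oO bO cF Xu.
have [_ Hu _ _] := Xu; have [Hu1 _] := Hu; have [[mu_ _] _] := Hu1.
have [igphi eq] := weak _ Xphi.
have FM := chain_nondecreasing cF F10.
have [_ mF1] := chain_measurable cF mu_; have [mF _] := chain_measurable cF mu_.
have wF i := chain_is_weak_partial oO bO cF Hu i.
have Lw i : L2 Omega (weak_partial Omega i u) by have [] := weak_partialP i Hu1.
have Lw' i : L2 Omega (fun x => F1 (u x) * weak_partial Omega i u x) by have [] := wF i.
have mwF i : measurable_fun (Omega : set (Rn n)) (weak_partial Omega i (F \o u)).
  have [HF _] := chain_H10 oO bO cF Hu.
  by have [[]] := weak_partialP i HF.
have mw i : measurable_fun (Omega : set (Rn n)) (weak_partial Omega i u) by have [] := Lw i.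
pose S x := \sum_(i < n) weak_partial Omega i u x * weak_partial Omega i (F \o u) x.
pose S' x := \sum_(i < n) F1 (u x) * weak_partial Omega i u x ^+ 2.
have mS : measurable_fun (Omega : set (Rn n)) S.
  by apply: measurable_sum => i; apply: measurable_funM.
have iS' : mu.-integrable Omega (EFin \o S').
  have := @integrable_sum _ _ R mu Omega mO _ (index_enum 'I_n) xpredT
    (fun i x => (F1 (u x) * weak_partial Omega i u x * weak_partial Omega i u x)%:E)
    (fun i _ => L2_mul_integrable oO (Lw' i) (Lw i)).
  apply: eq_integrable; first exact: mO.
  move=> x _; rewrite /S' /= sumEFin; congr EFin; apply: eq_bigr => i _.
  by rewrite mulrA.
have SS' : {ae mu, forall x, Omega x -> S x = S' x}.
  have := @filter_forall _ _ (fun i x => Omega x -> weak_partial Omega i (F \o u) x =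
    F1 (u x) * weak_partial Omega i u x) _ (leb_ae_filter R n)
    (fun i => weak_partial_ae oO bO (wF i)).
  apply: filterS => x h Ox; apply: eq_bigr => i _.
  by rewrite (h i Ox) mulrCA.
have mH : measurable_fun (Omega : set (Rn n)) (fun x => c * (1 + `|u x| `^ (q - 1)) * `|F (u x)|).
  apply: measurable_funM; last by apply: measurableT_comp mF => //.
  apply: measurable_funM; first exact: measurable_cst.
  apply: measurable_funD; first exact: measurable_cst.
  by apply: measurable_fun_powr; apply: measurableT_comp mu_ => //.
have H0 x : Omega x -> 0 <= c * (1 + `|u x| `^ (q - 1)) * `|F (u x)|.
  by move=> _; rewrite mulr_ge0// mulr_ge0 ?(ltW c0)// addr_ge0// powR_ge0.
apply: (Rintegral_ae_le mO mS iS' SS' igphi mH H0).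
- apply: filterS gg => x h Ox; rewrite normrM; apply: ler_wpM2r => //.
  exact: h.
- rewrite -eq lerDl; apply: Rintegral_ge0 => z _.
  apply: mulr_ge0; last by rewrite invr_ge0 powR_ge0.
  have [le|/ltW le] := leP (u z.1) (u z.2).
  + by apply: mulr_le0; rewrite subr_le0//; exact: FM.
  + by apply: mulr_ge0; rewrite subr_ge0//; exact: FM.
Qed.

End energy.

(** * Truncated powers *)

Section truncated_power.
Context {R : realType} (e d r : R).
Hypotheses (e0 : 0 < e) (d0 : 0 < d) (r0 : 0 <= r).
Implicit Types t : R.

(* [tpow] is [t * zed t ^ r], a smooth replacement for [t * min (t ^ 2, 1 / d) ^ r]. *)
Definition zed t : R := (e + t ^+ 2) / (1 + d * e + d * t ^+ 2).
Definition tpow t : R := t * ((e + 1 * t ^+ 2) `^ r * (1 + d * e + d * t ^+ 2) `^ (- r)).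
Definition dtpow t : R := (e + 1 * t ^+ 2) `^ r * (1 + d * e + d * t ^+ 2) `^ (- r) *
  (1 + 2 * r * (t * t * ((e + 1 * t ^+ 2) `^ (- 1) * (1 + d * e + d * t ^+ 2) `^ (- 1)))).

Let P0 t : 0 < e + t ^+ 2.
Proof. by rewrite ltr_pwDl// sqr_ge0. Qed.

Let de0 : 0 < 1 + d * e.
Proof. by rewrite addr_gt0// mulr_gt0. Qed.

Let Q0 t : 0 < 1 + d * e + d * t ^+ 2.
Proof. by rewrite ltr_pwDl// mulr_ge0 ?sqr_ge0// ltW. Qed.

Lemma zed_gt0 t : 0 < zed t.
Proof. by rewrite divr_gt0. Qed.

Lemma zed_ge0 t : 0 <= zed t. Proof. exact/ltW/zed_gt0. Qed.

Lemma zed_led t : zed t <= d^-1.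
Proof.
rewrite ler_pdivrMr// mulrDr mulrDr !mulrA mulVf ?gt_eqF// !mul1r mulr1 -addrA lerDr.
by rewrite invr_ge0 ltW.
Qed.

Lemma zed_le t : zed t <= e + t ^+ 2.
Proof.
rewrite ler_pdivrMr// ler_peMr ?(ltW (P0 t))// -addrA lerDl.
by rewrite addr_ge0// mulr_ge0 ?sqr_ge0// ltW.
Qed.

Lemma zedE t : (e + 1 * t ^+ 2) `^ r * (1 + d * e + d * t ^+ 2) `^ (- r) = zed t `^ r.
Proof.
rewrite mul1r /zed powRM ?invr_ge0 ?(ltW (P0 t)) ?(ltW (Q0 t))//; congr (_ * _).
by rewrite -powR_inv1 ?(ltW (Q0 t))// -powRrM mulN1r.
Qed.

Lemma tpowE t : tpow t = t * zed t `^ r.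
Proof. by rewrite /tpow zedE. Qed.

Lemma dtpowE t : dtpow t =
  zed t `^ r * (1 + 2 * r * (t ^+ 2 / ((e + t ^+ 2) * (1 + d * e + d * t ^+ 2)))).
Proof.
rewrite /dtpow zedE !powR_inv1 ?mul1r ?(ltW (P0 t)) ?(ltW (Q0 t))//.
by rewrite invfM -expr2.
Qed.

Lemma dtpow_ge t : zed t `^ r <= dtpow t.
Proof.
rewrite dtpowE ler_peMr ?powR_ge0// lerDl; apply: mulr_ge0; first exact: mulr_ge0.
by apply: divr_ge0; [exact: sqr_ge0|rewrite mulr_ge0// ltW].
Qed.

Lemma dtpow_ge0 t : 0 <= dtpow t.
Proof. exact: le_trans (powR_ge0 _ _) (dtpow_ge t). Qed.

(** The correction [t^2 / (P Q)], with [P = e + t^2] and [Q = 1 + d P], is at most 1 because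
    [t^2 <= P] and [1 <= Q]. At the exponent [(beta - 1) / 2] the factor [1 + 2 r] is [beta]. *)
Lemma dtpow_le t : dtpow t <= (1 + 2 * r) * zed t `^ r.
Proof.
rewrite dtpowE mulrC; apply: ler_wpM2r; first exact: powR_ge0.
rewrite lerD2l ler_piMr ?mulr_ge0// ler_pdivrMr ?mulr_gt0// mul1r.
apply: (@le_trans _ _ (e + t ^+ 2)); first by rewrite lerDr ltW.
rewrite ler_peMr ?(ltW (P0 t))// -addrA lerDl.
by rewrite addr_ge0// mulr_ge0 ?sqr_ge0// ltW.
Qed.

Lemma dtpow_bounded t : `|dtpow t| <= (1 + 2 * r) * d^-1 `^ r.
Proof.
rewrite ger0_norm ?dtpow_ge0//; apply: le_trans (dtpow_le t) _.
apply: ler_wpM2l; first by rewrite addr_ge0// mulr_ge0.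
by apply: le_powR; rewrite ?zed_ge0 ?zed_led.
Qed.

Lemma is_derive_tpow t : is_derive t (1 : R) tpow (dtpow t).
Proof.
have e1 : 0 <= (1 : R) by [].
have dP := is_derive_powR_quad r t e0 e1.
have dQ := is_derive_powR_quad (- r) t de0 (ltW d0).
apply: (is_derive_eq (is_deriveM (is_derive_id t (1 : R)) (is_deriveM dP dQ))).
have pE (x a : R) : 0 < x -> x `^ (a - 1) = x `^ a * x^-1.
  move=> x0; rewrite powRD; last by rewrite (gt_eqF x0) implybT.
  by rewrite powR_inv1// ltW.
rewrite [X in _ + X](_ : _ = (e + 1 * t ^+ 2) `^ r * (1 + d * e + d * t ^+ 2) `^ (- r));
  last exact: mulr1.
rewrite /dtpow /= !pE ?mul1r// !powR_inv1 ?(ltW (P0 t)) ?(ltW (Q0 t))//.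
move: (P0 t) (Q0 t); rewrite /GRing.scale/=; set P := e + t ^+ 2; set Q := _ + d * _ => P0' Q0'.
(* The derivative produces [1/P - d/Q], which this relation turns into [1/(P Q)]: the correction
   term is nonnegative. *)
have QE : Q = 1 + d * P by rewrite /Q /P; ring.
move: (P `^ r) (Q `^ (- r)) => a b.
rewrite QE; rewrite QE in Q0'; field.
by rewrite !gt_eqF.
Qed.

Lemma continuous_dtpow : continuous dtpow.
Proof.
have cP a : continuous (fun t => (e + 1 * t ^+ 2) `^ a).
  by move=> t; exact: is_derive_continuous (is_derive_powR_quad a t e0 ler01).
have cQ a : continuous (fun t => (1 + d * e + d * t ^+ 2) `^ a).
  by move=> t; exact: is_derive_continuous (is_derive_powR_quad a t de0 (ltW d0)).
have cid : continuous (id : R -> R) by move=> t; exact: cvg_id.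
apply: cont_mul; first exact: cont_mul.
have cM : continuous (fun t => 2 * r * (t * t * ((e + 1 * t ^+ 2) `^ (- 1) *
    (1 + d * e + d * t ^+ 2) `^ (- 1)))).
  apply: (@cont_mul _ _ (cst (2 * r))); first by move=> ?; exact: cst_continuous.
  by apply: cont_mul; apply: cont_mul.
by move=> t; apply: (cvgD (cvg_cst _) (cM t)).
Qed.

Lemma chainable_tpow n : chainable (n := n) tpow dtpow ((1 + 2 * r) * d^-1 `^ r).
Proof.
split; [by rewrite /tpow mul0r|exact: is_derive_tpow|exact: continuous_dtpow|exact: dtpow_bounded|].
move=> phi sphi; apply: (comp_smooth sphi).
apply: (@alg_mul _ _ _ phi (fun x => (e + 1 * phi x ^+ 2) `^ r * (1 + d * e + d * phi x ^+ 2) `^ (- r))).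
  by apply: alg_gen; left; exists [::].
apply: (@alg_mul _ _ _ (fun x => (e + 1 * phi x ^+ 2) `^ r) (fun x => (1 + d * e + d * phi x ^+ 2) `^ (- r))).
  by apply: alg_gen; right; exists e, 1, r.
by apply: alg_gen; right; exists (1 + d * e), d, (- r); split => //; exact: ltW.
Qed.

Lemma normr_tpow t : `|tpow t| = `|t| * zed t `^ r.
Proof. by rewrite tpowE normrM (ger0_norm (powR_ge0 _ _)). Qed.

Lemma normr_tpow_le t : `|tpow t| <= `|t| * (e + t ^+ 2) `^ r.
Proof.
rewrite normr_tpow; apply: ler_wpM2l => //.
by apply: le_powR; rewrite ?zed_ge0 ?zed_le.
Qed.

End truncated_power.

Lemma powRKV (R : realType) (x a : R) : 0 <= x -> 0 < a -> (x `^ a) `^ a^-1 = x.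
Proof. by move=> x0 a0; rewrite -powRrM mulfV ?gt_eqF// powRr1. Qed.

Lemma powRVK (R : realType) (x a : R) : 0 <= x -> 0 < a -> (x `^ a^-1) `^ a = x.
Proof. by move=> x0 a0; rewrite -powRrM mulVf ?gt_eqF// powRr1. Qed.

Section integral_bounds.
Context d (T : measurableType d) {R : realType} (mu : {measure set T -> \bar R}) (A : set T).
Hypotheses (mA : measurable A).
Implicit Types f g : T -> R.

Lemma integral_le_scale f g (k B : R) : measurable_fun A f -> measurable_fun A g ->
  (forall x, A x -> 0 <= f x) -> (forall x, A x -> 0 <= g x) -> 0 <= k ->
  (forall x, A x -> f x <= k * g x) ->
  (\int[mu]_(x in A) (g x)%:E <= B%:E)%E -> (\int[mu]_(x in A) (f x)%:E <= (k * B)%:E)%E.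
Proof.
move=> mf mg f0 g0 k0 fg gB.
apply: (@le_trans _ _ (\int[mu]_(x in A) (k * g x)%:E)%E).
  apply: ge0_le_integral => //.
  - exact/measurable_EFinP.
  - by apply/measurable_EFinP; exact: measurable_funM.
under eq_integral do rewrite EFinM.
rewrite ge0_integralZl//; last exact/measurable_EFinP.
by rewrite EFinM; apply: lee_wpmul2l.
Qed.

Lemma ge0_hoelder_in f g (p q : R) : measurable_fun A f -> measurable_fun A g ->
  (forall x, 0 <= f x) -> (forall x, 0 <= g x) -> 0 < p -> 0 < q -> p^-1 + q^-1 = 1 ->
  (\int[mu]_(x in A) (f x * g x)%:E <= (\int[mu]_(x in A) (f x `^ p)%:E) `^ p^-1 *
     (\int[mu]_(x in A) (g x `^ q)%:E) `^ q^-1)%E.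
Proof.
move=> mf mg f0 g0 p0 q0 pq.
have mr (h : T -> R) : measurable_fun A h -> measurable_fun setT (h \_ A).
  move=> mh; apply/measurable_EFinP; rewrite -restrict_EFin.
  by apply: (measurable_restrictT _ mA).1; exact/measurable_EFinP.
have r0 (h : T -> R) x : (forall x, 0 <= h x) -> 0 <= (h \_ A) x.
  by move=> h0; rewrite patchE; case: ifP.
have := ge0_hoelder mu (mr f mf) (mr g mg) (r0 f ^~ f0) (r0 g ^~ g0) p0 q0 pq.
have E (k : T -> R) (a : R) : 0 < a ->
    (\int[mu]_x ((k \_ A) x `^ a)%:E = \int[mu]_(x in A) (k x `^ a)%:E)%E.
  move=> a0; rewrite [RHS]integral_mkcond; apply: eq_integral => x _.
  by rewrite !patchE; case: ifP => //; rewrite powR0// gt_eqF.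
rewrite (E f p p0) (E g q q0).
rewrite [X in (X <= _)%E -> _](_ : _ = \int[mu]_(x in A) (f x * g x)%:E)%E//.
rewrite [RHS]integral_mkcond; apply: eq_integral => x _.
by rewrite !patchE; case: ifP => //; rewrite mul0r.
Qed.

(** The excess [max(|f| - K, 0)] stands for [|f|] where it is large: it vanishes at each point once
    [K] is large, and where [|f| > 2 K] it still controls [|f|], by [|f| <= 2 (|f| - K)]. *)
Lemma integral_tail f (p : R) : measurable_fun A f -> 0 < p ->
  (\int[mu]_(x in A) (`|f x| `^ p)%:E < +oo)%E -> forall eta : R, 0 < eta ->
  exists2 K : R, 1 <= K &
    (\int[mu]_(x in A) (Num.max (`|f x| - K) 0 `^ p)%:E <= eta%:E)%E.
Proof.
move=> mf p0 fp eta eta0.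
have mn : measurable_fun A (fun x => `|f x|) by exact: measurableT_comp.
pose v k x := Num.max (`|f x| - k.+1%:R) 0 `^ p.
have mv k : measurable_fun A (EFin \o v k).
  apply/measurable_EFinP/measurable_fun_powr/measurable_maxr => //.
  exact: measurable_funB.
have v0 k x : 0 <= v k x by exact: powR_ge0.
have ig : mu.-integrable A (fun x => (`|f x| `^ p)%:E).
  apply/integrableP; split; first by apply/measurable_EFinP/measurable_fun_powr.
  by under eq_integral do rewrite gee0_abs ?lee_fin ?powR_ge0//.
have [| | |_ _] := @dominated_convergence _ _ R mu A mA (fun k x => (v k x)%:E) (cst 0%E)
    (fun x => (`|f x| `^ p)%:E) mv _ _ ig.
- exact: measurable_cst.
- apply: aeW => x Ax; apply: cvg_near_cst.
  have := archi_boundP (normr_ge0 (f x)); set N := Num.bound _ => hN.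
  exists N => // k /= Nk; rewrite /v; congr EFin.
  have -> : Num.max (`|f x| - k.+1%:R) 0 = 0.
    apply/max_idPr; rewrite subr_le0; apply: le_trans (ltW hN) _.
    by rewrite ler_nat (leq_trans Nk).
  by rewrite powR0// gt_eqF.
- apply: aeW => x k Ax; rewrite gee0_abs ?lee_fin//.
  apply: le_powR; [exact: ltW|by rewrite le_max lexx orbT|].
  by rewrite ge_max normr_ge0 andbT gerBl.
rewrite integral0 => /fine_cvgP[fin /cvgrPdist_le/(_ _ eta0)] near_le.
near \oo => k; exists k.+1%:R; first by rewrite ler1n.
have kfin : (\int[mu]_(x in A) (v k x)%:E)%E \is a fin_num by near: k.
rewrite -(fineK kfin) lee_fin; apply: le_trans (ler_norm _) _.
rewrite -normrN -[X in `|X|]add0r; near: k; exact: near_le.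
Unshelve. all: by end_near. Qed.

End integral_bounds.

Section truncated_power_bounds.
Context {R : realType}.
Implicit Types e d r t p K c : R.

Lemma cvg_tpow e r t : 0 < e ->
  tpow e k.+1%:R^-1 r t @[k --> \oo] --> t * (e + t ^+ 2) `^ r.
Proof.
move=> e0; have ch : (k.+1%:R^-1 : R) @[k --> \oo] --> (0 : R) by exact: cvg_harmonic.
have cb : (1 + k.+1%:R^-1 * e + k.+1%:R^-1 * t ^+ 2 : R) @[k --> \oo] --> (1 : R).
  rewrite [X in _ --> X](_ : _ = 1 + 0 * e + 0 * t ^+ 2); last by rewrite !mul0r !addr0.
  apply: cvgD; last exact: cvgMl.
  by apply: cvgD; [exact: cvg_cst|exact: cvgMl].
have cp : {for (1 : R), continuous (fun x : R => x `^ (- r))}.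
  exact: is_derive_continuous (is_derive1_powR (- r) ltr01).
apply: cvgMr; rewrite -[X in _ --> X]mulr1 mul1r; apply: cvgMr.
by have := cvg_comp _ _ cb cp; rewrite powR1.
Qed.

(** Links the test function, with exponent [r], to the function put into the Sobolev inequality,
    with exponent [r / 2]; this is what makes absorption possible. *)
Lemma tpow_sqr e d r t : 0 < e -> 0 < d ->
  `|t| * `|tpow e d r t| = `|tpow e d (r / 2) t| ^+ 2.
Proof.
move=> e0 d0; rewrite !normr_tpow// exprMn mulrA -expr2; congr (_ * _).
rewrite expr2 -powRD ?(gt_eqF (zed_gt0 e0 d0 t)) ?implybT//.
by rewrite -splitr.
Qed.

(** For [|t| <= 2 K] the left side is bounded by a constant free of [d]. For [|t| > 2 K] one has
    [1 + |t|^(p-1) <= 2 |t|^(p-1)] and [|t| <= 2 (|t| - K)], and one factor [|t|] is spent on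
    [tpow_sqr]. *)
Lemma tpow_growth c p K d r t : 0 < c -> 2 < p -> 1 <= K -> 0 < d -> 0 <= r ->
  c * (1 + `|t| `^ (p - 1)) * `|tpow 1 d r t| <=
  c * (1 + (2 * K) `^ (p - 1)) * (2 * K * (1 + (2 * K) ^+ 2) `^ r) +
  2 * c * 2 `^ (p - 2) * (Num.max (`|t| - K) 0 `^ (p - 2) * `|tpow 1 d (r / 2) t| ^+ 2).
Proof.
move=> c0 p2 K1 d0 r0.
have K0 : 0 < K by exact: lt_le_trans K1.
have p10 : 0 <= p - 1 by move: p2; clear; lra.
have p20 : 0 <= p - 2 by move: p2; clear; lra.
have [tK|Kt] := leP `|t| (2 * K).
- have h1 : `|t| `^ (p - 1) <= (2 * K) `^ (p - 1) by exact: le_powR.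
  apply: (@le_trans _ _ (c * (1 + (2 * K) `^ (p - 1)) * (2 * K * (1 + (2 * K) ^+ 2) `^ r))).
    apply: ler_pM => //.
    + by rewrite mulr_ge0 ?(ltW c0)// addr_ge0// powR_ge0.
    + by rewrite ler_pM2l// lerD2l.
    + apply: le_trans (normr_tpow_le ltr01 d0 r0 t) _.
      apply: ler_pM => //; first exact: powR_ge0.
      apply: le_powR => //; first by rewrite addr_ge0// sqr_ge0.
      rewrite lerD2l -[t ^+ 2]real_normK ?num_real//.
      by apply: lerXn2r; rewrite ?nnegrE// mulr_ge0// ltW.
  rewrite lerDl; apply: mulr_ge0; first by rewrite !mulr_ge0 ?powR_ge0// ltW.
  by rewrite mulr_ge0 ?powR_ge0// sqr_ge0.
- have t1 : 1 <= `|t|.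
    by move: Kt K1; clear; lra.
  have t0 : 0 < `|t| by exact: lt_le_trans t1.
  apply: ler_wpDl.
    apply: mulr_ge0; apply: mulr_ge0; rewrite ?powR_ge0 ?(ltW c0)//.
      by rewrite addr_ge0// powR_ge0.
    by rewrite mulr_ge0// ltW.
  rewrite -tpow_sqr//.
  have -> : Num.max (`|t| - K) 0 = `|t| - K.
    by apply/max_idPl; move: Kt K0; clear; lra.
  have h1 : 1 + `|t| `^ (p - 1) <= 2 * `|t| `^ (p - 1).
    have := le_powR p10 ler01 t1; rewrite powR1.
    by rewrite mulr_natl mulr2n lerD2r.
  have h2 : `|t| `^ (p - 1) = `|t| `^ (p - 2) * `|t|.
    rewrite -[X in _ * X]powRr1// -powRD ?(gt_eqF t0) ?implybT//.
    by congr (_ `^ _); ring.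
  have h3 : `|t| `^ (p - 2) <= 2 `^ (p - 2) * (`|t| - K) `^ (p - 2).
    rewrite -powRM//; last by move: Kt K0; clear; lra.
    by apply: le_powR => //; move: Kt K0; clear; lra.
  move: h3; set a := 2 `^ _; set b := (_ - K) `^ _; set y := `|tpow _ _ _ _| => h3.
  have y0 : 0 <= y by exact: normr_ge0.
  apply: (@le_trans _ _ (c * (2 * `|t| `^ (p - 1)) * y)).
    by apply: ler_wpM2r => //; rewrite ler_pM2l.
  rewrite h2 -subr_ge0.
  have -> : 2 * c * a * (b * (`|t| * y)) - c * (2 * (`|t| `^ (p - 2) * `|t|)) * y =
    2 * c * `|t| * y * (a * b - `|t| `^ (p - 2)) by ring.
  by rewrite mulr_ge0 ?subr_ge0// !mulr_ge0// ltW.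
Qed.

End truncated_power_bounds.

Section iteration.
Context {R : realType}.
Implicit Types r E Q : R.

(* The exponents of [E] are chosen so that [a k * E^(al k + b)] exactly satisfies
   [x_{k+1} <= x_k^r], that is, [r (k + 1) + al (k + 1) + b = r (al k + b)]. *)
Lemma geometric_iteration (a : nat -> R) r E : 1 < r -> 1 <= E -> (forall k, 0 <= a k) ->
  (forall k, a k.+1 <= (E ^+ k.+1 * a k) `^ r) ->
  forall k, a k <= (a 0%N * E `^ ((r + r / (r - 1)) / (r - 1))) `^ (r ^+ k).
Proof.
move=> r1 E1 a0 ha.
have E0 : 0 < E by exact: lt_le_trans E1.
have rN0 : r - 1 != 0 by rewrite subr_eq0 gt_eqF.
have r10 : 0 < r - 1 by rewrite subr_gt0.
have r0 : 0 < r by exact: lt_trans r1.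
pose al := r / (r - 1); pose b := (r + al) / (r - 1).
have al0 : 0 <= al by rewrite divr_ge0// ltW.
have b0 : 0 <= b by apply: divr_ge0; [rewrite addr_ge0// ltW|exact: ltW].
have stronger k : a k * E `^ (al * k%:R + b) <= (a 0%N * E `^ b) `^ (r ^+ k).
  elim: k => [|k IH].
    by rewrite mulr0 add0r expr0 powRr1// mulr_ge0 ?powR_ge0.
  rewrite exprSr powRrM.
  apply: (@le_trans _ _ ((a k * E `^ (al * k%:R + b)) `^ r)); last first.
    by apply: le_powR => //; [exact: ltW|rewrite mulr_ge0 ?powR_ge0].
  rewrite [leRHS]powRM ?powR_ge0// -powRrM.
  apply: (@le_trans _ _ ((E ^+ k.+1 * a k) `^ r * E `^ (al * k.+1%:R + b))).
    by apply: ler_wpM2r; rewrite ?powR_ge0.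
  rewrite powRM ?exprn_ge0 ?(ltW E0)// -powR_mulrn ?(ltW E0)// -powRrM mulrAC mulrC.
  rewrite -powRD ?(gt_eqF E0) ?implybT//.
  rewrite (_ : k.+1%:R * r + _ = (al * k%:R + b) * r)//.
  by rewrite /b /al -natr1; field.
move=> k; apply: le_trans (stronger k); rewrite ler_peMr//.
have z0 : 0 <= al * k%:R + b by rewrite addr_ge0// mulr_ge0.
by have := ler_powR E1 z0; rewrite powRr0.
Qed.

(** In use, [m] is the measure of a superlevel set. The powers are unbounded since
    [G^(r^k) >= r^k ln G >= k (r - 1) ln G]. *)
Lemma powR_exp_unbounded r G m : 1 < r -> 1 < G -> 0 <= m ->
  (forall k, m * G `^ (r ^+ k) <= 1) -> m = 0.
Proof.
move=> r1 G1 m0 h; apply/eqP; rewrite -[_ == _]negbK; apply/negP => mN0.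
have mp : 0 < m by rewrite lt0r mN0.
have G0 : 0 < G by exact: lt_trans G1.
have lG : 0 < ln G by exact: ln_gt0.
have r10 : 0 < r - 1 by rewrite subr_gt0.
pose z := (m * ln G * (r - 1))^-1.
have z0 : 0 <= z by rewrite invr_ge0 !mulr_ge0// ltW.
have := archi_boundP z0; set k := Num.bound _ => zk.
have rk : k%:R * (r - 1) <= r ^+ k.
  elim: (k) => [|j IH]; first by rewrite mul0r.
  rewrite -natr1 mulrDl mul1r exprS.
  have rj : 1 <= r ^+ j by rewrite exprn_ege1// ltW.
  have : (r - 1) * 1 <= (r - 1) * r ^+ j by rewrite ler_pM2l.
  by move: IH; set x := _ * (r - 1); set y := r ^+ j; clear; lra.
have := h k; apply/negP; rewrite -ltNge.
have Gk : k%:R * (r - 1) * ln G <= G `^ (r ^+ k).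
  rewrite /powR gt_eqF//; apply: le_trans (expR_ge1Dx _).
  apply: (@le_trans _ _ (r ^+ k * ln G)); last by rewrite lerDr.
  by rewrite ler_pM2r.
apply: lt_le_trans (_ : m * (k%:R * (r - 1) * ln G) <= _); last by rewrite ler_pM2l.
move: zk; rewrite /z -div1r ltr_pdivrMr ?mulr_gt0//.
by rewrite (_ : _ * (m * _ * _) = m * (k%:R * (r - 1) * ln G)); last by ring.
Qed.

End iteration.

(** * Higher integrability and iteration *)

Section higher_integrability.
Context d (T : measurableType d) {R : realType} (mu : {measure set T -> \bar R}) (A : set T).
Hypotheses (mA : measurable A) (fA : (mu A < +oo)%E).
Variables (u : T -> R) (p c M : R).
Hypotheses (mu_ : measurable_fun A u) (p2 : 2 < p) (c0 : 0 < c) (M0 : 0 < M).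
Hypothesis up : (\int[mu]_(x in A) (`|u x| `^ p)%:E < +oo)%E.
(** The energy inequality and the Sobolev inequality in one statement, uniform in [e] and [dl]. With
    it the iteration runs on an arbitrary space of finite measure. *)
Hypothesis key : forall beta e dl B : R, 1 <= beta -> 0 < e -> 0 < dl -> 0 < B ->
  (\int[mu]_(x in A) (c * (1 + `|u x| `^ (p - 1)) * `|tpow e dl (beta - 1) (u x)|)%:E
     <= B%:E)%E ->
  (\int[mu]_(x in A) (`|tpow e dl ((beta - 1) / 2) (u x)| `^ p)%:E
     <= ((M * (beta ^+ 2 * B)) `^ (p / 2))%:E)%E.

Let p0 : 0 < p. Proof. exact: lt_trans p2. Qed.

Lemma measurable_tpow e dl r : 0 < e -> 0 < dl -> 0 <= r ->
  measurable_fun A (fun x => `|tpow e dl r (u x)|).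
Proof.
move=> e0 d0 r0; apply: measurableT_comp => //.
apply: (measurableT_comp (f := tpow e dl r)) => //.
apply: continuous_measurable_fun => t.
exact: is_derive_continuous (is_derive_tpow r e0 d0 t).
Qed.

(** Removes the truncation by letting [dl] tend to 0; the limit [|u| (e + u^2)^r] dominates
    [|u|^(1 + 2 r)]. *)
Lemma tpow_fatou e r (Z : R) : 0 < e -> 0 <= r ->
  (forall dl, 0 < dl -> (\int[mu]_(x in A) (`|tpow e dl r (u x)| `^ p)%:E <= Z%:E)%E) ->
  (\int[mu]_(x in A) (`|u x| `^ (p * (1 + 2 * r)))%:E <= Z%:E)%E.
Proof.
move=> e0 r0 le.
have k0 k : (0 : R) < k.+1%:R^-1 by rewrite invr_gt0.
have mn : measurable_fun A (fun x => `|u x|) by exact: measurableT_comp.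
have ml : measurable_fun A (fun x => `|u x * (e + u x ^+ 2) `^ r| `^ p).
  apply/measurable_fun_powr/measurableT_comp => //; apply: measurable_funM => //.
  apply: measurable_fun_powr; apply: measurable_funD; first exact: measurable_cst.
  exact: measurable_funX.
apply: (@le_trans _ _ (\int[mu]_(x in A) (`|u x * (e + u x ^+ 2) `^ r| `^ p)%:E)%E).
  apply: (ae_le_integral_EFin mA) => //; first exact: measurable_fun_powr.
  apply: aeW => x _; rewrite mulrC powRrM; apply: le_powR => //; first exact: ltW.
  have r1 : 0 < 1 + 2 * r by rewrite ltr_pwDl// mulr_ge0.
  rewrite powRD; last by rewrite (gt_eqF r1).
  rewrite powRr1// normrM (ger0_norm (powR_ge0 _ _)); apply: ler_wpM2l => //.
  rewrite -powR_sqr// (_ : 2 * r / 2 = r); last by field.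
  apply: le_powR => //.
  by rewrite real_normK ?num_real// lerDr ltW.
apply: (@fatou_le _ _ R mu A mA (fun k x => `|tpow e k.+1%:R^-1 r (u x)| `^ p)) => //.
- by move=> k; apply: measurable_fun_powr; exact: measurable_tpow.
- by apply: aeW => x _; apply: cvg_norm_powR => //; exact: cvg_tpow.
- by move=> k; exact: le.
Qed.

(** The truncated power is at most [dl^(-r) |u|]. This finiteness is what allows absorption in
    [all_moments]. *)
Lemma tpow_integrable dl r : 0 < dl -> 0 <= r ->
  (\int[mu]_(x in A) (`|tpow 1 dl r (u x)| `^ p)%:E)%E \is a fin_num.
Proof.
move=> d0 r0; rewrite ge0_fin_numE; last first.
  by apply: integral_ge0 => x _; rewrite lee_fin powR_ge0.
have upE : (\int[mu]_(x in A) (`|u x| `^ p)%:E)%E \is a fin_num.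
  by rewrite ge0_fin_numE// integral_ge0// => x _; rewrite lee_fin powR_ge0.
have mn : measurable_fun A (fun x => `|u x|) by exact: measurableT_comp.
apply: le_lt_trans (ltry _).
apply: (@integral_le_scale _ _ R mu A mA _ (fun x => `|u x| `^ p) ((dl^-1 `^ r) `^ p)
  (fine (\int[mu]_(x in A) (`|u x| `^ p)%:E))).
- by apply: measurable_fun_powr; exact: measurable_tpow.
- exact: measurable_fun_powr.
- by move=> x _; exact: powR_ge0.
- by move=> x _; exact: powR_ge0.
- exact: powR_ge0.
- move=> x _; rewrite -powRM ?powR_ge0//; apply: le_powR => //; first exact: ltW.
  rewrite normr_tpow// mulrC; apply: ler_wpM2r => //.
  by apply: le_powR; rewrite ?zed_ge0 ?zed_led.
- by rewrite fineK.
Qed.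

(* Brezis-Kato: on [|u| > 2K] the factor [|u|^(p-2)] is small in [L^(p/(p-2))], so that this
   part of the right-hand side is absorbed, uniformly in the truncation [dl]. *)
Lemma all_moments beta : 1 <= beta ->
  (\int[mu]_(x in A) (`|u x| `^ (p * beta))%:E < +oo)%E.
Proof.
move=> b1; pose r := beta - 1; have r0 : 0 <= r by rewrite subr_ge0.
have b0 : 0 < beta by exact: lt_le_trans b1.
pose kap := 2 * c * 2 `^ (p - 2).
have kap0 : 0 < kap by rewrite !mulr_gt0// powR_gt0.
pose al := M * beta ^+ 2 * kap.
have al0 : 0 < al by rewrite !mulr_gt0// exprn_gt0.
have p20 : 0 < p - 2 by rewrite subr_gt0.
pose P := p / (p - 2); pose Q := p / 2.
have P0 : 0 < P by rewrite divr_gt0.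
have Q0 : 0 < Q by rewrite divr_gt0.
have PQ : P^-1 + Q^-1 = 1.
  by rewrite /P /Q; field; rewrite !gt_eqF.
(* With this value the term to absorb, [al * eta' * Y], is [Y / 2]. *)
pose eta' := (2 * al)^-1.
have eta'0 : 0 < eta' by rewrite invr_gt0 mulr_gt0.
(* The level [eta'^P] becomes [eta'] when Hoelder takes the power [1/P]. *)
have [K K1 vK] := integral_tail mA mu_ p0 up (powR_gt0 P eta'0).
have fAE : (mu A) \is a fin_num by rewrite ge0_fin_numE.
pose A0 := c * (1 + (2 * K) `^ (p - 1)) * (2 * K * (1 + (2 * K) ^+ 2) `^ r).
have A00 : 0 <= A0.
  have K0 : 0 <= K by exact: le_trans K1.
  apply: mulr_ge0; apply: mulr_ge0; rewrite ?powR_ge0 ?(ltW c0)//.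
    by rewrite addr_ge0// powR_ge0.
  by rewrite mulr_ge0.
pose A1 := A0 * fine (mu A) + 1.
have A10 : 0 < A1 by rewrite ltr_wpDl// mulr_ge0// fine_ge0.
have mn : measurable_fun A (fun x => `|u x|) by exact: measurableT_comp.
pose v x := Num.max (`|u x| - K) 0.
have v0 x : 0 <= v x by rewrite le_max lexx orbT.
have mv : measurable_fun A v.
  apply: measurable_maxr; last exact: measurable_cst.
  by apply: measurable_funB => //; exact: measurable_cst.
have r20 : 0 <= r / 2 by rewrite divr_ge0.
suff bound dl : 0 < dl -> (\int[mu]_(x in A) (`|tpow 1 dl (r / 2) (u x)| `^ p)%:E <=
    ((2 * (M * beta ^+ 2 * A1)) `^ Q)%:E)%E.
  have := tpow_fatou ltr01 r20 bound.
  rewrite (_ : 1 + 2 * (r / 2) = beta); last by rewrite /r; field.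
  by move=> /le_lt_trans; apply; exact: ltry.
move=> d0.
have mh := measurable_tpow ltr01 d0 r20.
have mF := measurable_tpow ltr01 d0 r0.
have Xfin := tpow_integrable d0 r20.
pose X := fine (\int[mu]_(x in A) (`|tpow 1 dl (r / 2) (u x)| `^ p)%:E).
have XE : (\int[mu]_(x in A) (`|tpow 1 dl (r / 2) (u x)| `^ p)%:E)%E = X%:E by rewrite fineK.
have X0 : 0 <= X by rewrite fine_ge0// integral_ge0// => x _; rewrite lee_fin powR_ge0.
pose Y := X `^ Q^-1.
have Y0 : 0 <= Y by exact: powR_ge0.
have mh2 : measurable_fun A (fun x => `|tpow 1 dl (r / 2) (u x)| ^+ 2) by exact: measurable_funX.
have mvp : measurable_fun A (fun x => v x `^ (p - 2)) by exact: measurable_fun_powr.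
have H : (\int[mu]_(x in A) (v x `^ (p - 2) * `|tpow 1 dl (r / 2) (u x)| ^+ 2)%:E <=
    (eta' * Y)%:E)%E.
  have := @ge0_hoelder_in _ _ R mu A mA (fun x => v x `^ (p - 2))
    (fun x => `|tpow 1 dl (r / 2) (u x)| ^+ 2) P Q mvp mh2
    (fun x => powR_ge0 _ _) (fun x => sqr_ge0 _) P0 Q0 PQ.
  move=> /le_trans; apply.
  rewrite EFinM; apply: lee_pmul; [exact: poweR_ge0|exact: poweR_ge0| |].
  - have E : (\int[mu]_(x in A) ((v x `^ (p - 2)) `^ P)%:E = \int[mu]_(x in A) (v x `^ p)%:E)%E.
      apply: eq_integral => x _; rewrite -powRrM /P; congr (_ `^ _)%:E.
      by field; rewrite gt_eqF.
    rewrite E; apply: (@le_trans _ _ ((eta' `^ P)%:E `^ P^-1)%E).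
      apply: le_poweR vK; first by rewrite invr_ge0 ltW.
      by apply: integral_ge0 => x _; rewrite lee_fin powR_ge0.
    by rewrite poweR_EFin (powRKV (ltW eta'0) P0).
  - rewrite (_ : integral _ _ _ = X%:E); first by rewrite poweR_EFin.
    by rewrite -XE; apply: eq_integral => x _; rewrite powR_sqr.
pose B := A1 + kap * (eta' * Y).
have B0 : 0 < B.
  by rewrite ltr_wpDr// mulr_ge0 ?(ltW kap0)// mulr_ge0// ltW.
have HB : (\int[mu]_(x in A) (c * (1 + `|u x| `^ (p - 1)) * `|tpow 1 dl (beta - 1) (u x)|)%:E
     <= B%:E)%E.
  apply: (@le_trans _ _ (\int[mu]_(x in A) (A0 * 1 + kap *
      (v x `^ (p - 2) * `|tpow 1 dl (r / 2) (u x)| ^+ 2))%:E)%E).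
    apply: (ae_le_integral_EFin mA).
    - apply: measurable_funM => //; apply: measurable_funM => //.
      by apply: measurable_funD => //; exact: measurable_fun_powr.
    - apply: measurable_funD => //; apply: measurable_funM => //.
      exact: measurable_funM.
    - by move=> x _; rewrite mulr_ge0// mulr_ge0 ?(ltW c0)// addr_ge0// powR_ge0.
    - move=> x _; rewrite addr_ge0 ?mulr1// mulr_ge0 ?(ltW kap0)//.
      by rewrite mulr_ge0 ?powR_ge0// sqr_ge0.
    - by apply: aeW => x _; rewrite mulr1; exact: tpow_growth.
  rewrite (@ge0_integral_lin2 _ _ _ mu A (cst 1) _ A0 kap)//; last 3 first.
  - exact: measurable_funM.
  - by move=> x _; rewrite mulr_ge0 ?powR_ge0// sqr_ge0.
  - exact: ltW.
  rewrite /B (EFinD A1) (EFinM kap); apply: leeD; last by apply: lee_wpmul2l => //; rewrite lee_fin ltW.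
  rewrite (integral_cst mu mA 1%:E) mul1e -(fineK fAE) -EFinM lee_fin /A1.
  by rewrite lerDl.
have := key b1 ltr01 d0 B0 HB.
rewrite -/r XE !lee_fin -/Q => XB.
have MB0 : 0 <= M * (beta ^+ 2 * B) by rewrite mulr_ge0 ?(ltW M0)// mulr_ge0 ?sqr_ge0// ltW.
have YB : Y <= M * (beta ^+ 2 * B).
  have iQ0 : 0 <= Q^-1 by rewrite invr_ge0 ltW.
  by have := le_powR iQ0 X0 XB; rewrite (powRKV MB0 Q0).
have E : M * (beta ^+ 2 * B) = M * beta ^+ 2 * A1 + Y / 2.
  rewrite /B /eta' /al; field; rewrite !gt_eqF//; exact: exprn_gt0.
(* [Y] is a real number, so [Y / 2] can be subtracted; the bound that remains does not depend on
   [dl]. *)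
have Y2 : Y <= 2 * (M * beta ^+ 2 * A1).
  by move: YB; rewrite E; clear; set z := _ * A1; lra.
rewrite -(powRVK X0 Q0).
by apply: le_powR => //; exact: ltW.
Qed.

Let moment beta := \int[mu]_(x in A) (`|u x| `^ (p * beta)).

Lemma moment_ge0 beta : 0 <= moment beta.
Proof. by apply: Rintegral_ge0 => x _; exact: powR_ge0. Qed.

Lemma momentE beta : 1 <= beta ->
  (\int[mu]_(x in A) (`|u x| `^ (p * beta)))%:E =
  (\int[mu]_(x in A) (`|u x| `^ (p * beta))%:E)%E.
Proof.
move=> b1; rewrite fineK// ge0_fin_numE ?all_moments//.
by apply: integral_ge0 => x _; rewrite lee_fin powR_ge0.
Qed.

(** The inner product collects the constants of one step. The added 1 and the factor 2 absorb the
    summand 1 in [1 + moment], so that the recursion closes on that quantity. *)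
Definition moser_cst : R := 2 * (1 + M * (2 * c * expR 1 * (1 + fine (mu A)))).

(* With [e = 1 / beta'], the factor [(1 + e)^(beta' - 1)] stays below [exp 1]. *)
Lemma moser_step beta beta' : 1 <= beta -> beta' = 1 + p / 2 * (beta - 1) ->
  1 + moment beta' <= (moser_cst * beta' ^+ 2 * (1 + moment beta)) `^ (p / 2).
Proof.
move=> b1 beta'E.
have p12 : 1 < p / 2 by rewrite ltr_pdivlMr// mul1r.
have bb1 : 1 <= beta' by rewrite beta'E lerDl mulr_ge0 ?subr_ge0// ltW// (lt_trans _ p12).
have bb0 : 0 < beta' by exact: lt_le_trans bb1.
pose r := beta' - 1; have r0 : 0 <= r by rewrite subr_ge0.
pose e := beta'^-1; have e0 : 0 < e by rewrite invr_gt0.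
have er : (1 + e) `^ r <= expR 1.
  apply: (@le_trans _ _ (expR e `^ r)).
    by apply: le_powR => //; [rewrite addr_ge0// ltW|exact: expR_ge1Dx].
  rewrite -expRM ler_expR /e mulrC ler_pdivrMr// mul1r /r gerBl//.
have m0 : 0 <= moment beta := moment_ge0 beta.
have fA0 : 0 <= fine (mu A) by exact: fine_ge0.
have fAE : (mu A) \is a fin_num by rewrite ge0_fin_numE.
have e10 : 0 < expR (1 : R) := expR_gt0 1.
pose B := 2 * c * expR 1 * (1 + fine (mu A)) * (1 + moment beta).
have B0 : 0 < B by rewrite /B !mulr_gt0// ltr_pwDl.
have mn : measurable_fun A (fun x => `|u x|) by exact: measurableT_comp.
have pointwise dl x : 0 < dl ->
    c * (1 + `|u x| `^ (p - 1)) * `|tpow e dl (beta' - 1) (u x)| <=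
    2 * c * expR 1 * (1 * 1 + 1 * `|u x| `^ (p * beta)).
  move=> d0; rewrite -/r !mul1r; set t := u x.
  pose W := Num.max 1 `|t|.
  have W1 : 1 <= W by rewrite le_max lexx.
  have W0 : 0 < W by exact: lt_le_trans W1.
  have tW : `|t| <= W by rewrite le_max lexx orbT.
  have p10 : 0 <= p - 1 by rewrite subr_ge0 (le_trans _ (ltW p2))// ler1n.
  have h1 : c * (1 + `|t| `^ (p - 1)) <= 2 * c * W `^ (p - 1).
    have a1 : `|t| `^ (p - 1) <= W `^ (p - 1) by exact: le_powR.
    have a2 : 1 <= W `^ (p - 1) by have := le_powR p10 ler01 W1; rewrite powR1.
    rewrite [2 * c]mulrC -mulrA ler_pM2l// mulr_natl mulr2n.
    exact: lerD.
  have h2 : `|tpow e dl r t| <= W * (W `^ (2 * r) * expR 1).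
    apply: le_trans (normr_tpow_le e0 d0 r0 t) _.
    apply: ler_pM => //; first exact: powR_ge0.
    apply: (@le_trans _ _ ((W ^+ 2 * (1 + e)) `^ r)).
      apply: le_powR => //; first by rewrite addr_ge0 ?sqr_ge0// ltW.
      rewrite mulrDr mulr1 addrC; apply: lerD.
        rewrite -[t ^+ 2]real_normK ?num_real//.
        by apply: lerXn2r; rewrite ?nnegrE// ltW.
      by rewrite ler_peMl ?(ltW e0)// exprn_ege1.
    rewrite powRM ?sqr_ge0//; last by rewrite addr_ge0// ltW.
    apply: ler_pM => //; [exact: powR_ge0|exact: powR_ge0|].
    by rewrite -(powR_sqr _ (ltW W0)) (_ : 2 * r / 2 = r)//; field.
  apply: (@le_trans _ _ (2 * c * W `^ (p - 1) * (W * (W `^ (2 * r) * expR 1)))).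
    by apply: ler_pM => //; rewrite mulr_ge0 ?(ltW c0).
  have -> : 2 * c * W `^ (p - 1) * (W * (W `^ (2 * r) * expR 1)) =
    2 * c * expR 1 * W `^ (p * beta).
    (* The count of exponents behind the recursion: [2 r = 2 (beta' - 1) = p (beta - 1)]. *)
    rewrite (_ : p * beta = (p - 1) + 1 + 2 * r); last first.
      by rewrite /r beta'E; field.
    have D a b : W `^ (a + b) = W `^ a * W `^ b by rewrite powRD// (gt_eqF W0) implybT.
    by rewrite (D (p - 1 + 1)) (D (p - 1) 1) (powRr1 (ltW W0)); ring.
  rewrite ler_pM2l; last by rewrite !mulr_gt0.
  rewrite /W; case: (leP 1 `|t|) => _; first by rewrite lerDr.
  by rewrite powR1 lerDl powR_ge0.
have HB dl : 0 < dl ->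
    (\int[mu]_(x in A) (c * (1 + `|u x| `^ (p - 1)) * `|tpow e dl (beta' - 1) (u x)|)%:E
     <= B%:E)%E.
  move=> d0; have mF := measurable_tpow e0 d0 r0.
  rewrite /B -mulrA.
  apply: (@integral_le_scale _ _ R mu A mA _ (fun x => 1 * 1 + 1 * `|u x| `^ (p * beta))).
  - apply: measurable_funM => //; apply: measurable_funM => //.
    by apply: measurable_funD => //; exact: measurable_fun_powr.
  - apply: measurable_funD => //; apply: measurable_funM => //.
    exact: measurable_fun_powr.
  - by move=> x _; rewrite mulr_ge0// mulr_ge0 ?(ltW c0)// addr_ge0// powR_ge0.
  - by move=> x _; rewrite !mul1r addr_ge0// powR_ge0.
  - by rewrite !mulr_ge0// ltW.
  - by move=> x _; exact: pointwise.
  - rewrite (@ge0_integral_lin2 _ _ _ mu A (cst 1) _ 1 1)//; last exact: measurable_fun_powr.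
    rewrite (integral_cst mu mA 1%:E) !mul1e -momentE// -(fineK fAE) -EFinD lee_fin.
    rewrite /= mulrDl mul1r mulrDr mulr1 -/(moment beta).
    move: m0 fA0; set a := moment beta; set b := fine (mu A) => a0 b0'.
    have ab : 0 <= b * a by exact: mulr_ge0.
    by rewrite -subr_ge0 (_ : _ - _ = 1 + b * a); [rewrite addr_ge0|ring].
have fat dl : 0 < dl -> (\int[mu]_(x in A) (`|tpow e dl (r / 2) (u x)| `^ p)%:E <=
    ((M * (beta' ^+ 2 * B)) `^ (p / 2))%:E)%E.
  by move=> d0; exact: key bb1 e0 d0 B0 (HB dl d0).
have r20 : 0 <= r / 2 by rewrite divr_ge0.
have := tpow_fatou e0 r20 fat.
rewrite (_ : 1 + 2 * (r / 2) = beta'); last by rewrite /r; field.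
rewrite -momentE// -/(moment beta') lee_fin => le.
have p20 : 0 <= p / 2 by apply: ltW; exact: lt_trans p12.
pose N0 := M * (2 * c * expR 1 * (1 + fine (mu A))).
have N00 : 0 <= N0 by rewrite mulr_ge0 ?(ltW M0)// mulr_ge0 ?addr_ge0// !mulr_ge0// ltW.
pose y := (1 + N0) * beta' ^+ 2 * (1 + moment beta).
have by1 : 1 <= beta' ^+ 2 * (1 + moment beta).
  apply: (@le_trans _ _ (1 * 1)); first by rewrite mulr1.
  by apply: ler_pM => //; [exact: exprn_ege1|rewrite lerDl].
have y1 : 1 <= y.
  apply: (@le_trans _ _ (1 * 1)); first by rewrite mulr1.
  by rewrite /y -mulrA; apply: ler_pM => //; rewrite lerDl.
have y0 : 0 <= y by exact: le_trans y1.
have h1 : 1 <= y `^ (p / 2) by have := le_powR p20 ler01 y1; rewrite powR1.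
have h2 : moment beta' <= y `^ (p / 2).
  apply: le_trans le _; apply: le_powR => //.
    by rewrite mulr_ge0 ?(ltW M0)// mulr_ge0 ?sqr_ge0// ltW.
  rewrite (_ : M * _ = N0 * (beta' ^+ 2 * (1 + moment beta))); last by rewrite /B /N0; ring.
  rewrite /y -mulrA; apply: ler_wpM2r; first exact: le_trans by1.
  by rewrite lerDr.
(* Both summands are at most [y^(p/2)], and [2 <= 2^(p/2)] lets the factor 2 enter the power. *)
apply: (@le_trans _ _ (2 * y `^ (p / 2))).
  by rewrite mulr_natl mulr2n; exact: lerD.
rewrite (_ : moser_cst * _ * _ = 2 * y); last by rewrite /moser_cst /y /N0; ring.
rewrite powRM//; apply: ler_wpM2r; first exact: powR_ge0.
have := @ler_powR R 2 (ler1n _ 2) 1 (p / 2) (ltW p12).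
by rewrite powRr1.
Qed.

(** The constant [E] of [geometric_iteration]. The exponent after [j + 1] steps is at most
    [beta1 (p/2)^(j+1)] with [beta1 = (p+1)/2], so its square times [moser_cst] is at most
    [moser_base^(j+1)]; [moser_exp] is the exponent of [E] in that lemma for the ratio [p/2]. *)
Definition moser_base : R := moser_cst * ((p + 1) / 2) ^+ 2 * (p / 2) ^+ 2.
Definition moser_exp : R := (p / 2 + p / 2 / (p / 2 - 1)) / (p / 2 - 1).

Lemma moser_cst_ge1 : 1 <= moser_cst.
Proof.
have fA0 : 0 <= fine (mu A) by exact: fine_ge0.
apply: (@le_trans _ _ (1 * 1)); first by rewrite mulr1.
apply: ler_pM => //; first by rewrite ler1n.
by rewrite lerDl mulr_ge0 ?(ltW M0)// mulr_ge0 ?addr_ge0// !mulr_ge0 ?expR_ge0// ltW.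
Qed.

Lemma moser_base_ge1 : 1 <= moser_base.
Proof.
have p12 : 1 <= p / 2 by rewrite ler_pdivlMr// mul1r ltW.
have b1 : 1 <= (p + 1) / 2 by rewrite ler_pdivlMr// mul1r (le_trans (ltW p2))// lerDl.
apply: (@le_trans _ _ (1 * 1 * 1)); first by rewrite !mulr1.
by apply: ler_pM => //; [apply: ler_pM => //; [exact: moser_cst_ge1|exact: exprn_ege1]|exact: exprn_ege1].
Qed.

Lemma moser_iteration beta1 k : beta1 = (p + 1) / 2 ->
  1 + moment (1 + (beta1 - 1) * (p / 2) ^+ k) <=
  ((1 + moment beta1) * moser_base `^ moser_exp) `^ ((p / 2) ^+ k).
Proof.
move=> beta1E.
have p12 : 1 < p / 2 by rewrite ltr_pdivlMr// mul1r.
have p120 : 0 < p / 2 by exact: lt_trans p12.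
have b1 : 1 <= beta1 by rewrite beta1E ler_pdivlMr// mul1r (le_trans (ltW p2))// lerDl.
have b10 : 0 < beta1 by exact: lt_le_trans b1.
have rk1 j : 1 <= (p / 2) ^+ j by rewrite exprn_ege1// ltW.
have fA0 : 0 <= fine (mu A) by exact: fine_ge0.
have N1 := moser_cst_ge1.
have N0 : 0 < moser_cst by exact: lt_le_trans N1.
have NB1 : 1 <= moser_cst * beta1 ^+ 2.
  apply: (@le_trans _ _ (1 * 1)); first by rewrite mulr1.
  by apply: ler_pM => //; exact: exprn_ege1.
have E1 := moser_base_ge1.
pose a j := 1 + moment (1 + (beta1 - 1) * (p / 2) ^+ j).
have a0 j : 0 <= a j by rewrite addr_ge0// moment_ge0.
have := @geometric_iteration R a (p / 2) moser_base p12 E1 a0.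
have -> : a 0%N = 1 + moment beta1 by rewrite /a expr0 mulr1 [1 + (_ - _)]addrC subrK.
move=> /(_ _ k); apply => j.
have bj : 1 <= 1 + (beta1 - 1) * (p / 2) ^+ j.
  by rewrite lerDl mulr_ge0 ?subr_ge0// exprn_ge0// ltW.
have := @moser_step _ (1 + (beta1 - 1) * (p / 2) ^+ j.+1) bj.
rewrite exprS => /(_ ltac:(ring)); rewrite -exprS.
move=> /le_trans; apply; apply: le_powR; first exact: ltW.
  by apply: mulr_ge0; [rewrite mulr_ge0 ?sqr_ge0// ltW|exact: (a0 j)].
apply: ler_wpM2r; first exact: a0.
apply: (@le_trans _ _ (moser_cst * (beta1 * (p / 2) ^+ j.+1) ^+ 2)).
  rewrite ler_pM2l//; apply: lerXn2r; rewrite ?nnegrE.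
  - by rewrite addr_ge0// mulr_ge0 ?subr_ge0// exprn_ge0// ltW.
  - by rewrite mulr_ge0 ?(ltW b10)// exprn_ge0// ltW.
  - have := rk1 j.+1; set z := _ ^+ j.+1 => z1.
    by rewrite mulrBl mul1r addrCA gerDl subr_le0.
have sq : ((p / 2) ^+ j.+1) ^+ 2 = ((p / 2) ^+ 2) ^+ j.+1 by rewrite -!exprM mulnC.
rewrite (exprMn _ beta1) mulrA sq /moser_base -beta1E [leRHS]exprMn.
apply: ler_wpM2r; first by rewrite exprn_ge0// exprn_ge0// ltW.
exact: ler_eXnr.
Qed.

(** If [m] is the measure of the set where [|u| > lam], Chebyshev at the exponent [p beta_k] gives
    [m lam^(p beta_k) <= Q^((p/2)^k)]. As [lam >= 1] and [p beta_k >= th (p/2)^k], it follows that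
    [m (lam^th / Q)^((p/2)^k) <= 1] for all [k]. The assumption on [lam] says that [lam^th > Q],
    hence [m = 0]. *)
Lemma moser_ae_bound lam :
  (moser_base `^ moser_exp * (1 + moment ((p + 1) / 2))) `^
     (p * ((p + 1) / 2 - 1))^-1 < lam ->
  {ae mu, forall x, A x -> `|u x| <= lam}.
Proof.
set beta1 := (p + 1) / 2; set Q := _ * (1 + _); set th := p * (beta1 - 1) => Qlam.
have p12 : 1 < p / 2 by rewrite ltr_pdivlMr// mul1r.
have b1 : 0 < beta1 - 1 by rewrite subr_gt0 ltr_pdivlMr// mul1r (lt_trans p2)// ltrDl.
have th0 : 0 < th by rewrite mulr_gt0.
have lam0 : 0 < lam by apply: le_lt_trans Qlam; exact: powR_ge0.
have Q0 : 0 <= Q by rewrite mulr_ge0 ?powR_ge0// addr_ge0// moment_ge0.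
have mn : measurable_fun A (fun x => `|u x|) by exact: measurableT_comp.
pose S := A `&` [set x | lam < `|u x|].
have mS : measurable S.
  have := measurable_fun_ltr (measurable_cst lam) mn.
  by move=> /(_ mA [set true] I); rewrite (_ : A `&` _ = S)//; apply/seteqP; split.
have mSfin : mu S \is a fin_num.
  rewrite ge0_fin_numE//; apply: le_lt_trans fA.
  by apply: le_measure; rewrite ?inE//; exact: subIsetl.
suff S0 : mu S = 0%E.
  exists S; split => // x /= /not_implyP[Ax /negP]; rewrite -ltNge => xl.
  by split.
pose m := fine (mu S).
have mE : mu S = m%:E by rewrite fineK.
have m0 : 0 <= m by exact: fine_ge0.
rewrite mE; congr EFin.
have cheb beta : 1 <= beta -> m * lam `^ (p * beta) <= moment beta.
  move=> bb1; rewrite -lee_fin momentE// mulrC EFinM -mE.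
  rewrite -(integral_cst mu mS (lam `^ (p * beta))%:E).
  have SA : S `<=` A by exact: subIsetl.
  have mup : measurable_fun A (fun x => (`|u x| `^ (p * beta))%:E).
    by apply/measurable_EFinP; exact: measurable_fun_powr.
  apply: (@le_trans _ _ (\int[mu]_(x in S) (`|u x| `^ (p * beta))%:E)%E).
    apply: ge0_le_integral => //.
    - by move=> x _; rewrite lee_fin powR_ge0.
    - exact: measurable_funS mup.
    - move=> x [_ /= xl]; rewrite lee_fin; apply: le_powR.
      + by rewrite mulr_ge0 ?(ltW p0)// (le_trans _ bb1).
      + exact: ltW.
      + exact: ltW.
  apply: ge0_subset_integral => //.
have E1 : 1 <= moser_base `^ moser_exp.
  have ex0 : 0 <= moser_exp.
    have r10 : 0 < p / 2 - 1 by rewrite subr_gt0.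
    have r0 : 0 <= p / 2 by rewrite ltW// (lt_trans _ p12).
    by apply: divr_ge0 (ltW r10); rewrite addr_ge0// divr_ge0// ltW.
  by have := ler_powR moser_base_ge1 ex0; rewrite powRr0.
have Q1 : 1 <= Q.
  apply: (@le_trans _ _ (1 * 1)); first by rewrite mulr1.
  by apply: ler_pM => //; rewrite lerDl moment_ge0.
have Qp : 0 < Q by exact: lt_le_trans Q1.
have Ql : Q < lam `^ th.
  have := gt0_ltr_powR th0 _ _ Qlam; rewrite powRVK//; apply.
    by rewrite nnegrE powR_ge0.
  by rewrite nnegrE ltW.
have lam1 : 1 <= lam.
  apply: ltW; apply: le_lt_trans Qlam.
  by have := @le_powR _ 1 Q th^-1 _ ler01 Q1; rewrite powR1; apply; rewrite invr_ge0 ltW.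
apply: (@powR_exp_unbounded R (p / 2) (lam `^ th / Q)) => //.
  by rewrite ltr_pdivlMr// mul1r.
move=> k.
have rk0 : 0 <= (p / 2) ^+ k by rewrite exprn_ge0// ltW// (lt_trans _ p12).
have -> : (lam `^ th / Q) `^ ((p / 2) ^+ k) = (lam `^ th) `^ ((p / 2) ^+ k) / Q `^ ((p / 2) ^+ k).
  rewrite powRM ?powR_ge0// ?invr_ge0//; congr (_ * _).
  by rewrite -(powR_inv1 Q0) -powRrM mulN1r powRN.
rewrite mulrA ler_pdivrMr ?powR_gt0// mul1r.
have := moser_iteration k (erefl beta1).
rewrite [_ * moser_base `^ _]mulrC -/Q; apply: le_trans.
set bk := 1 + (beta1 - 1) * _.
have bk1 : 1 <= bk by rewrite lerDl mulr_ge0// ltW.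
apply: (@le_trans _ _ (moment bk)); last by rewrite lerDr.
apply: le_trans (cheb bk bk1); apply: ler_wpM2l => //.
rewrite -powRrM; apply: ler_powR => //.
by rewrite /th /bk -mulrA ler_pM2l// lerDr.
Qed.

End higher_integrability.

Lemma Lnormy_le d (T : measurableType d) (R : realType) (mu : {measure set T -> \bar R})
    (A : set T) (u : T -> R) (B : R) : 0 <= B ->
  (forall lam, B < lam -> {ae mu, forall x, A x -> `|u x| <= lam}) ->
  ('N[mu]_+oo[EFin \o (u \_ A)] <= B%:E)%E.
Proof.
move=> B0 h; rewrite unlock; case: ifP => _; last by rewrite lee_fin.
apply/lee_addgt0Pr => e e0; apply/ess_sup_inf.ess_supP.
have Be : B < B + e by rewrite ltrDl.
apply: filterS (h _ Be) => x hx /=; rewrite -EFinD lee_fin patchE.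
case: ifPn => [/set_mem Ax|_]; first exact: hx.
by rewrite normr0 addr_ge0// ltW.
Qed.

(** * Application to weak solutions *)

Section solutions.
Context {R : realType} {n : nat} (Omega : set 'rV[R]_n).
Hypotheses (oO : open Omega) (bO : bounded_set Omega).
Local Notation mu := (@leb R n).

Let mO : measurable (Omega : set (Rn n)).
Proof. exact: bounded_open_measurable. Qed.

(** Since [|t|^(q-1) <= 1 + |t|^(p-1)], the argument can run with the single exponent [p], at the
    price of doubling [c]. *)
Lemma growth_le (c q p : R) (g : 'rV[R]_n -> R -> R) : 0 < c -> 1 <= q -> q <= p ->
  growth Omega c q g -> growth Omega (2 * c) p g.
Proof.
move=> c0 q1 qp; apply: filterS => x h Ox t; apply: le_trans (h Ox t) _.
have q10 : 0 <= q - 1 by rewrite subr_ge0.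
have qp1 : q - 1 <= p - 1 by rewrite lerD2r.
have le : `|t| `^ (q - 1) <= 1 + `|t| `^ (p - 1).
  have [t1|/ltW t1] := leP `|t| 1.
    have := le_powR q10 (normr_ge0 t) t1; rewrite powR1 => /le_trans; apply.
    by rewrite lerDl powR_ge0.
  by apply: le_trans (ler_powR t1 qp1) _; rewrite lerDr.
rewrite [2 * c]mulrC -mulrA ler_pM2l// mulr_natl mulr2n.
have := powR_ge0 `|t| (p - 1); move: le; clear.
by set a := _ `^ _; set b := _ `^ _; lra.
Qed.

Variables (p C c s : R) (g : 'rV[R]_n -> R -> R) (u : 'rV[R]_n -> R).
Hypotheses (p2 : 2 < p) (C0 : 0 < C) (c0 : 0 < c).
Hypothesis sob : forall phi D, Cc_infty Omega phi -> 0 <= D ->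
  (\int[mu]_(x in Omega) (\sum_i partial i phi x ^+2)%:E <= D%:E)%E ->
  (\int[mu]_(x in Omega) (`|phi x| `^ p)%:E <= ((C * D) `^ (p / 2))%:E)%E.
Hypotheses (gg : growth Omega c p g) (su : weak_solution s Omega g u).

Let p0 : 0 < p. Proof. exact: lt_trans p2. Qed.
Let Hu : H10 Omega u. Proof. by have [[]] := su. Qed.

Lemma solution_measurable : measurable_fun (Omega : set (Rn n)) u.
Proof. by have [[[]]] := Hu. Qed.

Lemma solution_Lp : (\int[mu]_(x in Omega) (`|u x| `^ p)%:E < +oo)%E.
Proof.
have [Hu1 _] := Hu.
have Lw i : L2 Omega (weak_partial Omega i u) by have [] := weak_partialP i Hu1.
have iS : mu.-integrable Omega (EFin \o (fun x => \sum_(i < n) weak_partial Omega i u x ^+ 2)).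
  have := @integrable_sum _ _ R mu Omega mO _ (index_enum 'I_n) xpredT
    (fun i x => (weak_partial Omega i u x * weak_partial Omega i u x)%:E)
    (fun i _ => L2_mul_integrable oO (Lw i) (Lw i)).
  apply: eq_integrable; first exact: mO.
  by move=> x _; rewrite /= sumEFin.
have fin := integrable_fin_num mO iS.
(* The added 1 makes [D] positive, as [H10_sobolev] requires. *)
pose D := fine (\int[mu]_(x in Omega) (\sum_(i < n) weak_partial Omega i u x ^+ 2)%:E) + 1.
have D0 : 0 < D.
  rewrite ltr_wpDl// fine_ge0// integral_ge0// => x _.
  by rewrite lee_fin sumr_ge0// => i _; exact: sqr_ge0.
have le : (\int[mu]_(x in Omega) (\sum_(i < n) weak_partial Omega i u x ^+ 2)%:E <= D%:E)%E.
  by rewrite -(fineK fin) lee_fin lerDl.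
exact: le_lt_trans (H10_sobolev oO bO p0 sob Hu D0 le) (ltry _).
Qed.

(** Establishes the hypothesis of the iteration with [M = 3 C]: the energy inequality at the
    exponent [beta - 1] controls the gradient of the truncated power at the exponent
    [(beta - 1) / 2], to which the Sobolev inequality applies. *)
Lemma solution_key beta e dl B : 1 <= beta -> 0 < e -> 0 < dl -> 0 < B ->
  (\int[mu]_(x in Omega) (c * (1 + `|u x| `^ (p - 1)) * `|tpow e dl (beta - 1) (u x)|)%:E
     <= B%:E)%E ->
  (\int[mu]_(x in Omega) (`|tpow e dl ((beta - 1) / 2) (u x)| `^ p)%:E
     <= ((3 * C * (beta ^+ 2 * B)) `^ (p / 2))%:E)%E.
Proof.
move=> b1 e0 d0 B0 HB.
have r0 : 0 <= beta - 1 by rewrite subr_ge0.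
have r20 : 0 <= (beta - 1) / 2 by rewrite divr_ge0.
have [Hu1 _] := Hu.
have ch := chainable_tpow e0 d0 r20 n.
have cF := chainable_tpow e0 d0 r0 n.
have mw i : measurable_fun (Omega : set (Rn n)) (weak_partial Omega i u).
  by have [[]] := weak_partialP i Hu1.
have [_ mF1] := chain_measurable cF solution_measurable.
have [_ mh1] := chain_measurable ch solution_measurable.
have en := le_trans (energy oO bO c0 gg su cF (dtpow_ge0 e0 d0 r0)) HB.
rewrite (_ : 3 * C * _ = C * (3 * (beta ^+ 2 * B))); last by ring.
apply: (chain_sobolev oO bO p0 sob ch Hu); first by rewrite mulr_gt0// exprn_gt0// (lt_le_trans _ b1).
apply: (integral_le_scale mO _ _ _ _ (sqr_ge0 beta) _ en).
- by apply: measurable_sum => i; apply: measurable_funX; exact: measurable_funM.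
- by apply: measurable_sum => i; apply: (measurable_funM mF1); exact: measurable_funX.
- by move=> x _; apply: sumr_ge0 => i _; exact: sqr_ge0.
- by move=> x _; apply: sumr_ge0 => i _; rewrite mulr_ge0 ?sqr_ge0 ?dtpow_ge0.
- move=> x _; rewrite mulr_sumr; apply: ler_sum => i _.
  rewrite exprMn mulrA; apply: ler_wpM2r; first exact: sqr_ge0.
  (* Squaring [dtpow_le] gives [beta^2 zed^(beta-1)], and [dtpow_ge] at the exponent [beta - 1]
     bounds this by [beta^2] times the derivative of the test function. *)
  apply: (@le_trans _ _ ((beta * zed e dl (u x) `^ ((beta - 1) / 2)) ^+ 2)).
    apply: lerXn2r; rewrite ?nnegrE ?dtpow_ge0//.
      by rewrite mulr_ge0 ?powR_ge0// (le_trans _ b1).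
    have := dtpow_le e0 d0 r20 (u x).
    by rewrite (_ : 1 + 2 * ((beta - 1) / 2) = beta)//; field.
  rewrite exprMn; apply: ler_wpM2l; first exact: sqr_ge0.
  rewrite expr2 -powRD ?(gt_eqF (zed_gt0 e0 d0 (u x))) ?implybT//.
  by rewrite -splitr; exact: dtpow_ge.
Qed.

Let M0 : 0 < 3 * C. Proof. by rewrite mulr_gt0. Qed.

Lemma solution_moments beta : 1 <= beta ->
  (\int[mu]_(x in Omega) (`|u x| `^ (p * beta))%:E < +oo)%E.
Proof.
exact: (all_moments mO (leb_bounded oO bO) solution_measurable p2 c0 M0 solution_Lp solution_key).
Qed.

Lemma solution_Linfty_norm beta1 : beta1 = (p + 1) / 2 ->
  (Linfty_norm Omega u <=
   ((moser_base mu Omega p c (3 * C) `^ moser_exp p) `^ (p * (beta1 - 1))^-1)%:E *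
     (1 + \int[mu]_(x in Omega) (`|u x| `^ (p * beta1))%:E) `^ (p * (beta1 - 1))^-1%R)%E.
Proof.
move=> ->.
have b1 : 1 <= ((p + 1) / 2) by rewrite ler_pdivlMr// mul1r (le_trans (ltW p2))// lerDl.
have I0 : (0 <= \int[mu]_(x in Omega) (`|u x| `^ (p * ((p + 1) / 2)))%:E)%E.
  by apply: integral_ge0 => x _; rewrite lee_fin powR_ge0.
have fin : (\int[mu]_(x in Omega) (`|u x| `^ (p * ((p + 1) / 2)))%:E)%E \is a fin_num.
  by rewrite ge0_fin_numE//; exact: solution_moments.
rewrite -(fineK fin) -EFinD poweR_EFin -EFinM -powRM ?powR_ge0//; last first.
  by rewrite addr_ge0// fine_ge0.
apply: Lnormy_le; first exact: powR_ge0.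
move=> lam; exact: (moser_ae_bound mO (leb_bounded oO bO) solution_measurable p2 c0 M0
  solution_Lp solution_key).
Qed.

End solutions.

Section critical_exponent.
Context {R : realType} (n : nat) (q : R).
Hypothesis q_le : (q%:E <= two_star R n)%E.

(** The middle inequality is the condition under which [sobolev] applies: an equality at
    [p = 2n/(n-2)], while for [n <= 2] its left side is at most [p - 2]. *)
Lemma critical_exponentP (p : R) : critical_exponent n q p ->
  [/\ 2 < p, n%:R * (p / 2 - 1) <= p & q <= p].
Proof.
move: q_le; rewrite /critical_exponent /two_star; case: ifPn => n2.
  have n20 : (0 : R) < n%:R - 2 by rewrite subr_gt0 ltr_nat.
  rewrite lee_fin => qle [->]; split => //.
  - by rewrite ltr_pdivlMr// ltr_pM2l// gtrBl.
  - rewrite le_eqVlt; apply/orP; left; apply/eqP; field.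
    by rewrite gt_eqF.
move=> _ [p2 qp]; split => //.
have le2 : n%:R <= (2 : R) by rewrite ler_nat leqNgt.
have p20 : 0 <= p / 2 - 1 by rewrite subr_ge0 ler_pdivlMr// mul1r ltW.
apply: le_trans (ler_wpM2r p20 le2) _; rewrite (_ : 2 * _ = p - 2); last by field.
by rewrite gerBl.
Qed.

Lemma critical_exponent_exists : exists p : R, critical_exponent n q p.
Proof.
rewrite /critical_exponent /two_star; case: ifPn => n2; first by eexists.
by exists (Num.max q 3); rewrite lt_max le_max lexx ltr_nat orbT.
Qed.

End critical_exponent.

(** The constant is fixed before [s], [g] and [u]: it is assembled from [p], the measure of [Omega],
    [2 c] (from [growth_le]) and [3 C] (from [H10_sobolev]), where [C] is the Sobolev constant. *)
Lemma Linfty_norm_bound (R : realType) (n : nat) (Omega : set 'rV[R]_n) (c q p : R)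
    (n_gt0 : (0 < n)%N) (oO : open Omega) (bO : bounded_set Omega)
    (c_gt0 : 0 < c) (q_ge1 : 1 <= q) (q_le : (q%:E <= two_star R n)%E) :
  critical_exponent n q p -> exists2 C0 : R, 0 < C0 &
  forall s g u beta1, growth Omega c q g -> weak_solution s Omega g u -> beta1 = (p + 1) / 2 ->
    [/\ measurable_fun (Omega : set (Rn n)) u,
      (\int[leb n]_(x in Omega) (`|u x| `^ (p * beta1))%:E < +oo)%E &
      (Linfty_norm Omega u <=
        C0%:E * (1 + \int[leb n]_(x in Omega) (`|u x| `^ (p * beta1))%:E)
                  `^ (p * (beta1 - 1))^-1%R)%E].
Proof.
move=> /(critical_exponentP q_le)[p2 np qp].
have [C C0 sob] := sobolev n_gt0 oO bO p2 np.
have c20 : 0 < 2 * c by rewrite mulr_gt0.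
have M0 : 0 < 3 * C by rewrite mulr_gt0.
have b1 : 1 <= (p + 1) / 2 by rewrite ler_pdivlMr// mul1r (le_trans (ltW p2))// lerDl.
have base := moser_base_ge1 (@leb R n) Omega p2 c20 M0.
exists ((moser_base (@leb R n) Omega p (2 * c) (3 * C) `^ moser_exp p) `^
   (p * ((p + 1) / 2 - 1))^-1).
  by apply: powR_gt0; apply: powR_gt0; exact: lt_le_trans base.
move=> s g u beta1 /(growth_le c_gt0 q_ge1 qp) gg su ->.
split.
- exact: (solution_measurable su).
- exact: (solution_moments oO bO p2 C0 c20 sob gg su b1).
- exact: (solution_Linfty_norm oO bO p2 C0 c20 sob gg su (erefl _)).
Qed.

Theorem theorem1p1 (R : realType) (n : nat) (Omega : set 'rV[R]_n) (c q : R)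
    (n_gt0 : (0 < n)%N) (openOmega : open Omega) (bndOmega : bounded_set Omega)
    (c_gt0 : 0 < c) (q_ge1 : 1 <= q) (q_le : (q%:E <= two_star R n)%E) :
  (forall (s : R) (g : 'rV[R]_n -> R -> R) (u : 'rV[R]_n -> R),
     0 < s -> s < 1 -> growth Omega c q g -> weak_solution s Omega g u ->
     Linfty Omega u) /\
  (forall p : R, critical_exponent n q p ->
   let beta1 := (p + 1) / 2 in
   exists C0 : R, 0 < C0 /\
   forall (s : R) (g : 'rV[R]_n -> R -> R) (u : 'rV[R]_n -> R),
     0 < s -> s < 1 -> growth Omega c q g -> weak_solution s Omega g u ->
     (Linfty_norm Omega u <=
        C0%:E * (1 + \int[leb n]_(x in Omega) (`|u x| `^ (p * beta1))%:E)
                  `^ (p * (beta1 - 1))^-1%R)%E).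
Proof.
split.
- move=> s g u _ _ gg su.
  have [p cp] := critical_exponent_exists n q.
  have [C0 C00 H] := Linfty_norm_bound n_gt0 openOmega bndOmega c_gt0 q_ge1 q_le cp.
  have [mu_ fin le] := H s g u _ gg su (erefl _).
  split; first exact: mu_.
  apply: (le_lt_trans le).
  apply: lte_mul_pinfty; [by rewrite lee_fin ltW|by []|].
  by apply: poweR_lty; apply: lte_add_pinfty; [exact: ltry|exact: fin].
- move=> p cp beta1.
  have [C0 C00 H] := Linfty_norm_bound n_gt0 openOmega bndOmega c_gt0 q_ge1 q_le cp.
  exists C0; split=> // s g u _ _ gg su.
  by have [] := H s g u beta1 gg su (erefl _).
Qed.
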